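(* Suppose that $\big(k,\ell,r,\delta,(n_0,u_0,\kappa_0,\lambda_0)\big)$ is a $p$-adic exponent datum. Let $\delta'=1$ if $\ell=k+\frac12$, and $\delta'=0$ otherwise. (1) If $\ell\ge k+\frac12$, then, for every prime $p$, every integer $\kappa\ge\max\big(\kappa_0(1,p),1+\iota'(2)\big)$, every $\lambda\in\rho_p\mathbb N$ with $\lambda\ge\lambda_0(1,p)$, and with $r=r(1,p,\kappa,\lambda)$, and for every $n\ge\max\big(n_0(1,p,\kappa,\lambda)+\kappa,\,2\kappa\big)$ and every primitive Dirichlet character $\chi$ modulo $q=p^n$, $$L\left(\tfrac12,\chi\right)\ll p^{r+\kappa(1-k-\ell)}\big(p^n\big)^{\frac{k+\ell}2-\frac14}(\log q)^{\delta+\delta'}.$$ (2) If $\ell<k+\frac12$, then, for every prime $p$, every integer $\kappa\ge\max\big(\kappa_0(1,p),\lambda_0(1,p),1+\iota'(4)\big)$ and with $r=r(1,p,\kappa,\kappa)$, and for every $n\ge\max\big(n_0(1,p,\kappa,\kappa)+\kappa,\,2\kappa+1+\iota'(12)\big)$ and every primitive Dirichlet character $\chi$ modulo $q=p^n$, $$L\left(\tfrac12,\chi\right)\ll p^{r+\kappa(1-k-\ell)}\big(p^n\big)^{\frac{k+\ell}2-\frac14}(\log q)^{\delta}.$$ The implied constants depend only on the datum.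
   Context: Notation. $\mathbb N=\{1,2,\dots\}$, $\mathbb Q^+$ is the set of positive rationals, $\mathbb R^+_0=[0,\infty)$, $P$ is the set of primes. For a prime $p$: $\rho_p=1/(p-1)$; $e(x)=e^{2\pi i x}$, also extended from $\mathbb Z[1/p]$ to the unique $\mathbb Z_p$-periodic function on $\mathbb Q_p$. For $y\in\mathbb Q^+$: $\iota(y)=\max(0,-\mathrm{ord}_p y)$, $\iota'(y)=\max(0,\mathrm{ord}_p y)$ (these depend on $p$); $\iota,\iota'$ stand for $\iota(y),\iota'(y)$ when $y$ is clear. Power series. $\mathbf I_0(\mathbb Z_p)$ is the set of power series $\sum_{k\ge0}a_kt^k$ with $a_k\in\mathbb Z_p$ and $|a_k|_p\to0$; for real $\lambda\ge 0$, $\mathbf I_0[\lambda](\mathbb Z_p)=\{a\in\mathbf I_0(\mathbb Z_p):\mathrm{ord}_pa_k\ge\lceil k\lambda\rceil\ \forall k\ge0\}$. $(1+x)^y=\sum_k\binom yk x^k$. Class $\mathbf F$. Let $w\in\mathbb Z$, $u,\kappa\in\mathbb N$ with $\kappa\ge1+\iota'(2)$, $\lambda\in\rho_p\mathbb N$, $y\in\mathbb Q^+$, $\omega,\omega'\in\mathbb Z_p^\times$. A power series $f\in\mathbb Q_p^\times\mathbf I_0(\mathbb Z_p)$ belongs to $\mathbf F(w,y,\kappa,\lambda,u,\omega,\omega')$ if $$f'(t)=p^w\omega'(1+p^{\iota+\kappa}\omega t)^{-y}+p^w\gamma_0+p^{u+w}g(t)$$ for some $\gamma_0\in\mathbb Z_p$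 and $g\in\mathbf I_0[\lambda](\mathbb Z_p)$. $f\in\mathbf F(w,y,\kappa,\lambda,u)$ means $f\in\mathbf F(w,y,\kappa,\lambda,u,\omega,\omega')$ for some $\omega,\omega'\in\mathbb Z_p^\times$. Parameter functions. For a set $Y$, $\mathbf J(Y)$ is the set of functions $g:\mathbb Q^+\times P\to Y$ such that for every $y$ there are a finite $P_0(y)\subset P$ and a function $g_0:P\setminus P_0(y)\to Y$ with $g(y,p)=g_0(p)$ for all $p\in P\setminus P_0(y)$. Similarly $\mathbf J_1(Y)$ is the set of functions $g(y,p,\kappa,\lambda)\in Y$ defined for $y\in\mathbb Q^+$, $p\in P$, $\kappa\in\iota'(2)+\mathbb N$, $\lambda\in\rho_p\mathbb N$, such that for every $y$ there are a finite $P_0(y)\subset P$ and a function $g_0$ on $(P\setminus P_0(y))\times X$, $X=\mathbb N\times\mathbb R^+$, with $g(y,p,\kappa,\lambda)=g_0(p,\kappa,\lambda)$ for all $p\in P\setminus P_0(y)$ and all admissible $\kappa,\lambda$. $p$-adic exponent data. Let $q=(k,\ell,r,\delta,(n_0,u_0,\kappa_0,\lambda_0))$ with $k,\ell\in\mathbb R$, $0\le k\le\frac12\le\ell\le1$, $r\in\mathbf J_1(\mathbb R)$, $\delta\in\mathbb R_0^+$, $n_0,u_0\in\mathbf J_1(\mathbb N)$, $\kappa_0\in\mathbf J(\mathbb N)$, $\lambda_0\in\mathbf J(\mathbb R_0^+)$, and $n_0(y,p,\kappa,\lambda)>\kappa+\iota'(y)$. Such $q$ is a $p$-adic exponent datum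 if, for every $p\in P$, $y\in\mathbb Q^+$, $w\in\mathbb Z$, $\kappa\in\mathbb N$ with $\kappa\ge1+\iota'(2)$, $\lambda\in\rho_p\mathbb N$, $n,u\in\mathbb N$ with $$\kappa\ge\kappa_0(y,p),\quad\lambda\ge\lambda_0(y,p),\quad n\ge w+n_0(y,p,\kappa,\lambda),\quad u\ge u_0(y,p,\kappa,\lambda),$$ and for every $f\in\mathbf F(w,y,\kappa,\lambda,u)$, $M\in\mathbb Z$, and $0<B\le p^{n-w-\kappa-\iota'}$, $$\sum_{M<m\le M+B}e\left(\frac{f(m)}{p^n}\right)\ll p^{r}\left(\frac{p^{n-w-\kappa-\iota'}}B\right)^kB^{\ell}\big(\log p^{n-w-\kappa-\iota'}\big)^{\delta},$$ where $r=r(y,p,\kappa,\lambda)$ and the implied constant depends only on the datum. (In the claim, $q$ denotes the modulus $p^n$.) *)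

(* Defs.v *)
From HB Require Import structures.
From mathcomp Require Import all_boot all_order all_algebra.
From mathcomp Require Import all_classical all_reals all_analysis.
From mathcomp Require Import complex.

Set Implicit Arguments.
Unset Strict Implicit.
Unset Printing Implicit Defensive.

Import Order.TTheory GRing.Theory Num.Theory.
Import numFieldNormedType.Exports.

Local Open Scope classical_set_scope.
Local Open Scope ring_scope.
Local Open Scope complex_scope.

Record prime_nat := PrimeNat { prime_val :> nat; prime_valP : prime prime_val }.

Lemma modz_dvdm (m n d : int) : (d %| m)%Z -> modz (modz n m) d = modz n d.
Proof.
by case/dvdzP => c ->; rewrite [in RHS](divz_eq n (c * d)) mulrA modzMDl.
Qed.

Definition ppow (p : prime_nat) (n : nat) : int := (p ^ n)%N.

(* Z_p is the inverse limit of the rings Z/p^n: an element is the sequence of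
   its residues modulo p^n, represented in [0, p^n[. *)
Section PadicIntegers.
Variable p : prime_nat.

Local Notation pe n := (ppow p n).

Record Zpadic := MkZp {
  residue : nat -> int;
  residueP : forall n, residue n = modz (residue n.+1) (ppow p n) }.

Lemma Zp_ext (x y : Zpadic) : (forall n, residue x n = residue y n) -> x = y.
Proof.
case: x y => [x hx] [y hy] /= /funext exy.
by case: _ / exy hy => hy; congr MkZp; exact: Prop_irrelevance.
Qed.

HB.instance Definition _ := gen_eqMixin Zpadic.
HB.instance Definition _ := gen_choiceMixin Zpadic.

Lemma pe_gt0 n : 0 < pe n.
Proof. by rewrite /ppow ltz_nat expn_gt0 prime_gt0 ?prime_valP. Qed.

Lemma pe_neq0 n : pe n != 0.
Proof. by rewrite gt_eqF // pe_gt0. Qed.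

Lemma pe_dvd m n : (m <= n)%N -> (pe m %| pe n)%Z.
Proof. by move=> lmn; rewrite /ppow dvdzE /= dvdn_exp2l. Qed.

Lemma residue_modS (x : Zpadic) n :
  modz (residue x n.+1) (pe n) = modz (residue x n) (pe n).
Proof. by rewrite [in RHS](residueP x n) modz_mod. Qed.

Lemma residue_mod (x : Zpadic) n : (residue x n %% pe n)%Z = residue x n.
Proof. by rewrite (residueP x n) modz_mod. Qed.

Lemma mkZp_subproof (f : nat -> int) :
    (forall n, modz (f n.+1) (pe n) = modz (f n) (pe n)) ->
  forall n, modz (f n) (pe n) = modz (modz (f n.+1) (pe n.+1)) (pe n).
Proof. by move=> hf n; rewrite modz_dvdm ?hf // pe_dvd. Qed.

Definition mkZp f hf := MkZp (@mkZp_subproof f hf).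

Lemma mkZp_constP (m : int) n : modz m (pe n) = modz m (pe n).
Proof. by []. Qed.

Definition Zp_of_int (m : int) := mkZp (f := fun=> m) (mkZp_constP m).

Lemma addZpP (x y : Zpadic) n :
  modz (residue x n.+1 + residue y n.+1) (pe n) =
  modz (residue x n + residue y n) (pe n).
Proof. by rewrite -modzDm !residue_modS modzDm. Qed.

Definition addZp x y := mkZp (addZpP x y).

Lemma oppZpP (x : Zpadic) n :
  modz (- residue x n.+1) (pe n) = modz (- residue x n) (pe n).
Proof. by rewrite -modzNm residue_modS modzNm. Qed.

Definition oppZp x := mkZp (oppZpP x).

Lemma mulZpP (x y : Zpadic) n :
  modz (residue x n.+1 * residue y n.+1) (pe n) =
  modz (residue x n * residue y n) (pe n).
Proof. by rewrite -modzMm !residue_modS modzMm. Qed.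

Definition mulZp x y := mkZp (mulZpP x y).

Lemma addZpA : associative addZp.
Proof. by move=> x y z; apply: Zp_ext => n /=; rewrite modzDml modzDmr addrA. Qed.

Lemma addZpC : commutative addZp.
Proof. by move=> x y; apply: Zp_ext => n /=; rewrite addrC. Qed.

Lemma add0Zp : left_id (Zp_of_int 0) addZp.
Proof. by move=> x; apply: Zp_ext => n /=; rewrite mod0z add0r residue_mod. Qed.

Lemma addNZp : left_inverse (Zp_of_int 0) oppZp addZp.
Proof. by move=> x; apply: Zp_ext => n /=; rewrite modzDml addNr. Qed.

HB.instance Definition _ := GRing.isZmodule.Build Zpadic addZpA addZpC add0Zp addNZp.

Lemma mulZpA : associative mulZp.
Proof. by move=> x y z; apply: Zp_ext => n /=; rewrite modzMml modzMmr mulrA. Qed.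

Lemma mulZpC : commutative mulZp.
Proof. by move=> x y; apply: Zp_ext => n /=; rewrite mulrC. Qed.

Lemma mul1Zp : left_id (Zp_of_int 1) mulZp.
Proof. by move=> x; apply: Zp_ext => n /=; rewrite modzMml mul1r residue_mod. Qed.

Lemma mulZpDl : left_distributive mulZp +%R.
Proof.
by move=> x y z; apply: Zp_ext => n /=; rewrite modzMml modzDm mulrDl.
Qed.

Lemma oneZp_neq0 : Zp_of_int 1 != 0.
Proof.
apply/eqP => /(congr1 (fun x => residue x 1)) /=.
rewrite mod0z modz_small // /ppow expn1 /= ltz_nat.
exact: prime_gt1 (prime_valP p).
Qed.

HB.instance Definition _ := GRing.Zmodule_isComNzRing.Build Zpadic
  mulZpA mulZpC mul1Zp mulZpDl oneZp_neq0.

Definition Zp_unit : pred Zpadic := fun x => `[< exists y, y * x = 1 >].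
Definition Zp_inv (x : Zpadic) : Zpadic :=
  if Zp_unit x then xget 0 [set y | y * x = 1] else x.

Lemma mulVZp : {in Zp_unit, left_inverse 1 Zp_inv *%R}.
Proof.
move=> x xu; have [y yx] := asboolW xu.
rewrite /Zp_inv ifT //; case: xgetP => [z _ //|/(_ y) h].
by case: h.
Qed.

Lemma Zp_unitPl (x y : Zpadic) : y * x = 1 -> Zp_unit x.
Proof. by move=> yx; apply/asboolP; exists y. Qed.

Lemma Zp_inv_out : {in [predC Zp_unit], Zp_inv =1 id}.
Proof. by move=> x; rewrite inE /Zp_inv => /negbTE xu; rewrite ifF. Qed.

HB.instance Definition _ :=
  GRing.ComNzRing_hasMulInverse.Build Zpadic mulVZp Zp_unitPl Zp_inv_out.

Lemma residueD (x : Zpadic) m n :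
  modz (residue x (m + n)) (pe m) = modz (residue x m) (pe m).
Proof.
elim: n => [|n IHn]; first by rewrite addn0.
rewrite addnS -IHn -(modz_dvdm (residue x (m + n).+1) (pe_dvd (leq_addr n m))).
by rewrite residue_modS modz_dvdm // pe_dvd // leq_addr.
Qed.

Lemma residue_neq0 (x : Zpadic) m n : residue x m != 0 ->
  residue x (m + n) != 0 /\ (logn p `|residue x (m + n)| < m)%N.
Proof.
move=> xm; have : ~~ (pe m %| residue x (m + n))%Z.
  by apply: contra xm => /dvdz_mod0P; rewrite residueD residue_mod => ->.
case: eqVneq => [->|xmn]; first by rewrite dvdz0.
by rewrite dvdzE /= pfactor_dvdn ?prime_valP ?absz_gt0 // -ltnNge.
Qed.

Lemma Zp_idomain : GRing.integral_domain_axiom Zpadic.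
Proof.
move=> x y xy0; apply/norP => -[/eqP x0 /eqP y0].
have ex_res (z : Zpadic) : z <> 0 -> exists n, residue z n != 0.
  move=> z0; apply/not_existsP => hz; apply: z0; apply: Zp_ext => n /=.
  by rewrite mod0z; apply/eqP/negPn/negP/hz.
have [m xm] := ex_res _ x0; have [n yn] := ex_res _ y0.
have [xmn lx] := residue_neq0 n xm.
have := residue_neq0 m yn; rewrite addnC => -[ymn ly].
have /(congr1 (fun z => residue z (m + n))) /= := xy0.
rewrite mod0z => /dvdz_mod0P; rewrite dvdzE abszM /=.
rewrite pfactor_dvdn ?prime_valP ?muln_gt0 ?absz_gt0 ?xmn ?ymn //.
by rewrite lognM ?absz_gt0 // leqNgt -addnS leq_add // ltnW.
Qed.

HB.instance Definition _ := GRing.ComUnitRing_isIntegral.Build Zpadic Zp_idomain.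

End PadicIntegers.

Notation Qpadic p := {fraction (Zpadic p)}.

Section PadicNumbers.
Variable p : prime_nat.

Local Notation Qp := (Qpadic p).

Definition toQp (x : Zpadic p) : Qp := tofrac x.

(* ord_p x >= m, that is x \in p^m Z_p; it holds for every m when x = 0. *)
Definition ord_ge (x : Qp) (m : int) : Prop :=
  exists z : Zpadic p, x = p%:R ^ m * toQp z.

Definition padic_series_sum (v : nat -> Qp) (s : Qp) : Prop :=
  forall m : int, \forall n \near \oo, ord_ge (\sum_(0 <= i < n) v i - s) m.

(* A formal power series is the sequence of its coefficients; its value is set
   to 0 where it diverges. *)
Definition padic_eval (f : nat -> Qp) (x : Qp) : Qp :=
  xget 0 [set s | padic_series_sum (fun i => f i * x ^+ i) s].

Definition deriv_series (f : nat -> Qp) : nat -> Qp :=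
  fun i => f i.+1 *+ i.+1.

Definition gbinom (y : rat) (i : nat) : rat :=
  (\prod_(0 <= j < i) (y - j%:R)) / i`!%:R.

(* The series (1 + c t)^y. *)
Definition binom_series (c : Qp) (y : rat) : nat -> Qp :=
  fun i => ratr (gbinom y i) * c ^+ i.

Definition const_series (c : Qp) : nat -> Qp := fun i => if i == 0%N then c else 0.

Definition I0 (a : nat -> Zpadic p) : Prop :=
  forall m : nat, \forall i \near \oo, ord_ge (toQp (a i)) m.

Definition I0_ge (R : realType) (lambda : R) (a : nat -> Zpadic p) : Prop :=
  I0 a /\ forall i : nat, ord_ge (toQp (a i)) (Num.ceil (i%:R * lambda)).

Definition ordq (y : rat) : int :=
  (logn p `|numq y|)%:Z - (logn p `|denq y|)%:Z.

(* iota_ and iota' count the factors p of the denominator and the numerator. *)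
Definition iota_ (y : rat) : nat := absz (Num.max 0 (- ordq y)).
Definition iota' (y : rat) : nat := absz (Num.max 0 (ordq y)).

Definition rho (R : realType) : R := (p%:R - 1)^-1.

Definition rhoN (R : realType) (lambda : R) : Prop :=
  exists2 j : nat, (0 < j)%N & lambda = rho R * j%:R.

Definition class_F (R : realType) (w : int) (y : rat) (kappa : nat)
    (lambda : R) (u : nat) (f : nat -> Qp) : Prop :=
  (exists c : Qp, c != 0 /\
     exists2 a : nat -> Zpadic p, I0 a & forall i, f i = c * toQp (a i)) /\
  exists omega omega' : Zpadic p,
    [/\ omega \is a GRing.unit, omega' \is a GRing.unit &
     exists (gamma0 : Zpadic p) (g : nat -> Zpadic p), I0_ge lambda g /\
       forall i, deriv_series f i =
         p%:R ^ w * toQp omega' *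
           binom_series (p%:R ^+ (iota_ y + kappa) * toQp omega) (- y) i
         + const_series (p%:R ^ w * toQp gamma0) i
         + p%:R ^ (u%:Z + w) * toQp (g i)].

Definition cexp (R : realType) (z : R[i]) : R[i] :=
  (expR (complex.Re z))%:C * (cos (complex.Im z) +i* sin (complex.Im z)).

Definition e_real (R : realType) (x : R) : R[i] := cexp ((2 * pi * x)%:C * 'i).

(* Every x \in Q_p differs from some r \in Z[1/p] by an element of Z_p, and r is
   unique modulo Z; hence the choice of r below does not matter. *)
Definition e_padic (R : realType) (x : Qp) : R[i] :=
  e_real (ratr (xget 0 [set r : rat |
    (exists (a : int) (j : nat), r = a%:~R / p%:R ^+ j) /\
    exists z : Zpadic p, x - ratr r = toQp z])).

End PadicNumbers.

Section ParameterFunctions.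
Variables (R : realType) (T : Type).

(* As in the definition followed here, g0 may depend on y. *)
Definition param_J (Y : set T) (g : rat -> prime_nat -> T) : Prop :=
  (forall (y : rat) (p : prime_nat), 0 < y -> Y (g y p)) /\
  (forall y : rat, 0 < y ->
     exists2 P0 : set prime_nat, finite_set P0 &
     exists g0 : prime_nat -> T,
       forall p : prime_nat, ~ P0 p -> g y p = g0 p).

Definition admissible (p : prime_nat) (kappa : nat) (lambda : R) : Prop :=
  (1 + iota' p 2%R <= kappa)%N /\ rhoN p lambda.

Definition param_J1 (Y : set T) (g : rat -> prime_nat -> nat -> R -> T) : Prop :=
  (forall (y : rat) (p : prime_nat) (kappa : nat) (lambda : R),
     0 < y -> admissible p kappa lambda -> Y (g y p kappa lambda)) /\
  (forall y : rat, 0 < y ->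
     exists2 P0 : set prime_nat, finite_set P0 &
     exists g0 : prime_nat -> nat -> R -> T,
       forall (p : prime_nat) (kappa : nat) (lambda : R),
         ~ P0 p -> admissible p kappa lambda ->
         g y p kappa lambda = g0 p kappa lambda).

End ParameterFunctions.

(* The integers m with M < m <= M + B are M + 1, ..., M + floor B. *)
Definition exp_sum (R : realType) (p : prime_nat) (f : nat -> Qpadic p) (n : nat)
    (M : int) (B : R) : R[i] :=
  \sum_(0 <= j < Num.truncn B)
    e_padic R (padic_eval f (M + j.+1%:Z)%:~R / p%:R ^+ n).

Definition padic_exponent_datum (R : realType) (k l : R)
    (r : rat -> prime_nat -> nat -> R -> R) (delta : R)
    (n0 u0 : rat -> prime_nat -> nat -> R -> nat)
    (kappa0 : rat -> prime_nat -> nat) (lambda0 : rat -> prime_nat -> R) : Prop :=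
  [/\ [/\ 0 <= k, k <= 2^-1, 2^-1 <= l, l <= 1 & 0 <= delta],
      [/\ param_J1 setT r,
          param_J1 [set n | (0 < n)%N] n0, param_J1 [set u | (0 < u)%N] u0,
          param_J [set n | (0 < n)%N] kappa0 & param_J [set x | 0 <= x] lambda0],
      forall (y : rat) (p : prime_nat) (kappa : nat) (lambda : R),
        0 < y -> admissible p kappa lambda ->
        (kappa + iota' p y < n0 y p kappa lambda)%N &
      exists C : R,
      forall (p : prime_nat) (y : rat) (w : int) (kappa : nat) (lambda : R)
        (n u : nat),
        0 < y -> (1 + iota' p 2%R <= kappa)%N -> rhoN p lambda ->
        (0 < n)%N -> (0 < u)%N ->
        (kappa0 y p <= kappa)%N -> lambda0 y p <= lambda ->
        w + (n0 y p kappa lambda)%:Z <= n%:Z -> (u0 y p kappa lambda <= u)%N ->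
      forall f : nat -> Qpadic p, class_F w y kappa lambda u f ->
      forall (M : int) (B : R),
        let Q : R := p%:R ^ (n%:Z - w - kappa%:Z - (iota' p y)%:Z) in
        0 < B -> B <= Q ->
        `| exp_sum f n M B | <=
          (C * (p%:R `^ r y p kappa lambda * (Q / B) `^ k * B `^ l
                * ln Q `^ delta))%:C].

Definition dirichlet_character (R : realType) (q : nat) (chi : int -> R[i]) : Prop :=
  [/\ forall m n : int, chi (m * n) = chi m * chi n,
      forall m : int, chi (m + q%:Z) = chi m &
      forall m : int, (chi m != 0) = coprimez m q].

Definition primitive_character (R : realType) (q : nat) (chi : int -> R[i]) : Prop :=
  dirichlet_character q chi /\
  forall d : nat, (d %| q)%N -> (d < q)%N ->
    ~ exists2 psi : int -> R[i], dirichlet_character d psi &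
        forall m : int, coprimez m q -> chi m = psi m.

(* L(s, chi) as the limit of the partial sums of its Dirichlet series, which
   converges for Re s > 0 when chi is not principal. *)
Definition dirichlet_L (R : realType) (chi : int -> R[i]) (s : R[i]) : R[i] :=
  lim ((\sum_(1 <= m < N) chi m%:Z * cexp (- s * (ln m%:R)%:C) : R[i]^o) @[N --> \oo]).

(* Main.v *)
(* Write the sum of chi over an interval as a sum over residue classes m0 mod
   p^kappa: on each class chi(m0 + p^kappa t) = chi(m0) e(al log(1 + p^kappa m t) / p^n)
   is a p-adic phase of the class F with y = 1 and w = kappa, so the datum bounds
   the sums S(x) of chi. The same bound for one term, and for a family of phases
   twisted by additive characters combined with Parseval, shows that the bound to
   be proved is at least a constant times p^(kappa/2).

   The weights m^(-1/2) are replaced by K C(2m,m)/4^m, up to O(m^(-3/2)), because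
   these are the coefficients of the algebraic function sigma(w) = (1-w)^(-1/2).
   So L(1/2,chi) reduces to the limit, as rho tends to 1, of
   V(rho) = sum_m chi(m) C(2m,m) 4^(-m) rho^m, and Gauss sums give
   tau V(rho) = sum_{b mod q} conj(chi(b)) sigma(rho e(b/q)), a substitute for the
   functional equation. Abel summation bounds V(1-1/Y2) - V(1-1/Y1) by
   sum_m |S(m)| m^(-3/2) min(1, m/Y1, Y2/m) in the first form of V, and by the same
   sum with Y1, Y2 replaced by q/Y2, q/Y1 in the second one. If l >= k + 1/2, use the
   first form up to Y = sqrt q and the second one beyond. If l < k + 1/2, the range
   is cut at p^kappa, sqrt q and q/p^kappa, alternating the two forms; on the two
   outer pieces the trivial bound |S(m)| <= m gives O(p^(kappa/2)). *)

From HB Require Import structures.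
Require Import Defs.
From mathcomp Require Import all_boot all_order all_algebra.
From mathcomp Require Import all_classical all_reals all_analysis.
From mathcomp Require Import complex.
From mathcomp Require Import ring lra zify.
From mathcomp Require cyclic.

Set Implicit Arguments.
Unset Strict Implicit.
Unset Printing Implicit Defensive.

Import Order.TTheory GRing.Theory Num.Theory.
Import numFieldNormedType.Exports.
Local Open Scope classical_set_scope.
Local Open Scope ring_scope.
Local Open Scope complex_scope.

(** The datum admits progressions of at most p^(n - 2 kappa) terms, so it controls S(x) up to x =
    q/p^kappa; from there on the bound grows linearly. Put a = l - k. Against the weight m^(-3/2), a
    bound x^a is dominated by the upper end of the range if a > 1/2 and by the lower end if a < 1/2;
    for a = 1/2 all scales contribute equally, whence the extra logarithm. For a < 1/2 short sums
    are therefore the expensive ones, and the cuts are such that the datum is only used with weights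
    concentrated on [sqrt q, q/p^kappa]. The lower bound p^(kappa/2) then pays for the outer pieces,
    and it also absorbs absolute errors such as the sum of m^(-3/2).

    The analysis of sigma is purely algebraic. The principal square root maps Re >= 0 into the
    sector |Im| <= Re, where sums do not cancel; hence differences of sigma are bounded through
    1/(alpha + alpha'), with no derivatives or contour integrals. Likewise the p-adic logarithm only
    enters through an integer, which equals the logarithm series modulo p^n. *)

Section ComplexExp.
Variable R : realType.
Local Notation e := (@e_real R).
Local Notation normc := (@Normc.normc R).

Lemma e_realE (x : R) : e x = cos (2 * pi * x) +i* sin (2 * pi * x).
Proof.
rewrite /e_real /cexp /=; simpc.
by rewrite expR0 !mul1r.
Qed.

Lemma e_realD (x y : R) : e (x + y) = e x * e y.
Proof. by rewrite !e_realE mulrDr cosD sinD; simpc; congr (_ +i* _); rewrite addrC. Qed.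

Lemma e_real0 : e 0 = 1.
Proof. by rewrite e_realE mulr0 cos0 sin0. Qed.

Lemma e_realN (x : R) : e (- x) = conjc (e x).
Proof. by rewrite !e_realE mulrN cosN sinN. Qed.

Lemma e_real_nat (n : nat) : e n%:R = 1.
Proof.
elim: n => [|n IH]; first exact: e_real0.
rewrite -addn1 natrD e_realD IH mul1r e_realE mulr1.
have -> : 2 * pi = pi + pi :> R by ring.
by rewrite cosD sinD cospi sinpi !(mulr0, mul0r) mulrNN mulr1 subr0 addr0.
Qed.

Lemma e_real_int (n : int) : e n%:~R = 1.
Proof.
case: n => n; first exact: e_real_nat.
by rewrite NegzE mulrNz e_realN -pmulrn e_real_nat conjc1.
Qed.

Lemma e_realX (x : R) n : e (n%:R * x) = e x ^+ n.
Proof.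
elim: n => [|n IH]; first by rewrite mul0r e_real0.
by rewrite -addn1 natrD mulrDl mul1r e_realD IH addn1 exprSr.
Qed.

Lemma normc_e_real (x : R) : normc (e x) = 1.
Proof. by rewrite e_realE /= cos2Dsin2 sqrtr1. Qed.

Lemma normrE (z : R[i]) : `|z| = (normc z)%:C.
Proof. by rewrite normc_def; case: z. Qed.

Lemma normc_ge0 (z : R[i]) : 0 <= normc z.
Proof. by case: z => a b /=; rewrite sqrtr_ge0. Qed.

Lemma normcD (x y : R[i]) : normc (x + y) <= normc x + normc y.
Proof. exact: le_normcD. Qed.

Lemma normcB (x y : R[i]) : normc (x - y) <= normc x + normc y.
Proof. by rewrite -(normcN y); exact: normcD. Qed.

Lemma normcX (x : R[i]) n : normc (x ^+ n) = normc x ^+ n.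
Proof. by elim: n => [|n IH]; rewrite ?expr0 ?Normc.normc1 // !exprS Normc.normcM IH. Qed.

Lemma normc_conj (x : R[i]) : normc (conjc x) = normc x.
Proof. by case: x => a b /=; rewrite sqrrN. Qed.

Lemma normc_real (x : R) : normc x%:C = `|x|.
Proof. by rewrite /= expr0n addr0 sqrtr_sqr. Qed.

Lemma normc_sum I (r : seq I) (P : pred I) (F : I -> R[i]) :
  normc (\sum_(i <- r | P i) F i) <= \sum_(i <- r | P i) normc (F i).
Proof.
elim/big_ind2: _ => [|x1 x2 y1 y2 h1 h2|//]; first by rewrite Normc.normc0.
by apply: le_trans (normcD _ _) _; apply: lerD.
Qed.

Lemma normc_sqr (z : R[i]) : (normc z ^+ 2)%:C = z * conjc z.
Proof. by rewrite -sqr_normc normrE rmorphXn. Qed.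

Lemma conjcM (x y : R[i]) : conjc (x * y) = conjc x * conjc y.
Proof. exact: rmorphM. Qed.

Lemma conjc_sum I (r : seq I) (P : pred I) (F : I -> R[i]) :
  conjc (\sum_(i <- r | P i) F i) = \sum_(i <- r | P i) conjc (F i).
Proof.
exact: (big_morph _ (fun x y => rmorphD conjc x y) (conjc0 R)).
Qed.

Lemma Re_le_normc (z : R[i]) : complex.Re z <= normc z.
Proof.
case: z => a b /=; apply: le_trans (ler_norm a) _.
by rewrite -sqrtr_sqr ler_wsqrtr // lerDl sqr_ge0.
Qed.

Lemma normc_ge_Im (z : R[i]) : `|complex.Im z| <= normc z.
Proof. by case: z => a b /=; rewrite -sqrtr_sqr ler_wsqrtr // lerDr sqr_ge0. Qed.

Lemma normc_ge_Re (z : R[i]) : `|complex.Re z| <= normc z.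
Proof. by case: z => a b /=; rewrite -sqrtr_sqr ler_wsqrtr // lerDl sqr_ge0. Qed.

Lemma normc_gt0 (z : R[i]) : z != 0 -> 0 < normc z.
Proof.
move=> z0; rewrite lt_neqAle normc_ge0 andbT eq_sym.
by apply: contra z0 => /eqP /Normc.eq0_normc ->.
Qed.

End ComplexExp.

(** * Divisibility, units and convergent series in the p-adic integers *)

Section ZpTheory.
Variable p : prime_nat.
Local Notation Zp := (Zpadic p).
Local Notation pe n := (ppow p n).

Lemma residue_intr (m : int) n : residue (m%:~R : Zp) n = modz m (pe n).
Proof.
have addc (a b : int) : Zp_of_int p (a + b) = Zp_of_int p a + Zp_of_int p b.
  by apply: Zp_ext => j /=; rewrite modzDm.
suff -> : (m%:~R : Zp) = Zp_of_int p m by [].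
elim/int_rect: m => [|j IH|j IH]; first by rewrite mulr0z.
  by rewrite -addn1 PoszD rmorphD /= IH addc.
rewrite -addn1 PoszD opprD rmorphD /= IH addc; congr (_ + _).
by rewrite mulrN1z; apply: Zp_ext => i; rewrite /= modzNm.
Qed.

Lemma residueE (x : Zp) m n : (m <= n)%N -> residue x m = modz (residue x n) (pe m).
Proof. by move=> /subnK <-; rewrite addnC residueD residue_mod. Qed.

Lemma residue_add (x y : Zp) n : residue (x + y) n = modz (residue x n + residue y n) (pe n).
Proof. by []. Qed.

Lemma residue_mul (x y : Zp) n : residue (x * y) n = modz (residue x n * residue y n) (pe n).
Proof. by []. Qed.

Lemma residue_sub0 (x y : Zp) n : residue (x - y) n = 0 <-> residue x n = residue y n.
Proof.
rewrite residue_add /= modzDmr.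
split=> [/dvdz_mod0P|->]; last by rewrite subrr mod0z.
by rewrite -eqz_mod_dvd => /eqP; rewrite !residue_mod.
Qed.

Lemma ppowE n : pe n = (p : nat)%:Z ^+ n.
Proof. by rewrite /ppow -natz natrX natz. Qed.

Lemma residue_natX m n : residue ((p : nat)%:R ^+ m : Zp) n = modz (pe m) (pe n).
Proof. by rewrite -residue_intr ppowE rmorphXn. Qed.

(** Dividing [residue x (m + n)] by p^m drops the m lowest digits; these quotients are coherent in n
    and define the cofactor. *)
Lemma Zp_divP (x : Zp) m : residue x m = 0 <-> exists z : Zp, x = (p : nat)%:R ^+ m * z.
Proof.
split=> [x0|[z ->]]; last first.
  by rewrite residue_mul residue_natX modzz mul0r mod0z.
have dv n : (pe m %| residue x (m + n))%Z by apply/dvdz_mod0P; rewrite residueD residue_mod.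
have hf n : modz (residue x (m + n.+1) %/ pe m)%Z (pe n) = modz (residue x (m + n) %/ pe m)%Z (pe n).
  apply/eqP; rewrite eqz_mod_dvd.
  rewrite -(@dvdz_mul2l (pe m)) ?pe_neq0 // mulrBr -!(mulrC (_ %/ _)%Z) !divzK ?dv //.
  rewrite -eqz_mod_dvd !ppowE -exprD -ppowE addnS; apply/eqP.
  exact: residue_modS.
exists (mkZp hf); apply: Zp_ext => n.
rewrite (residueE x (leq_addl m n)) residue_mul residue_natX /= modzMmr modzMml.
by rewrite mulrC divzK.
Qed.

(** Inverses can be chosen independently modulo each p^n: they are unique there, so the choices are
    automatically coherent. *)
Lemma Zp_int_unit (a : int) : coprimez a (p : nat) -> (a%:~R : Zp) \is a GRing.unit.
Proof.
move=> cap.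
have inv n : exists b : int, modz (b * a) (pe n) = modz 1 (pe n).
  have : coprimez a (pe n) by rewrite ppowE; apply: coprimezXr.
  case/coprimezP => -[u v] /= e; exists u.
  by rewrite -e; apply/eqP; rewrite eqz_mod_dvd opprD addrA subrr add0r -mulNr dvdz_mull.
pose f n := xget 0 [set b : int | modz (b * a) (pe n) = modz 1 (pe n)].
have fP n : modz (f n * a) (pe n) = modz 1 (pe n).
  rewrite /f; case: xgetP => [y _ //|h]; by case: (inv n) => b /h.
have hf n : modz (f n.+1) (pe n) = modz (f n) (pe n).
  have h1 : modz (f n.+1 * a) (pe n) = modz 1 (pe n).
    by rewrite -(modz_dvdm _ (pe_dvd p (leqnSn n))) fP modz_dvdm // pe_dvd.
  apply/eqP; rewrite eqz_mod_dvd -(@Gauss_dvdzl _ _ a); last first.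
    by rewrite coprimez_sym ppowE; apply: coprimezXr.
  by rewrite mulrBl -eqz_mod_dvd h1 fP.
apply/unitrP; exists (mkZp hf).
suff e : mkZp hf * a%:~R = 1 by split; rewrite // mulrC.
by apply: Zp_ext => n; rewrite residue_mul residue_intr /= modzMmr modzMml fP.
Qed.

Lemma Zp_nat_neq0 n : (0 < n)%N -> (n%:R : Zp) != 0.
Proof.
move=> n0; apply/eqP => /(congr1 (fun z => residue z n)).
rewrite -[n%:R]/((n%:Z)%:~R) residue_intr -[0 in RHS]/((0%:Z)%:~R) residue_intr mod0z.
rewrite modz_small; first by case; case: (n) n0.
by rewrite le0z_nat /= /ppow ltz_nat ltn_expl // prime_gt1 // prime_valP.
Qed.

Lemma Zp_series_sum (b : nat -> Zp) (N : nat -> nat) :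
    (forall m i, (N m <= i)%N -> residue (b i) m = 0) ->
  exists s : Zp, forall m K, (N m <= K)%N -> residue s m = residue (\sum_(i < K) b i) m.
Proof.
move=> hb.
have stable m K : (N m <= K)%N ->
    residue (\sum_(i < K) b i) m = residue (\sum_(i < N m) b i) m.
  move=> /subnK <-; rewrite addnC; elim: (K - N m)%N => [|j IH]; first by rewrite addn0.
  rewrite addnS big_ord_recr residue_add (_ : residue (b _) m = 0) ?hb ?leq_addr //.
  by rewrite addr0 IH residue_mod.
(* [N] need not be monotone, so the truncation lies beyond both [N m] and [N m.+1]; this makes
   consecutive residues comparable. *)
pose f m := residue (\sum_(i < maxn (N m) (N m.+1)) b i) m.
have hf m : modz (f m.+1) (pe m) = modz (f m) (pe m).
  rewrite /f [in RHS](stable m) ?leq_maxl //.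
  rewrite (stable m.+1) ?leq_maxl // -(stable m.+1 (maxn (N m) (N m.+1))) ?leq_maxr //.
  by rewrite residue_modS stable ?leq_maxl.
exists (mkZp hf) => m K hK /=.
by rewrite /f residue_mod !stable ?leq_maxl.
Qed.

Lemma ord_ge_toQp (x : Zp) (m : int) :
  residue x `|m| = 0 -> ord_ge (toQp x) m.
Proof.
move=> /Zp_divP[z ->].
(* For negative m the surplus p^(|m| - m) turns p^m into p^|m|. *)
exists ((p : nat)%:R ^+ absz (`|m| - m) * z).
have pn0 : ((p : nat)%:R : Qpadic p) != 0.
  by rewrite -tofrac1 -tofracMn tofrac_eq0 Zp_nat_neq0 // prime_gt0 // prime_valP.
rewrite /toQp !tofracM !tofracXn !tofracMn !tofrac1 mulrA; congr (_ * _).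
rewrite !exprnP -expfzDr //; congr (_ ^ _).
by have := ler_norm m; lia.
Qed.

Lemma ord_ge_residue (x : Zp) (m : nat) : ord_ge (toQp x) m -> residue x m = 0.
Proof.
case=> z e; apply/Zp_divP; exists z; apply/eqP; rewrite -tofrac_eq; apply/eqP.
by rewrite tofracM tofracXn tofracMn tofrac1.
Qed.

Lemma padic_series_sum_uniq (v : nat -> Qpadic p) s s' :
  padic_series_sum v s -> padic_series_sum v s' -> s = s'.
Proof.
move=> h h'.
have hd (m : int) : ord_ge (s' - s) m.
  near \oo => n.
  have [z hz] : ord_ge (\sum_(0 <= i < n) v i - s) m by near: n; exact: h.
  have [z' hz'] : ord_ge (\sum_(0 <= i < n) v i - s') m by near: n; exact: h'.
  exists (z - z'); rewrite /toQp tofracB mulrBr -hz -hz'.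
  by rewrite opprD addrACA subrr add0r opprK addrC.
(* The case m = 0 puts the difference into Z_p, where it vanishes because all its residues do. *)
have [z0 e0] := hd 0.
have e0' : s' - s = toQp z0 by rewrite e0 expr0z mul1r.
suff z00 : z0 = 0 by apply/eqP; rewrite eq_sym -subr_eq0 e0' z00 /toQp tofrac0.
apply: Zp_ext => n; rewrite -[0 in RHS]/((0%:Z)%:~R) residue_intr mod0z.
by apply: ord_ge_residue; rewrite -e0'.
Unshelve. all: by end_near. Qed.

Lemma padic_evalE (a : nat -> Zp) (N : nat -> nat) (x s : Zp) :
    (forall m i, (N m <= i)%N -> residue (a i) m = 0) ->
    (forall m K, (N m <= K)%N -> residue s m = residue (\sum_(i < K) a i * x ^+ i) m) ->
  padic_eval (fun i => toQp (a i)) (toQp x) = toQp s.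
Proof.
move=> ha hs.
have H : padic_series_sum (fun i => toQp (a i) * toQp x ^+ i) (toQp s).
  move=> m; near=> n.
  rewrite (_ : \sum_(0 <= i < n) _ - _ = toQp (\sum_(i < n) a i * x ^+ i - s)); last first.
    rewrite /toQp tofracB (big_morph _ (@tofracD _) (@tofrac0 _)) big_mkord; congr (_ - _).
    by apply: eq_bigr => i _; rewrite tofracM tofracXn.
  apply/ord_ge_toQp/residue_sub0; rewrite (hs `|m|%N n) //.
  by near: n; exact: nbhs_infty_ge.
rewrite /padic_eval; case: xgetP => [y _ /= hy|/(_ (toQp s)) hn]; last by case: hn.
exact: padic_series_sum_uniq hy H.
Unshelve. all: by end_near. Qed.

End ZpTheory.

(** * The p-adic logarithm and p-adic phases *)

Section PadicLog.
Variable p : prime_nat.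
Local Notation Zp := (Zpadic p).
Local Notation pe n := (ppow p n).

(** This crude bound, valid for p = 2 as well, makes p^(kappa i)/i integral and divisible by p^m as
    soon as i >= 2 m. *)
Lemma logn_half i : (2 * logn p i <= i)%N.
Proof.
case: i => [|i]; first by rewrite logn0.
have h v : (2 * v <= 2 ^ v)%N by elim: v => // v; rewrite expnS; case: v => // v; lia.
apply: leq_trans (h _) _; apply: leq_trans (dvdn_leq (ltn0Sn i) (pfactor_dvdnn p i.+1)).
by case: (logn p i.+1) => // v; rewrite leq_exp2r // prime_gt1 // prime_valP.
Qed.

(* p^(kappa i) / i as an element of Z_p, with value 0 at i = 0. *)
Definition log_coef (kappa i : nat) : Zp :=
  (p : nat)%:R ^+ (kappa * i - logn p i) * ((i %/ p ^ logn p i)%N%:R)^-1.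

Lemma log_coefP kappa i : (0 < kappa)%N -> (0 < i)%N ->
  i%:R * log_coef kappa i = (p : nat)%:R ^+ (kappa * i).
Proof.
move=> k0 i0; rewrite /log_coef.
set v := logn p i; set j := (i %/ p ^ v)%N.
have ei : i = (j * p ^ v)%N by rewrite /j divnK // pfactor_dvdnn.
have ju : (j%:R : Zp) \is a GRing.unit.
  have := @Zp_int_unit p j%:Z; rewrite -pmulrn; apply.
  rewrite coprimezE /= coprime_sym prime_coprime ?prime_valP //.
  apply/negP => /dvdnP[c ec]; have : (p ^ v.+1 %| i)%N.
    by rewrite ei ec expnS -mulnA dvdn_mull.
  by rewrite pfactor_dvdn ?prime_valP // ltnn.
rewrite {1}ei natrM natrX (mulrC j%:R) mulrACA mulrV // mulr1 -exprD.
have := logn_half i; rewrite -/v => h.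
by congr (_ ^+ _); nia.
Qed.

Lemma log_coef0 kappa : log_coef kappa 0 = 0.
Proof. by rewrite /log_coef div0n invr0 mulr0. Qed.

Lemma residue_mul0 (x y : Zp) m : residue x m = 0 -> residue (x * y) m = 0.
Proof. by move=> x0; rewrite residue_mul x0 mul0r mod0z. Qed.

Lemma residue_mul0r (x y : Zp) m : residue y m = 0 -> residue (x * y) m = 0.
Proof. by rewrite mulrC; apply: residue_mul0. Qed.

Lemma log_coef_residue kappa i m : (0 < kappa)%N -> (2 * m <= i)%N ->
  residue (log_coef kappa i) m = 0.
Proof.
move=> k0 hm; apply: residue_mul0; apply/Zp_divP.
have := logn_half i => h.
exists ((p : nat)%:R ^+ (kappa * i - logn p i - m)); rewrite -exprD; congr (_ ^+ _).
by nia.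
Qed.

(* An integer approximation of the p-adic logarithm, from log a = lim (a^(p^N) - 1) / p^N. *)
Definition padic_log (N : nat) (a : int) : int := ((a ^+ (p ^ N) - 1) %/ pe N)%Z.

(** Expand by the binomial theorem and use (i+1) C(P, i+1) = P C(P-1, i) with P = p^N: the factor P
    comes out, and p^(kappa (i+1))/(i+1) is left in each term. *)
Lemma padic_log_sum (kappa N : nat) (y : int) : (0 < kappa)%N ->
  ((1 + pe kappa * y) ^+ (p ^ N) - 1)%:~R = (pe N)%:~R *
    \sum_(i < p ^ N) 'C((p ^ N).-1, i)%:R * (log_coef kappa i.+1 * y%:~R ^+ i.+1) :> Zp.
Proof.
move=> k0.
rewrite exprDn big_ord_recl /= expr1n expr0 mulr1 bin0 mulr1n addrAC subrr add0r.
rewrite rmorph_sum mulr_sumr /=; apply: eq_bigr => i _.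
rewrite expr1n mul1r /bump /= add1n.
rewrite rmorphMn /= rmorphXn /= rmorphM /= exprMn -mulr_natl.
have -> : (pe kappa)%:~R ^+ i.+1 = i.+1%:R * log_coef kappa i.+1.
  by rewrite log_coefP // exprM; congr (_ ^+ _); rewrite ppowE rmorphXn.
rewrite -!mulrA [RHS]mulrA (mulrA 'C(_, _)%:R); congr (_ * _).
rewrite -natrM -mulnC (_ : (pe N)%:~R = (p ^ N)%:R :> Zp) // -natrM; congr (_%:R).
by rewrite mul_bin_diag.
Qed.

Lemma padic_log_dvd (kappa N : nat) (y : int) : (0 < kappa)%N ->
  (pe N %| (1 + pe kappa * y) ^+ (p ^ N) - 1)%Z.
Proof.
move=> k0; apply/dvdz_mod0P; rewrite -(residue_intr p) padic_log_sum //.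
by apply: residue_mul0; rewrite residue_intr modzz.
Qed.

Lemma padic_logE (kappa N : nat) (y : int) : (0 < kappa)%N ->
  (padic_log N (1 + pe kappa * y))%:~R =
    \sum_(i < p ^ N) 'C((p ^ N).-1, i)%:R * (log_coef kappa i.+1 * y%:~R ^+ i.+1) :> Zp.
Proof.
move=> k0; have pN0 : ((pe N)%:~R : Zp) != 0.
  by rewrite /ppow -[(Posz _)%:~R]/((p ^ N)%:R) Zp_nat_neq0 // expn_gt0 prime_gt0 // prime_valP.
apply: (mulfI pN0); rewrite -padic_log_sum // -intrM /padic_log.
by rewrite [X in X%:~R = _]mulrC divzK // padic_log_dvd.
Qed.

(** With P = p^(3n), consecutive binomials C(P-1, i) and C(P-1, i+1) add up to C(P, i+1), whose
    valuation is at least 3n - v(i+1). Only i < 2n matters, so v(i+1) < 2n and p^n survives; this is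
    the origin of the exponent 3n. *)
Lemma bin_pX_mod n i : (i < 2 * n)%N ->
  modz 'C((p ^ (3 * n)).-1, i) (pe n) = modz ((-1) ^+ i) (pe n).
Proof.
have pp := prime_valP p.
elim: i => [|i IH] hi; first by rewrite bin0.
have P0 : (0 < p ^ (3 * n))%N by rewrite expn_gt0 prime_gt0.
have d : (p ^ n %| 'C(p ^ (3 * n), i.+1))%N.
  have i1 : (i.+1 <= p ^ (3 * n))%N.
    have h : (3 * n < p ^ (3 * n))%N by rewrite ltn_expl // prime_gt1.
    by lia.
  have b0 : (0 < 'C(p ^ (3 * n), i.+1))%N by rewrite bin_gt0.
  rewrite pfactor_dvdn //.
  have : (p ^ (3 * n) %| i.+1 * 'C(p ^ (3 * n), i.+1))%N.
    by rewrite -mul_bin_diag dvdn_mulr.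
  rewrite pfactor_dvdn ?muln_gt0 ?b0 // lognM //.
  have := @ltn_logl p i.+1 isT; lia.
have {}d : (p ^ n %| 'C((p ^ (3 * n)).-1, i.+1) + 'C((p ^ (3 * n)).-1, i))%N.
  by rewrite -binS prednK.
apply/eqP; rewrite eqz_mod_dvd exprS mulN1r opprK.
rewrite (_ : _ + _ = ('C((p ^ (3 * n)).-1, i.+1)%:Z + 'C((p ^ (3 * n)).-1, i)%:Z)
   - ('C((p ^ (3 * n)).-1, i)%:Z - (-1) ^+ i)); last by ring.
apply: rpredB; last by rewrite -eqz_mod_dvd; apply/eqP/IH/ltnW.
by rewrite -PoszD dvdzE.
Qed.

Lemma residue_sum (f g : nat -> Zp) m K :
  (forall i, (i < K)%N -> residue (f i) m = residue (g i) m) ->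
  residue (\sum_(i < K) f i) m = residue (\sum_(i < K) g i) m.
Proof.
elim: K => [|K IH] h; first by rewrite !big_ord0.
by rewrite !big_ord_recr !residue_add IH ?h // => i hi; apply: h; apply: ltnW.
Qed.

Lemma residue_sum_trunc (f : nat -> Zp) m K K' : (K <= K')%N ->
  (forall i, (K <= i)%N -> residue (f i) m = 0) ->
  residue (\sum_(i < K') f i) m = residue (\sum_(i < K) f i) m.
Proof.
move=> /subnK <- h; rewrite addnC; elim: (K' - K)%N => [|j IH]; first by rewrite addn0.
rewrite addnS big_ord_recr residue_add (_ : residue (f _) m = 0) ?h ?leq_addr //.
by rewrite addr0 IH residue_mod.
Qed.

(** Modulo p^n all terms from index 2n on vanish on both sides, and below 2n the binomials in
    [padic_logE] are the signs of the logarithm series. *)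
Lemma padic_log_residue (kappa n K : nat) (y : int) : (0 < kappa)%N -> (2 * n <= K)%N ->
  residue (\sum_(i < K) (-1) ^+ i * (log_coef kappa i.+1 * y%:~R ^+ i.+1) : Zp) n =
  residue ((padic_log (3 * n) (1 + pe kappa * y))%:~R : Zp) n.
Proof.
move=> k0 hK; rewrite padic_logE //.
have hP : (2 * n <= p ^ (3 * n))%N.
  have : (3 * n < p ^ (3 * n))%N by rewrite ltn_expl // prime_gt1 // prime_valP.
  by lia.
have T0 c i : (2 * n <= i)%N ->
    residue (c * (log_coef kappa i.+1 * y%:~R ^+ i.+1)) n = 0.
  by move=> hi; apply/residue_mul0r/residue_mul0/log_coef_residue => //; lia.
pose f c i : Zp := c i * (log_coef kappa i.+1 * y%:~R ^+ i.+1).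
rewrite (@residue_sum_trunc (f (fun i => (-1) ^+ i)) n _ _ hK); last by move=> i; apply: T0.
rewrite (@residue_sum_trunc (f (fun i => 'C((p ^ (3 * n)).-1, i)%:R)) n _ _ hP);
  last by move=> i; apply: T0.
apply: residue_sum => i hi; rewrite /f residue_mul [RHS]residue_mul.
congr (modz (_ * _) _).
rewrite (_ : (-1) ^+ i = ((-1) ^+ i)%:~R :> Zp); last by rewrite rmorphXn /= mulrN1z.
by rewrite -[_%:R]/((Posz _)%:~R) !residue_intr bin_pX_mod.
Qed.

End PadicLog.

Lemma cross_mulB (F : fieldType) (a J P Q Z : F) : P != 0 -> Q != 0 ->
  a * Q - J * P = P * Q * (Z - ((J + Q * Z) / Q - a / P)).
Proof. by move=> P0 Q0; field; rewrite P0 Q0. Qed.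

(** Coefficient of t^i in the derivative of al log(1 + P m t), with s = (-1)^i, N = i+1 and c =
    P^(i+1)/(i+1). *)
Lemma deriv_log_coef (A : comNzRingType) (al s c m P N : A) (i : nat) :
  N * c = P ^+ i.+1 ->
  al * (s * (c * m ^+ i.+1)) * N = P * (al * m) * (s * (P * m) ^+ i).
Proof.
move=> e; rewrite exprMn.
transitivity (al * s * m ^+ i.+1 * (N * c)); first by ring.
by rewrite e !exprS; ring.
Qed.

Section PadicPhase.
Variable p : prime_nat.
Local Notation Zp := (Zpadic p).
Local Notation Qp := (Qpadic p).
Local Notation pe n := (ppow p n).

Lemma toQp_int (m : int) : toQp (m%:~R : Zp) = m%:~R :> Qp.
Proof.
case: m => m; first by rewrite /toQp -!pmulrn tofracMn tofrac1.
by rewrite /toQp !NegzE !mulrNz tofracN -!pmulrn tofracMn tofrac1.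
Qed.

Lemma toQp_pX n : toQp ((p : nat)%:R ^+ n : Zp) = (p : nat)%:R ^+ n :> Qp.
Proof. by rewrite /toQp tofracXn tofracMn tofrac1. Qed.

Lemma Zp_int_neq0 (m : int) : m != 0 -> (m%:~R : Zp) != 0.
Proof.
case: m => m m0; first by rewrite -pmulrn Zp_nat_neq0 // lt0n.
by rewrite NegzE mulrNz oppr_eq0 -pmulrn Zp_nat_neq0.
Qed.

Lemma Qp_int_neq0 (m : int) : m != 0 -> (m%:~R : Qp) != 0.
Proof. by move=> m0; rewrite -toQp_int tofrac_eq0 Zp_int_neq0. Qed.

Lemma Qp_pX_neq0 n : ((p : nat)%:R ^+ n : Qp) != 0.
Proof.
by rewrite expf_neq0 // -[_%:R]/((Posz p)%:~R) Qp_int_neq0 // eqz_nat -lt0n prime_gt0 // prime_valP.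
Qed.

Lemma ratr_Qp (a : int) (j : nat) :
  ratr (a%:~R / (p : nat)%:R ^+ j) = a%:~R / (p : nat)%:R ^+ j :> Qp.
Proof.
set x : rat := _ / _.
have p0 : ((p : nat)%:R ^+ j : rat) != 0.
  by rewrite expf_neq0 // pnatr_eq0 -lt0n prime_gt0 // prime_valP.
have e : (a * denq x = numq x * pe j)%R.
  apply/(@intr_inj rat); rewrite !intrM ppowE rmorphXn /=.
  have ea : a%:~R = x * (p : nat)%:R ^+ j by rewrite /x divfK.
  by rewrite numqE ea mulrAC.
rewrite /ratr; apply/eqP; rewrite eqr_div ?Qp_pX_neq0 ?Qp_int_neq0 ?denq_neq0 //.
have := congr1 (fun z : int => z%:~R : Qp) e; rewrite !intrM ppowE rmorphXn /= => ->.
by rewrite mulrC.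
Qed.

Lemma e_padic_eq (R : realType) (s : Zp) (J : int) (n : nat) :
  residue s n = modz J (pe n) ->
  e_padic R (toQp s / (p : nat)%:R ^+ n) = e_real (J%:~R / (p : nat)%:R ^+ n).
Proof.
move=> hs.
have [z hz] : exists z : Zp, s - J%:~R = (p : nat)%:R ^+ n * z.
  by apply/Zp_divP/residue_sub0; rewrite residue_intr.
have hz' : toQp s = J%:~R + (p : nat)%:R ^+ n * toQp z.
  by rewrite -toQp_int -toQp_pX /toQp -tofracM -tofracD -hz addrC subrK.
(* The set contains J/p^n, so the default of [xget] never occurs. Any other a/p^j in it differs from
   J/p^n by an element of Z[1/p] lying in Z_p, that is, by an integer. *)
rewrite /e_padic; case: xgetP => [y _ /= [[a [j ->]] [z' ez']]|/(_ (J%:~R / (p : nat)%:R ^+ n)) h]; last first.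
  case: h; split; first by exists J, n.
  by exists z; rewrite ratr_Qp hz' mulrDl addrAC subrr add0r mulrAC divff ?Qp_pX_neq0 // mul1r.
rewrite ratr_Qp in ez'.
have pj := Qp_pX_neq0 j; have pn := Qp_pX_neq0 n.
have /eqP : (a * pe n - J * pe j)%:~R = (p : nat)%:R ^+ (j + n) * (z - z') :> Zp.
  apply/eqP; rewrite -tofrac_eq -/(toQp _) -/(toQp _) toQp_int; apply/eqP.
  rewrite [toQp (_ * _)]tofracM -/(toQp _) toQp_pX tofracB -/(toQp _) -/(toQp _) -ez' hz'.
  rewrite intrB !intrM !ppowE !rmorphXn /= exprD.
  exact: cross_mulB.
rewrite -subr_eq0 => /eqP e0.
have : (pe (j + n) %| a * pe n - J * pe j)%Z.
  apply/dvdz_mod0P; rewrite -(residue_intr p); apply/Zp_divP; exists (z - z').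
  by apply/eqP; rewrite -subr_eq0 e0.
case/dvdzP => c ec.
have pR m : ((p : nat)%:R ^+ m : R) != 0.
  by rewrite expf_neq0 // pnatr_eq0 -lt0n prime_gt0 // prime_valP.
have -> : ratr (a%:~R / (p : nat)%:R ^+ j) = J%:~R / (p : nat)%:R ^+ n + c%:~R :> R.
  rewrite fmorph_div rmorphXn /= ratr_nat ratr_int.
  have := congr1 (fun z : int => z%:~R : R) ec.
  rewrite intrB !intrM !ppowE !rmorphXn /= exprD => e1.
  apply/eqP; rewrite -subr_eq0; apply/eqP.
  transitivity ((a%:~R * p%:R ^+ n - J%:~R * p%:R ^+ j) / (p%:R ^+ j * p%:R ^+ n) - c%:~R :> R).
    by field; rewrite !pR.
  by rewrite e1 mulfK ?subrr // mulf_neq0.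
by rewrite e_realD e_real_int mulr1.
Qed.

(* The series t |-> al log(1 + p^kappa m t) + p^kappa gam t. *)
Definition phase_coef (kappa : nat) (al m gam : int) (i : nat) : Zp :=
  al%:~R * ((-1) ^+ i.-1 * (log_coef p kappa i * m%:~R ^+ i))
  + (if i == 1%N then (pe kappa * gam)%:~R else 0).

Lemma phase_eval (R : realType) (kappa n : nat) (al m gam t : int) : (0 < kappa)%N ->
  e_padic R (padic_eval (fun i => toQp (phase_coef kappa al m gam i)) t%:~R / (p : nat)%:R ^+ n)
  = e_real ((al * padic_log p (3 * n) (1 + pe kappa * (m * t)) + pe kappa * gam * t)%:~R
            / (p : nat)%:R ^+ n).
Proof.
move=> k0; rewrite -(toQp_int t).
pose a := phase_coef kappa al m gam.
(* Index 1 carries the linear term p^kappa gam, so the tail can start at 2 at the earliest. *)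
have ha k i : (maxn 2 (2 * k) <= i)%N -> residue (a i) k = 0.
  rewrite geq_max => /andP[i2 hi]; rewrite /a /phase_coef (gtn_eqF i2) addr0.
  by apply/residue_mul0r/residue_mul0r/residue_mul0/log_coef_residue.
pose b i := a i * t%:~R ^+ i.
have [|s hs] := @Zp_series_sum p b (fun k => maxn 2 (2 * k)).
  by move=> k i hi; apply/residue_mul0/ha.
rewrite (@padic_evalE p a (fun k => maxn 2 (2 * k)) _ s) //.
apply: e_padic_eq; rewrite (hs n (maxn 2 (2 * n)).+1 (leqnSn _)).
set K := maxn 2 (2 * n).
have bE i : b i.+1 = al%:~R * ((-1) ^+ i * (log_coef p kappa i.+1 * (m * t)%:~R ^+ i.+1))
    + (if i == 0%N then (pe kappa * gam * t)%:~R else 0).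
  rewrite /b /a /phase_coef mulrDl [(m * t)%:~R]intrM exprMn eqSS; congr (_ + _).
    by rewrite -!mulrA.
  by case: i => [|i] /=; rewrite ?mul0r // expr1 -intrM.
rewrite big_ord_recl [b _](_ : _ = 0) ?add0r; last first.
  by rewrite /b /a /phase_coef /= log_coef0 mul0r !mulr0 addr0 mul0r.
rewrite (eq_bigr (fun i : 'I_K => al%:~R * ((-1) ^+ i * (log_coef p kappa i.+1 * (m * t)%:~R ^+ i.+1))
    + (if i == 0%N :> nat then (pe kappa * gam * t)%:~R else 0))); last first.
  by move=> i _; rewrite -bE.
rewrite big_split -mulr_sumr residue_add residue_mul padic_log_residue ?leq_maxr //.
rewrite -residue_mul -residue_add.
have -> : \sum_(i < K) (if i == 0%N :> nat then (pe kappa * gam * t)%:~R else 0) =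
   (pe kappa * gam * t)%:~R :> Zp.
  have : (0 < K)%N by rewrite /K; lia.
  case: K => // K _; rewrite big_ord_recl big1 ?addr0 // => i _.
by rewrite -intrM -intrD residue_intr.
Qed.

Lemma gbinomN1 i : gbinom (- 1) i = (-1) ^+ i.
Proof.
rewrite /gbinom big_mkord.
have -> : \prod_(j < i) (- 1 - j%:R) = (-1) ^+ i * i`!%:R :> rat.
  elim: i => [|i IH]; first by rewrite big_ord0 expr0 mul1r fact0.
  rewrite big_ord_recr /= IH factS natrM exprS -natr1; ring.
by rewrite mulfK // pnatr_eq0 -lt0n fact_gt0.
Qed.

Lemma iota_1 : iota_ p 1 = 0%N.
Proof. by rewrite /iota_ /ordq /= logn1 subrr oppr0 maxxx. Qed.

Lemma iota'_1 : iota' p 1 = 0%N.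
Proof. by rewrite /iota' /ordq /= logn1 subrr maxxx. Qed.

(** The derivative is p^kappa al m (1 + p^kappa m t)^(-1) + p^kappa gam. Hence omega = m, omega' =
    al m, gamma0 = gam, and the remainder g = 0 suits every [u] and [lambda]. The free constant
    gamma0 is what makes the linear twists available. *)
Lemma phase_class_F (R : realType) (kappa u : nat) (lambda : R) (al m gam : int) :
    (0 < kappa)%N -> coprimez al (p : nat) -> coprimez m (p : nat) ->
  class_F kappa%:Z 1 kappa lambda u (fun i => toQp (phase_coef kappa al m gam i)).
Proof.
move=> k0 cal cm; split.
  exists 1; split; first exact: oner_neq0.
  exists (phase_coef kappa al m gam) => [j|i]; last by rewrite mul1r.
  near=> i; apply: ord_ge_toQp.
  rewrite /phase_coef (_ : (i == 1%N) = false) ?addr0; last first.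
    by apply: gtn_eqF; near: i; exact: nbhs_infty_gt.
  apply/residue_mul0r/residue_mul0r/residue_mul0/log_coef_residue => //.
  by near: i; exact: nbhs_infty_ge.
exists (m%:~R), ((al * m)%:~R); split; [exact: Zp_int_unit| |].
  by rewrite intrM unitrM !Zp_int_unit.
exists (gam%:~R), (fun=> 0); split.
  have o0 j : ord_ge (toQp (0 : Zp)) j by exists 0; rewrite /toQp tofrac0 mulr0.
  by split=> [j|i]; [near=> i|]; exact: o0.
move=> i; rewrite /deriv_series /binom_series iota_1 add0n gbinomN1.
rewrite /const_series [toQp 0]tofrac0 mulr0 addr0 /phase_coef eqSS.
have -> : (-1) ^+ i = ((-1) ^+ i)%:~R :> rat by rewrite rmorphXn /= mulrN1z.
rewrite ratr_int -!toQp_int -exprnP -toQp_pX /toQp -tofracMn -!tofracM -tofracXn -!tofracM.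
have -> : (if i == 0 then tofrac ((p : nat)%:R ^+ kappa * gam%:~R) else 0 : Qp)
    = tofrac (if i == 0 then ((p : nat)%:R ^+ kappa * gam%:~R) else 0 : Zp).
  by case: ifP => // _; rewrite tofrac0.
rewrite -tofracD mulrnDl; congr (tofrac (_ + _)); last first.
  case: eqP => [->|]; last by rewrite mul0rn.
  by rewrite mulr1n intrM ppowE rmorphXn.
rewrite intrM rmorphXn /= mulrN1z -[LHS]mulr_natr.
apply: deriv_log_coef; rewrite log_coefP // exprM.
by [].
Unshelve. all: by end_near. Qed.

End PadicPhase.

Lemma dvd_sum (A : comNzRingType) (P : A) (F : nat -> A) K :
  (forall i, exists z, F i = P * z) -> exists z, \sum_(i < K) F i = P * z.
Proof.
move=> h; elim: K => [|K [z IH]]; first by exists 0; rewrite big_ord0 mulr0.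
by have [t et] := h K; exists (z + t); rewrite big_ord_recr IH et mulrDr.
Qed.

(** * The logarithm on 1 + p^kappa Z: valuation and additivity *)

Section PadicLogIso.
Variable p : prime_nat.
Local Notation Zp := (Zpadic p).
Local Notation pe n := (ppow p n).
Local Notation L := (padic_log p).

Lemma iota'2_logn : iota' p 2 = logn p 2.
Proof. by rewrite /iota' /ordq /= logn1 subr0; lia. Qed.

Lemma padic_log_lead kappa N y : (1 + iota' p 2 <= kappa)%N ->
  exists z : Zp, (L N (1 + pe kappa * y))%:~R = (pe kappa * y)%:~R * (1 + (p : nat)%:R * z).
Proof.
rewrite iota'2_logn => hk; have k0 : (0 < kappa)%N by apply: leq_trans hk.
have pp := prime_valP p; have p1 := prime_gt1 pp.
(* Every term after the first has valuation at least kappa + 1. For p = 2 this needs kappa >= 2, as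
   j = 2 shows; hence the hypothesis with [iota' p 2]. *)
have val j : (1 < j)%N -> (kappa + 1 <= kappa * j - logn p j)%N.
  case: j => [|[|j]] // _; rewrite mulnS.
  have := dvdn_leq (ltn0Sn _) (pfactor_dvdnn p j.+2); move: (logn p j.+2) => v hv.
  have [p2|p2] := eqVneq (p : nat) 2.
    move: hk hv; rewrite p2 (_ : logn 2 2 = 1)%N // => hk hv.
    have h w : (w + 1 <= 2 ^ w)%N by elim: w => // w; rewrite expnS; lia.
    have := h v; have : (2 * j.+1 <= kappa * j.+1)%N by rewrite leq_mul2r hk orbT.
    move: hv; move: (2 ^ v)%N (kappa * j.+1)%N => X Y; lia.
  have p3 : (2 < p)%N by rewrite ltn_neqAle eq_sym p2.
  have h w : (w.+1 + 2 <= 3 ^ w.+1)%N by elim: w => // w; rewrite (expnS 3 w.+1); lia.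
  have : (1 * j.+1 <= kappa * j.+1)%N by rewrite leq_mul2r k0 orbT.
  case: v hv => [|v] hv; first by lia.
  have : (3 ^ v.+1 <= p ^ v.+1)%N by rewrite leq_exp2r.
  have := h v; move: hv; move: (3 ^ v.+1)%N (p ^ v.+1)%N (kappa * j.+1)%N => X Y Z; lia.
rewrite padic_logE //.
have dv i : exists z : Zp, log_coef p kappa i.+2 = (p : nat)%:R ^+ (kappa.+1) * z.
  rewrite /log_coef; set u := (_^-1).
  exists ((p : nat)%:R ^+ (kappa * i.+2 - logn p i.+2 - kappa.+1) * u).
  by rewrite mulrA -exprD; congr (_ ^+ _ * _); have := val i.+2 isT; lia.
have P0 : (0 < p ^ N)%N by rewrite expn_gt0 prime_gt0.
rewrite -(prednK P0) big_ord_recl bin0 mul1r expr1.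
have -> : log_coef p kappa 1 = (pe kappa)%:~R.
  by rewrite -[LHS]mul1r -[1]/(1%:R) log_coefP // muln1 ppowE rmorphXn.
have [|z hz] := @dvd_sum Zp ((pe kappa * y)%:~R * (p : nat)%:R)
  (fun i => 'C((p ^ N).-1.+1.-1, bump 0 i)%:R *
     (log_coef p kappa (bump 0 i).+1 * y%:~R ^+ (bump 0 i).+1)) (p ^ N).-1.
  move=> i; have [z hz] := dv i.
  exists ('C((p ^ N).-1.+1.-1, bump 0 i)%:R * z * y%:~R ^+ i.+1).
  rewrite intrM ppowE rmorphXn /= hz !exprS; ring.
by exists z; rewrite hz intrM mulrDr mulr1 mulrA.
Qed.

(** By [padic_log_lead] the logarithm of 1 + x is x times a unit. This determines both the kernel
    modulo p^n and the valuation of the logarithm of a generator. *)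
Lemma padic_log_dvdE kappa N y j : (1 + iota' p 2 <= kappa)%N ->
  (pe j %| L N (1 + pe kappa * y))%Z = (pe j %| pe kappa * y)%Z.
Proof.
move=> hk; have [z hz] := padic_log_lead N y hk.
have res0 (a : int) : (pe j %| a)%Z <-> residue (a%:~R : Zp) j = 0.
  by rewrite residue_intr; split=> /dvdz_mod0P.
apply/idP/idP => /res0 h; apply/res0; last by rewrite hz; apply: residue_mul0.
have [->|j0] := posnP j; first by rewrite residue_intr /ppow expn0 modz1.
move: h; rewrite hz residue_mul residue_intr; set u := residue (1 + _) _.
have cu : coprimez (pe j) u.
  rewrite ppowE coprimez_sym; apply: coprimezXr; rewrite coprimezE coprime_sym /=.
  rewrite prime_coprime ?prime_valP //; apply/negP => pu.
  have : modz u (pe 1) = 1.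
    rewrite /u -residueE // residue_add (_ : residue (_ * z) 1 = 0); last first.
      by apply/Zp_divP; exists z; rewrite expr1.
    rewrite addr0 -[residue 1 1]/(modz 1 (pe 1)) modz_mod modz_small //.
    by rewrite /ppow expn1 ltz_nat prime_gt1 // prime_valP.
  by rewrite (_ : modz u (pe 1) = 0) //; apply/dvdz_mod0P; rewrite dvdzE /ppow expn1.
rewrite modzMml => /dvdz_mod0P; rewrite Gauss_dvdzl // => h.
by apply/dvdz_mod0P.
Qed.

Lemma padic_log_spec kappa N y : (0 < kappa)%N ->
  (1 + pe kappa * y) ^+ (p ^ N) = 1 + pe N * L N (1 + pe kappa * y).
Proof.
by move=> k0; rewrite [pe N * _]mulrC /padic_log divzK ?padic_log_dvd // [RHS]addrC subrK.
Qed.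

(** The error is the cross term of (1 + p^N a)(1 + p^N b), where a and b are the two logarithms. *)
Lemma padic_logM kappa N x y : (0 < kappa)%N ->
  exists c : int, L N ((1 + pe kappa * x) * (1 + pe kappa * y)) =
    L N (1 + pe kappa * x) + L N (1 + pe kappa * y) + pe N * c.
Proof.
move=> k0; exists (L N (1 + pe kappa * x) * L N (1 + pe kappa * y)).
rewrite {1}/padic_log exprMn !padic_log_spec //.
set a := L _ _; set b := L _ _.
rewrite (_ : _ - 1 = pe N * (a + b + pe N * (a * b))); last by ring.
by rewrite mulKz // pe_neq0.
Qed.

Lemma padic_logX kappa N y s : (0 < kappa)%N ->
  modz (L N ((1 + pe kappa * y) ^+ s)) (pe N) = modz (s%:Z * L N (1 + pe kappa * y)) (pe N).
Proof.
move=> k0; elim: s => [|s IH]; first by rewrite expr0 mul0r /padic_log expr1n subrr div0z.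
have [c ec] : exists c, (1 + pe kappa * y) ^+ s = 1 + pe kappa * c.
  elim: s {IH} => [|s [c IH]]; first by exists 0; rewrite mulr0 addr0.
  by exists (y + c + pe kappa * (y * c)); rewrite exprS IH; ring.
rewrite exprS ec; have [d ->] := padic_logM N y c k0.
rewrite addrC (mulrC (pe N)) modzMDl -ec -modzDmr IH modzDmr.
by congr (modz _ _); rewrite -addn1 PoszD; ring.
Qed.
End PadicLogIso.

(** * Characters modulo p^n *)

Lemma modz_eqP (a b m : int) : modz a m = modz b m <-> exists c : int, a = b + c * m.
Proof.
split=> [/eqP|[c ->]]; last by rewrite addrC modzMDl.
by rewrite eqz_mod_dvd => /dvdzP[c ec]; exists c; rewrite -ec addrC subrK.
Qed.

Section RootsOfUnity.
Variable R : realType.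
Local Notation e := (@e_real R).
Local Notation normc := (@Normc.normc R).

Lemma e_real_neq1 (x : R) : 0 < x -> x < 1 -> e x != 1.
Proof.
move=> x0 x1; apply/eqP; rewrite e_realE => -[h _].
have pi0 := pi_gt0 R.
have s0 : 0 < sin (pi * x) by apply: sin_gt0_pi; nra.
have : cos (pi * x *+ 2) = 1 by rewrite -[RHS]h; congr cos; rewrite -mulr_natr; ring.
rewrite cos_mulr2n -[cos _ ^+ 2](addrK (sin (pi * x) ^+ 2)) cos2Dsin2.
by nra.
Qed.

Lemma e_real_root (M c : nat) : (0 < M)%N -> e (c%:R / M%:R) ^+ M = 1.
Proof.
by move=> M0; rewrite -e_realX mulrC divfK ?e_real_nat // pnatr_eq0 -lt0n.
Qed.

Lemma e_real_inj (M a b : nat) : (a < M)%N -> (b < M)%N ->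
  e (a%:R / M%:R) = e (b%:R / M%:R) -> a = b.
Proof.
wlog : a b / (a <= b)%N => [W|lab] aM bM.
  by have [/W|/ltnW /W h /esym] := leqP a b; [apply|move/(h bM aM)].
move=> eab; apply/eqP; rewrite eqn_leq lab leqNgt /=; apply/negP => hab.
have M0 : (0 : R) < M%:R by rewrite ltr0n (leq_ltn_trans _ aM).
have e1 : e ((b - a)%:R / M%:R) = 1.
  by rewrite natrB // mulrBl e_realD -eab -e_realD subrr e_real0.
move/eqP: e1; apply/negP/e_real_neq1.
  by rewrite divr_gt0 // ltr0n subn_gt0.
by rewrite ltr_pdivrMr // mul1r ltr_nat (leq_ltn_trans (leq_subr _ _)).
Qed.

(** The e(c/M) with c < M are M distinct roots of X^M - 1, hence all of them. *)
Lemma unity_root_e (M : nat) (z : R[i]) : (0 < M)%N -> z ^+ M = 1 ->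
  exists c : nat, z = e (c%:R / M%:R).
Proof.
move=> M0 zM; pose s := [seq e (c%:R / M%:R) | c <- iota 0 M].
have hall : all M.-unity_root s.
  by apply/allP => _ /mapP[c _ ->]; rewrite unity_rootE e_real_root.
have hu : uniq s.
  rewrite map_inj_in_uniq ?iota_uniq // => a b; rewrite !mem_iota !add0n /=.
  exact: e_real_inj.
have hs : size s = M by rewrite size_map size_iota.
have := mem_unity_roots M0 hall hu hs z.
rewrite -topredE /= unity_rootE zM eqxx => /esym /mapP[c _ ->].
by exists c.
Qed.

Lemma e_real_modz (p : prime_nat) n (a b : int) : modz a (ppow p n) = modz b (ppow p n) ->
  e (a%:~R / (p : nat)%:R ^+ n) = e (b%:~R / (p : nat)%:R ^+ n).
Proof.
move=> /eqP; rewrite eqz_mod_dvd => /dvdzP[c ec].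
have p0 : (p : nat)%:R ^+ n != 0 :> R.
  by rewrite expf_neq0 // pnatr_eq0 -lt0n prime_gt0 // prime_valP.
have -> : a = b + c * ppow p n by rewrite -ec addrC subrK.
rewrite intrD mulrDl e_realD intrM ppowE rmorphXn /= mulfK //.
by rewrite e_real_int mulr1.
Qed.
End RootsOfUnity.

Section Characters.
Variables (R : realType) (p : prime_nat) (n : nat) (chi : int -> R[i]).
Hypothesis hchi : dirichlet_character (p ^ n)%N chi.
Hypothesis n0 : (0 < n)%N.
Local Notation pe n := (ppow p n).
Local Notation normc := (@Normc.normc R).

Lemma coprimez_ppow (a : int) j : (0 < j)%N -> coprimez a (pe j) = coprimez a (p : nat).
Proof.
by move=> j0; rewrite /ppow !coprimezE /= coprime_pexpr.
Qed.

Lemma chiM a b : chi (a * b) = chi a * chi b.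
Proof. by case: hchi. Qed.

Lemma chi_neq0 a : (chi a != 0) = coprimez a (p : nat).
Proof. by case: hchi => _ _ ->; rewrite -[X in coprimez a X]/(pe n) coprimez_ppow. Qed.

Lemma chi1 : chi 1 = 1.
Proof.
have c1 : chi 1 != 0 by rewrite chi_neq0 /coprimez gcd1z.
by apply: (mulfI c1); rewrite mulr1 -chiM mulr1.
Qed.

Lemma chiX a s : chi (a ^+ s) = chi a ^+ s.
Proof. by elim: s => [|s IH]; rewrite ?expr0 ?chi1 // !exprS chiM IH. Qed.

Lemma chi_modz a b : modz a (pe n) = modz b (pe n) -> chi a = chi b.
Proof.
have per m (c : nat) : chi (m + c%:Z * pe n) = chi m.
  elim: c => [|c IH]; first by rewrite mul0r addr0.
  by rewrite -addn1 PoszD mulrDl mul1r addrA -[RHS]IH; case: hchi => _ h _; exact: h.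
move=> /eqP; rewrite eqz_mod_dvd => /dvdzP[[c|c] ec].
  by rewrite -(per b c) -ec addrC subrK.
by rewrite -(per a c.+1) -[_.+1%:Z]opprK -NegzE mulNr -ec opprB addrC subrK.
Qed.

Lemma chi_eq0 a : ~~ coprimez a (p : nat) -> chi a = 0.
Proof. by rewrite -chi_neq0 negbK => /eqP. Qed.

Lemma modz_inverse (a : int) : coprimez a (p : nat) ->
  exists2 b : int, modz (a * b) (pe n) = modz 1 (pe n) & coprimez b (p : nat).
Proof.
rewrite -(coprimez_ppow a n0) => /coprimezP[[u v] /= e].
exists u; first by rewrite -e mulrC -modzDmr modzMl addr0.
rewrite -(coprimez_ppow u n0); apply/coprimezP; exists (a, v).
by rewrite /= mulrC.
Qed.

(** By Euler's theorem a power of the value is 1. The passage to the residue b in [0, p^n[ is needed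
    because Euler's theorem is stated for natural numbers. *)
Lemma normc_chi a : coprimez a (p : nat) -> normc (chi a) = 1.
Proof.
move=> ca; pose b := `|modz a (pe n)|%N.
have eb : b%:Z = modz a (pe n) by rewrite gez0_abs // modz_ge0 // pe_neq0.
have cb : coprime b (p ^ n).
  rewrite -[coprime _ _]/(coprimez b%:Z (pe n)) eb /coprimez gcdz_modl.
  by rewrite -/(coprimez a (pe n)) coprimez_ppow.
have eab : chi a = chi b%:Z by apply: chi_modz; rewrite eb modz_mod.
have q0 : (0 < totient (p ^ n))%N by rewrite totient_gt0 expn_gt0 prime_gt0 // prime_valP.
have := cyclic.Euler_exp_totient cb => he.
have e1 : chi b%:Z ^+ totient (p ^ n) = 1.
  rewrite -chiX -chi1; apply: chi_modz.
  by rewrite -natz -natrX natz /ppow !modz_nat he.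
have := congr1 normc e1; rewrite normcX Normc.normc1 eab => h.
apply/eqP; rewrite -(@eqrXn2 _ (totient (p ^ n)) (normc _) 1) ?normc_ge0 //.
by rewrite h expr1n.
Qed.

Lemma normc_chi_le1 a : normc (chi a) <= 1.
Proof.
have [/normc_chi ->//|/chi_eq0 ->] := boolP (coprimez a (p : nat)).
by rewrite Normc.normc0.
Qed.

Section Phase.
Variable kappa : nat.
Hypotheses (hk : (1 + iota' p 2 <= kappa)%N) (kn : (kappa < n)%N).
Let k0 : (0 < kappa)%N. Proof. exact: leq_trans hk. Qed.
Local Notation L := (padic_log p (3 * n)).
Local Notation e := (@e_real R).

Lemma chi_log1 y : modz (L (1 + pe kappa * y)) (pe n) = 0 -> chi (1 + pe kappa * y) = 1.
Proof.
move=> /dvdz_mod0P; rewrite padic_log_dvdE // => h; rewrite -chi1; apply: chi_modz.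
by rewrite -modzDmr (dvdz_mod0P h) addr0.
Qed.

Lemma modz_ppow_dvd a b m j : (m <= j)%N -> modz a (pe j) = modz b (pe j) -> modz a (pe m) = modz b (pe m).
Proof. by move=> mj h; rewrite -(modz_dvdm a (pe_dvd p mj)) h modz_dvdm // pe_dvd. Qed.

Lemma one_pkP s y : exists c, (1 + pe kappa * y) ^+ s = 1 + pe kappa * c.
Proof.
elim: s => [|s [c IH]]; first by exists 0; rewrite mulr0 addr0.
by exists (y + c + pe kappa * (y * c)); rewrite exprS IH; ring.
Qed.

(* [chi_log1] for the quotient of the two arguments; the inverse is written as a power. *)
Lemma chi_log_eq x y : modz (L (1 + pe kappa * x)) (pe n) = modz (L (1 + pe kappa * y)) (pe n) ->
  chi (1 + pe kappa * x) = chi (1 + pe kappa * y).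
Proof.
move=> hxy; have nN : (n <= 3 * n)%N by rewrite leq_pmull.
pose s := (p ^ n).-1.
have s1 : s.+1 = (p ^ n)%N by rewrite prednK // expn_gt0 prime_gt0 // prime_valP.
have LX z m : modz (L ((1 + pe kappa * z) ^+ m)) (pe n) = modz (m%:Z * L (1 + pe kappa * z)) (pe n).
  by apply: modz_ppow_dvd nN _; exact: padic_logX.
have LM z w : modz (L ((1 + pe kappa * z) * (1 + pe kappa * w))) (pe n) =
    modz (L (1 + pe kappa * z) + L (1 + pe kappa * w)) (pe n).
  have [c ->] := padic_logM p (3 * n) z w k0.
  by rewrite -modzDmr (_ : modz (pe (3 * n) * c) _ = 0) ?addr0 //; apply/dvdz_mod0P/dvdz_mulr/pe_dvd.
have [c ec] := one_pkP s y.
have h1 z : modz (L (1 + pe kappa * z)) (pe n) = modz (L (1 + pe kappa * y)) (pe n) ->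
    chi ((1 + pe kappa * z) * (1 + pe kappa * c)) = 1.
  move=> hz.
  rewrite (_ : _ * _ = 1 + pe kappa * (z + c + pe kappa * (z * c))); last by ring.
  apply: chi_log1.
  rewrite (_ : 1 + _ = (1 + pe kappa * z) * (1 + pe kappa * c)); last by ring.
  rewrite LM -modzDm hz -ec LX modzDm -{1}[L (1 + _)]mul1r -mulrDl -PoszD add1n s1.
  by rewrite -[Posz _]/(pe n) mulrC modzMl.
have h := h1 x hxy; have := h1 y erefl; rewrite -h !chiM => /mulIf -> //.
rewrite chi_neq0 -ec /coprimez; apply/eqP.
have : chi ((1 + pe kappa * y) * (1 + pe kappa * c)) != 0 by rewrite h1 // oner_eq0.
by rewrite -ec chiM mulf_eq0 negb_or => /andP[_]; rewrite chi_neq0 => /eqP.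
Qed.

(** Modulo p^n the group 1 + p^kappa Z is cyclic, generated by g = 1 + p^kappa, as the logarithm
    shows. Write log g = p^kappa nu and chi(g) = e(c/p^(n - kappa)); then al = c/nu is right at g
    and hence at all powers of g. *)
Lemma chi_phase_one : exists al : int,
  forall y, chi (1 + pe kappa * y) = e ((al * L (1 + pe kappa * y))%:~R / (p : nat)%:R ^+ n).
Proof.
have nN : (n <= 3 * n)%N by rewrite leq_pmull.
pose g := 1 + pe kappa * 1.
have LX z m : modz (L ((1 + pe kappa * z) ^+ m)) (pe n) = modz (m%:Z * L (1 + pe kappa * z)) (pe n).
  by apply: modz_ppow_dvd nN _; exact: padic_logX.
have [nu enu] : exists nu, L g = pe kappa * nu.
  have /dvdzP[nu ->] : (pe kappa %| L g)%Z by rewrite padic_log_dvdE // mulr1.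
  by exists nu; rewrite mulrC.
(* The logarithm of g has exactly the valuation kappa of g - 1, so p does not divide the cofactor
   nu. *)
have cnu : coprimez nu (p : nat).
  rewrite coprimez_sym coprimezE /= prime_coprime ?prime_valP //; apply/negP => pnu.
  have : (pe kappa.+1 %| L g)%Z.
    by rewrite enu (ppowE p kappa.+1) exprSr -ppowE dvdz_mul2l ?pe_neq0 // dvdzE.
  rewrite padic_log_dvdE // mulr1 dvdzE /= dvdn_Pexp2l ?ltnn // prime_gt1 // prime_valP.
  by [].
have epn : pe n = pe kappa * pe (n - kappa) by rewrite !ppowE -exprD subnKC // ltnW.
have gn : chi g ^+ (p ^ (n - kappa)) = 1.
  rewrite -chiX; have [c ec] := one_pkP (p ^ (n - kappa)) 1; rewrite /g ec; apply: chi_log1.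
  rewrite -ec LX -/g enu mulrCA -[Posz _]/(pe (n - kappa)) mulrA -epn.
  by rewrite mulrC modzMl.
have q0 : (0 < p ^ (n - kappa))%N by rewrite expn_gt0 prime_gt0 // prime_valP.
have [c ec] := unity_root_e q0 gn.
have [nu' enu' _] := modz_inverse cnu.
exists (c%:Z * nu') => y.
have [y' ey'] : exists y', L (1 + pe kappa * y) = pe kappa * y'.
  have /dvdzP[y' ->] : (pe kappa %| L (1 + pe kappa * y))%Z.
    by rewrite padic_log_dvdE // dvdz_mulr.
  by exists y'; rewrite mulrC.
have /modz_eqP[w ew] := enu'.
(* The exponent s = y'/nu modulo p^n is chosen so that g^s has the logarithm p^kappa y' of the given
   argument. *)
pose s := `|modz (y' * nu') (pe n)|%N.
have es : s%:Z = modz (y' * nu') (pe n) by rewrite gez0_abs // modz_ge0 // pe_neq0.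
have [v ev] : exists v, s%:Z = y' * nu' + v * pe n by apply/modz_eqP; rewrite es modz_mod.
have [d ed] := one_pkP s 1.
have -> : chi (1 + pe kappa * y) = chi (1 + pe kappa * d).
  apply: chi_log_eq; rewrite -ed LX -/g enu ey' ev; apply/esym/modz_eqP.
  exists (pe kappa * (y' * w + v * nu)).
  transitivity (pe kappa * (y' * (nu * nu') + v * pe n * nu)); first by ring.
  by rewrite ew; ring.
rewrite -ed chiX -/g ec -e_realX ey'.
rewrite (_ : e ((_ * _)%:~R / _) = e ((pe kappa * (c%:Z * s%:Z))%:~R / (p : nat)%:R ^+ n)); last first.
  apply: e_real_modz; rewrite ev; apply/modz_eqP; exists (- (pe kappa * c * v)).
  ring.
congr e; rewrite !intrM natrX ppowE rmorphXn /=.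
rewrite -{2}(subnKC (ltnW kn)) exprD.
have p0 m : (p : nat)%:R ^+ m != 0 :> R.
  by rewrite expf_neq0 // pnatr_eq0 -lt0n prime_gt0 // prime_valP.
rewrite -!pmulrn; field.
by rewrite !p0.
Qed.

Hypothesis hprim : primitive_character (p ^ n)%N chi.

(** Otherwise chi would itself be a character modulo p^(n-1): for a unit m with inverse m', m +
    p^(n-1) = m (1 + p^(n-1) m') modulo p^n. As n > 1, the units modulo p^(n-1) are again the
    integers prime to p. *)
Lemma primitive_nontriv : (1 < n)%N -> exists y, chi (1 + pe n.-1 * y) != 1.
Proof.
move=> n1; apply/not_existsP => h.
have {}h y : chi (1 + pe n.-1 * y) = 1 by apply/eqP/negPn/negP/h.
have n11 : (0 < n.-1)%N by case: (n) n1 => [|[]].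
case: hprim => _ /(_ (p ^ n.-1)%N); apply.
- by rewrite dvdn_exp2l // leq_pred.
- by rewrite ltn_exp2l ?prime_gt1 ?prime_valP // ltn_predL.
exists chi => //; split.
- exact: chiM.
- move=> m; have [cm|ncm] := boolP (coprimez m (p : nat)).
    have [m' em' _] := modz_inverse cm.
    transitivity (chi (m * (1 + pe n.-1 * m'))); last by rewrite chiM h mulr1.
    move/modz_eqP: em' => [w ew]; apply/chi_modz/modz_eqP; exists (- (pe n.-1 * w)).
    rewrite -[Posz _]/(pe n.-1).
    transitivity (m + pe n.-1 * (m * m') - pe n.-1 * w * pe n); last by ring.
    by rewrite ew; ring.
  rewrite !chi_eq0 //; apply: contra ncm.
  rewrite -!(coprimez_ppow _ n11) /coprimez -/(pe n.-1) => /eqP <-; apply/eqP.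
  by rewrite -[in RHS]gcdz_modl modzDr gcdz_modl.
by move=> m; rewrite chi_neq0 -(coprimez_ppow m n11).
Qed.

Lemma chi_phase : exists2 al : int, coprimez al (p : nat) &
  forall m0, coprimez m0 (p : nat) -> exists2 m : int, coprimez m (p : nat) &
    forall t, chi (m0 + pe kappa * t) =
      chi m0 * e ((al * L (1 + pe kappa * (m * t)))%:~R / (p : nat)%:R ^+ n).
Proof.
have [al hal] := chi_phase_one.
exists al.
  (* If p divided al, the phase would be trivial on 1 + p^(n-1) Z, against primitivity. *)
  rewrite coprimez_sym coprimezE /= prime_coprime ?prime_valP //; apply/negP => pal.
  have [y] := primitive_nontriv (leq_ltn_trans k0 kn).
  rewrite (_ : 1 + _ = 1 + pe kappa * (pe (n.-1 - kappa) * y)).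
    rewrite hal; case/eqP.
    rewrite (@e_real_modz _ p n _ 0) ?mul0r ?e_real0 // mod0z; apply/dvdz_mod0P.
    have /dvdzP[c ->] : (p %| al)%Z by rewrite dvdzE.
    have /dvdzP[d ->] : (pe n.-1 %| L (1 + pe kappa * (pe (n.-1 - kappa) * y)))%Z.
      rewrite padic_log_dvdE // mulrA !ppowE -exprD subnKC ?dvdz_mulr //.
      by case: (n) kn.
    rewrite mulrACA dvdz_mull // ppowE -exprS prednK // -ppowE.
    by [].
  by rewrite mulrA !ppowE -exprD subnKC //; case: (n) kn.
(* With m the inverse of m0, m0 + p^kappa t = m0 (1 + p^kappa m t) modulo p^n. *)
move=> m0 cm0; have [m em cm] := modz_inverse cm0; exists m => // t.
rewrite -hal -chiM; move/modz_eqP: em => [w ew].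
apply/chi_modz/modz_eqP; exists (- (pe kappa * t * w)).
transitivity (m0 + pe kappa * t * (m0 * m) - pe kappa * t * w * pe n); last by ring.
by rewrite ew; ring.
Qed.
End Phase.
End Characters.

(** * Character sums and the exponent datum *)

Section Parseval.
Variable R : realType.
Local Notation e := (@e_real R).
Local Notation normc := (@Normc.normc R).

Lemma e_real_orthogonal (M j k : nat) : (j < M)%N -> (k < M)%N ->
  \sum_(c < M) e ((c * j)%:R / M%:R) * conjc (e ((c * k)%:R / M%:R)) = (if j == k then M%:R else 0).
Proof.
move=> jM kM; have M0 : (0 < M)%N by apply: leq_ltn_trans jM.
pose w := e (j%:R / M%:R) * conjc (e (k%:R / M%:R)).
have eX c i : e ((c * i)%:R / M%:R) = e (i%:R / M%:R) ^+ c by rewrite natrM -mulrA e_realX.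
have -> : \sum_(c < M) e ((c * j)%:R / M%:R) * conjc (e ((c * k)%:R / M%:R)) = \sum_(c < M) w ^+ c.
  by apply: eq_bigr => c _; rewrite !eX rmorphXn -exprMn.
have [jk|jk] := eqVneq.
  have -> : w = 1 by rewrite /w jk -normc_sqr normc_e_real expr1n.
  rewrite (eq_bigr (fun=> 1)) ?sumr_const ?card_ord // => c _; exact: expr1n.
have w1 : w - 1 != 0.
  rewrite subr_eq0; apply: contra jk => /eqP w1; apply/eqP/(e_real_inj (R := R) jM kM).
  rewrite -[LHS]mulr1 -[X in _ * X](_ : conjc (e (k%:R / M%:R)) * e (k%:R / M%:R) = 1); last first.
    by rewrite mulrC -normc_sqr normc_e_real expr1n.
  by rewrite mulrA -/w w1 mul1r.
apply: (mulfI w1); rewrite mulr0 -subrX1.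
by rewrite /w exprMn -rmorphXn !e_real_root // rmorph1 mulr1 subrr.
Qed.

Lemma parseval (M : nat) (F : nat -> R[i]) :
  \sum_(c < M) normc (\sum_(j < M) F j * e ((c * j)%:R / M%:R)) ^+ 2
    = M%:R * \sum_(j < M) normc (F j) ^+ 2.
Proof.
apply: complexI; rewrite rmorph_sum rmorphM rmorph_sum rmorph_nat /=.
transitivity (\sum_(c < M) \sum_(j < M) \sum_(k < M)
   F j * conjc (F k) * (e ((c * j)%:R / M%:R) * conjc (e ((c * k)%:R / M%:R)))).
  apply: eq_bigr => c _; rewrite normc_sqr conjc_sum big_distrl /=.
  apply: eq_bigr => j _; rewrite big_distrr; apply: eq_bigr => k _ /=.
  by rewrite conjcM mulrACA.
rewrite exchange_big /= mulr_sumr; apply: eq_bigr => j _.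
rewrite exchange_big /= (bigD1 j) //= [X in _ + X]big1 ?addr0 => [|k kj].
  by rewrite -mulr_sumr e_real_orthogonal // eqxx -normc_sqr mulrC.
by rewrite -mulr_sumr e_real_orthogonal // eq_sym (inj_eq val_inj) (negbTE kj) mulr0.
Qed.

End Parseval.

Section DatumSums.
Variables (R : realType) (k l : R) (r : rat -> prime_nat -> nat -> R -> R) (delta : R)
    (n0 u0 : rat -> prime_nat -> nat -> R -> nat)
    (kappa0 : rat -> prime_nat -> nat) (lambda0 : rat -> prime_nat -> R).
Hypothesis hq : padic_exponent_datum k l r delta n0 u0 kappa0 lambda0.
Local Notation e := (@e_real R).
Local Notation normc := (@Normc.normc R).
Local Notation pe p n := (ppow p n).

(* The factor in front of B `^ (l - k) in the datum for y = 1 and w = kappa. *)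
Definition datum_size (C : R) (p : prime_nat) (kappa n : nat) (lambda : R) : R :=
  C * p%:R `^ r 1 p kappa lambda * (p%:R ^+ (n - 2 * kappa)) `^ k
    * ln (p%:R ^+ (n - 2 * kappa)) `^ delta.

(** With w = kappa and y = 1 the length allowed by the datum is Q = p^(n - 2 kappa), and (Q/B)^k B^l
    = Q^k B^(l-k). The inequality 2 kappa < n comes from the requirement n0 > kappa on the datum. *)
Lemma datum_phase_sum : exists2 C : R, 0 < C &
  forall (p : prime_nat) (kappa n : nat) (lambda : R),
    (1 + iota' p 2 <= kappa)%N -> rhoN p lambda -> (kappa0 1 p <= kappa)%N ->
    lambda0 1 p <= lambda -> (n0 1 p kappa lambda + kappa <= n)%N ->
  [/\ (2 * kappa < n)%N &
  forall (al m gam M : int) (B : nat), coprimez al (p : nat) -> coprimez m (p : nat) ->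
    (0 < B)%N -> (B <= p ^ (n - 2 * kappa))%N ->
  normc (\sum_(j < B) e ((al * padic_log p (3 * n) (1 + pe p kappa * (m * (M + j.+1%:Z)))
      + pe p kappa * gam * (M + j.+1%:Z))%:~R / (p : nat)%:R ^+ n))
    <= datum_size C p kappa n lambda * B%:R `^ (l - k)].
Proof.
case: hq => hkl [_ hn0 hu0 _ _] hn [C hC].
exists (Num.max C 1); first by rewrite lt_max ltr01 orbT.
move=> p kappa n lambda hk hlam hk0 hl0 hnn.
have adm : admissible p kappa lambda by [].
have nk := hn 1 p kappa lambda ltr01 adm.
rewrite iota'_1 addn0 in nk.
have n2k : (2 * kappa < n)%N by lia.
split=> // al m gam M B cal cm B0 BQ.
have k0 : (0 < kappa)%N by apply: leq_trans hk.
pose u := u0 1 p kappa lambda.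
have up : (0 < u)%N by case: hu0 => /(_ 1 p kappa lambda ltr01 adm).
have hF := phase_class_F u lambda gam k0 cal cm.
have p0 : (0 : R) < (p : nat)%:R by rewrite ltr0n prime_gt0 // prime_valP.
have eQ : (p : nat)%:R ^ (n%:Z - kappa%:Z - kappa%:Z - (iota' p 1)%:Z) = (p : nat)%:R ^+ (n - 2 * kappa) :> R.
  by rewrite iota'_1 exprnP; congr (_ ^ _); lia.
have := hC p 1 kappa%:Z kappa lambda n u ltr01 hk hlam _ up hk0 hl0 _ (leqnn _) _ hF M B%:R.
lazy zeta; rewrite eQ ltr0n B0.
have -> : (0 < n)%N by lia.
have -> : B%:R <= (p : nat)%:R ^+ (n - 2 * kappa) :> R by rewrite -natrX ler_nat.
have -> : kappa%:Z + (n0 1 p kappa lambda)%:Z <= n%:Z by lia.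
move=> /(_ isT isT isT isT).
rewrite normrE lecR /exp_sum natrK big_mkord.
rewrite (eq_bigr (fun j : 'I_B => e ((al * padic_log p (3 * n) (1 + pe p kappa * (m * (M + j.+1%:Z)))
      + pe p kappa * gam * (M + j.+1%:Z))%:~R / (p : nat)%:R ^+ n))); last first.
  by move=> j _; rewrite phase_eval.
move=> /le_trans; apply.
set Q := _ ^+ _; have Q0 : 0 < Q by rewrite exprn_gt0.
have B0' : (0 : R) < B%:R by rewrite ltr0n.
rewrite /datum_size -/Q.
have -> : (Q / B%:R) `^ k = Q `^ k * B%:R `^ (- k).
  rewrite powRM ?invr_ge0 ?(ltW Q0) ?(ltW B0') //; congr (_ * _).
  by rewrite -powR_inv1 ?(ltW B0') // -powRrM mulN1r.
rewrite powRD; last by rewrite (gt_eqF B0') implybT.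
set X := (p%:R) `^ _; set Y := Q `^ k; set Z := ln Q `^ _; set b := B%:R `^ l; set b' := B%:R `^ _.
have -> : C * (X * (Y * b') * b * Z) = C * (X * Y * b' * b * Z) by ring.
have -> : Num.max C 1 * X * Y * Z * (b * b') = Num.max C 1 * (X * Y * b' * b * Z) by ring.
apply: ler_wpM2r; last by rewrite le_max lexx.
by rewrite !mulr_ge0 // powR_ge0.
Qed.


Lemma sum_blocks (V : nmodType) (F : nat -> V) (K B x : nat) :
  \sum_(i < K * B + x) F i =
    \sum_(m < K) \sum_(j < B) F (m + K * j)%N + \sum_(i < x) F (K * B + i)%N.
Proof.
rewrite big_split_ord /=; congr (_ + _).
elim: B => [|B IH]; first by rewrite muln0 big_ord0 big1 // => m _; rewrite big_ord0.
rewrite mulnS addnC big_split_ord /= IH -big_split /=.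
by apply: eq_bigr => m _; rewrite big_ord_recr /= addnC.
Qed.

Section OneCharacter.
Variables (C : R) (p : prime_nat) (kappa n : nat) (lambda : R).
Local Notation E := (datum_size C p kappa n lambda).
Local Notation a := (l - k).
Hypotheses (hk : (1 + iota' p 2 <= kappa)%N) (n2k : (2 * kappa < n)%N).
Hypothesis hC : forall (al m gam M : int) (B : nat), coprimez al (p : nat) -> coprimez m (p : nat) ->
    (0 < B)%N -> (B <= p ^ (n - 2 * kappa))%N ->
  normc (\sum_(j < B) e ((al * padic_log p (3 * n) (1 + pe p kappa * (m * (M + j.+1%:Z)))
      + pe p kappa * gam * (M + j.+1%:Z))%:~R / (p : nat)%:R ^+ n))
    <= E * B%:R `^ a.

Let p0 : (0 : R) < (p : nat)%:R. Proof. by rewrite ltr0n prime_gt0 // prime_valP. Qed.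
Let k0 : (0 < kappa)%N. Proof. exact: leq_trans hk. Qed.

Lemma a_ge0 : 0 <= a.
Proof. by case: hq => -[_ k2 l2 _ _] _ _ _; rewrite subr_ge0 (le_trans k2). Qed.

Lemma a_le1 : a <= 1.
Proof. by case: hq => -[k1 _ _ l1 _] _ _ _; lra. Qed.

Lemma datum_size_ge1 : 1 <= E.
Proof.
have := @hC 1 1 0 0 1 (coprime1n _) (coprime1n _) isT _.
rewrite powR1 mulr1 big_ord1 normc_e_real; apply.
by rewrite expn_gt0 prime_gt0 // prime_valP.
Qed.

(* Parseval over the linear twists, that is over gam = p^kappa c with c modulo p^(n - 2 kappa). *)
Lemma datum_size_sqrt :
  Num.sqrt ((p : nat)%:R ^+ (n - 2 * kappa)) <= E * ((p : nat)%:R ^+ (n - 2 * kappa)) `^ a.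
Proof.
pose Q := (p ^ (n - 2 * kappa))%N.
have Q0 : (0 < Q)%N by rewrite expn_gt0 prime_gt0 // prime_valP.
have QR : (0 : R) < Q%:R by rewrite ltr0n.
pose F (j : nat) := e ((padic_log p (3 * n) (1 + pe p kappa * j.+1%:Z))%:~R / (p : nat)%:R ^+ n).
have hc (c : nat) : normc (\sum_(j < Q) F j * e ((c * j)%:R / Q%:R)) <= E * Q%:R `^ a.
  have := @hC 1 1 (pe p kappa * c%:Z) 0 Q (coprime1n _) (coprime1n _) Q0 (leqnn _).
  (* The datum sums over j + 1 where Parseval sums over j; the factor e(c/Q) of modulus 1 makes up
     for the shift. *)
  have -> : normc (\sum_(j < Q) F j * e ((c * j)%:R / Q%:R)) =
      normc (e (c%:R / Q%:R) * \sum_(j < Q) F j * e ((c * j)%:R / Q%:R)).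
    by rewrite Normc.normcM normc_e_real mul1r.
  apply: le_trans; rewrite mulr_sumr.
  rewrite le_eqVlt; apply/orP; left; apply/eqP; congr normc.
  apply: eq_bigr => j _; rewrite !mul1r add0r /F mulrCA -e_realD -e_realD intrD mulrDl.
  congr (e (_ + _)).
  rewrite !intrM ppowE !rmorphXn /= -!pmulrn natrM -natr1 /Q.
  rewrite (_ : p%:R ^+ n = p%:R ^+ kappa * p%:R ^+ kappa * p%:R ^+ (n - 2 * kappa) :> R); last first.
    by rewrite -!exprD; congr (_ ^+ _); lia.
  by field; rewrite !expf_neq0 ?gt_eqF.
rewrite -natrX -/Q.
have /(congr1 (fun x => x / Q%:R)) := parseval Q F.
rewrite [in RHS](eq_bigr (fun=> 1)); last by move=> j _; rewrite normc_e_real expr1n.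
rewrite sumr_const card_ord mulrAC divff ?gt_eqF // mul1r => e1.
have E0 : 0 <= E * Q%:R `^ a by apply: le_trans (hc 0%N); exact: normc_ge0.
rewrite -[leRHS]ger0_norm // -sqrtr_sqr ler_wsqrtr //.
(* Q^2 is the total of the squares of the Q twisted sums, each of which is at most (E Q^a)^2. *)
rewrite -(ler_pM2l QR).
have -> : Q%:R * Q%:R = \sum_(c < Q) normc (\sum_(j < Q) F j * e ((c * j)%:R / Q%:R)) ^+ 2.
  rewrite parseval (eq_bigr (fun=> 1)); last by move=> j _; rewrite normc_e_real expr1n.
  by rewrite sumr_const card_ord.
apply: (@le_trans _ _ (\sum_(c < Q) (E * Q%:R `^ a) ^+ 2)).
  by apply: ler_sum => c _; rewrite ler_sqr ?nnegrE ?normc_ge0.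
by rewrite sumr_const card_ord mulr_natl.
Qed.

Variable chi : int -> R[i].
Hypothesis hchi : primitive_character (p ^ n)%N chi.

Let hchi1 : dirichlet_character (p ^ n)%N chi. Proof. by case: hchi. Qed.
Let n1 : (0 < n)%N. Proof. by apply: leq_ltn_trans n2k. Qed.
Let E0 : 0 <= E. Proof. exact: le_trans datum_size_ge1. Qed.

Lemma char_sum_AP (m0 M : int) (B : nat) : (B <= p ^ (n - 2 * kappa))%N ->
  normc (\sum_(j < B) chi (m0 + pe p kappa * (M + j.+1%:Z))) <= E * B%:R `^ a.
Proof.
move=> BQ; have b0 : 0 <= E * B%:R `^ a by rewrite mulr_ge0 // powR_ge0.
case: (posnP B) => [->|B0]; first by rewrite big_ord0 Normc.normc0 // mulr_ge0 // powR_ge0.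
have kn : (kappa < n)%N by lia.
have [cm|cm] := boolP (coprimez m0 (p : nat)); last first.
  rewrite big1 ?Normc.normc0 // => j _; rewrite (chi_eq0 hchi1 n1) //.
  apply: contra cm; rewrite -!(coprimez_ppow p _ k0) /coprimez => /eqP <-.
  by rewrite -[in X in _ == X]gcdz_modl mulrC addrC modzMDl gcdz_modl.
have [al cal hal] := chi_phase hchi1 n1 hk kn hchi.
have [m cm' hm] := hal _ cm.
rewrite (eq_bigr (fun j : 'I_B => chi m0 *
   e ((al * padic_log p (3 * n) (1 + pe p kappa * (m * (M + j.+1%:Z)))
      + pe p kappa * 0 * (M + j.+1%:Z))%:~R / (p : nat)%:R ^+ n))); last first.
  by move=> j _; rewrite hm mulr0 mul0r addr0.
rewrite -mulr_sumr Normc.normcM (normc_chi hchi1 n1) // mul1r.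
exact: hC.
Qed.

Local Notation P := ((p : nat)%:R ^+ kappa : R).

(** Each class modulo P = p^kappa contributes x/P terms up to rounding, and x <= p^(n - kappa) keeps
    this within the range of the datum. The fewer than P leftover terms are bounded trivially by P
    (x/P)^a, using a <= 1 if x <= P and a >= 0 otherwise. The two parts give the factor 2. *)
Lemma char_sum_short (M : int) (x : nat) : (x <= p ^ (n - kappa))%N ->
  normc (\sum_(i < x) chi (M + i%:Z)) <= 2 * E * P * (x%:R / P) `^ a.
Proof.
move=> xY; have q0 : (0 < p ^ kappa)%N by rewrite expn_gt0 prime_gt0 // prime_valP.
have P0 : 0 < P by rewrite exprn_gt0.
set B := (x %/ p ^ kappa)%N; set x' := (x %% p ^ kappa)%N.
have ex : x = (p ^ kappa * B + x')%N by rewrite mulnC -divn_eq.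
have xP : 0 <= x%:R / P by rewrite divr_ge0 // ltW.
have BP : B%:R <= x%:R / P.
  by rewrite ler_pdivlMr // -natrX -natrM ler_nat leq_divM.
have BQ : (B <= p ^ (n - 2 * kappa))%N.
  apply: leq_trans (leq_div2r _ xY) _.
  by rewrite (_ : n - kappa = kappa + (n - 2 * kappa))%N ?expnD ?mulKn //; lia.
have part1 : normc (\sum_(m < p ^ kappa) \sum_(j < B) chi (M + (m + p ^ kappa * j)%N%:Z))
    <= E * P * (x%:R / P) `^ a.
  apply: le_trans (normc_sum _ _ _) _.
  apply: (@le_trans _ _ (\sum_(m < p ^ kappa) E * (x%:R / P) `^ a)).
    apply: ler_sum => m _.
    (* The datum sums start at M + 1, so the offset -1 makes j start at 0. *)
    rewrite (eq_bigr (fun j : 'I_B => chi ((M + m%:Z) + pe p kappa * (-1 + j.+1%:Z)))); last first.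
      by move=> j _; congr chi; rewrite -addn1 !PoszD PoszM /ppow; ring.
    apply: le_trans (char_sum_AP _ _ BQ) _; rewrite ler_wpM2l //.
    by apply: ge0_ler_powR; rewrite ?nnegrE ?a_ge0.
  by rewrite sumr_const card_ord -[leLHS]mulr_natl natrX mulrA (mulrC _ E).
have part2 : normc (\sum_(i < x') chi (M + (p ^ kappa * B + i)%N%:Z)) <= E * P * (x%:R / P) `^ a.
  apply: le_trans (normc_sum _ _ _) _.
  apply: (@le_trans _ _ x'%:R).
    rewrite (_ : x'%:R = \sum_(i < x') 1); last by rewrite sumr_const card_ord.
    by apply: ler_sum => i _; exact: normc_chi_le1 hchi1 n1 _.
  apply: (@le_trans _ _ (P * (x%:R / P) `^ a)); last first.
    rewrite -mulrA ler_peMl ?datum_size_ge1 // mulr_ge0 ?powR_ge0 // ltW //.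
  have [x1|x1] := leP (x%:R / P) 1.
    apply: (@le_trans _ _ (P * (x%:R / P))).
      by rewrite mulrCA divff ?gt_eqF // mulr1 ler_nat ex leq_addl.
    rewrite ler_pM2l //.
    case: (eqVneq (x%:R / P) 0) => [->|x0]; first exact: powR_ge0.
    by rewrite ger1_powR ?a_le1 // lt_neqAle eq_sym x0 xP.
  apply: (@le_trans _ _ P); first by rewrite -natrX ler_nat ltnW // ltn_mod.
  rewrite -[leLHS]mulr1 ler_pM2l //.
  by rewrite -[leLHS](powRr0 (x%:R / P)) ler_powR ?a_ge0 // ltW.
have -> : \sum_(i < x) chi (M + i%:Z) = \sum_(i < p ^ kappa * B + x') chi (M + i%:Z) by rewrite -ex.
rewrite (sum_blocks (fun i => chi (M + i%:Z))); apply: le_trans (normcD _ _) _.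
by apply: le_trans (lerD part1 part2) _; set X := _ `^ a; rewrite le_eqVlt; apply/orP; left; apply/eqP; ring.
Qed.

(** This is G x^a up to x = Y and G Y^(a-1) x beyond: one block bound G Y^a for each of the x/Y
    blocks of length Y. *)
Definition char_majorant (G Y : R) (x : nat) : R :=
  G * x%:R `^ a * Num.max 1 (x%:R / Y) `^ (1 - a).

(** A sum longer than q1 = p^(n - kappa) is cut into c blocks of length q1 and a remainder. As c + 1
    <= 2 x/q1, the constant 2 of [char_sum_short] becomes 4. *)
Lemma char_sum_le (x : nat) :
  normc (\sum_(i < x) chi i.+1%:Z) <=
    char_majorant (4 * E * P `^ (1 - a)) (p%:R ^+ (n - kappa)) x.
Proof.
pose q1 := (p ^ (n - kappa))%N.
have q10 : (0 < q1)%N by rewrite expn_gt0 prime_gt0 // prime_valP.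
have P0 : 0 < P by rewrite exprn_gt0.
have q1R : 0 < q1%:R :> R by rewrite ltr0n.
have xP (y : nat) : P * (y%:R / P) `^ a = P `^ (1 - a) * y%:R `^ a.
  rewrite powRM ?invr_ge0 ?(ltW P0) ?ler0n // mulrCA mulrC; congr (_ * _).
  rewrite -(powR_inv1 (ltW P0)) -powRrM mulN1r powRD ?powRr1 ?(ltW P0) //.
  by rewrite (gt_eqF P0) implybT.
rewrite /char_majorant (_ : p%:R ^+ (n - kappa) = q1%:R); last by rewrite natrX.
have [xY|xY] := leqP x q1.
  rewrite (_ : Num.max 1 _ = 1) ?powR1 ?mulr1; last first.
    by apply/max_idPl; rewrite ler_pdivrMr // mul1r ler_nat.
  have -> : \sum_(i < x) chi i.+1%:Z = \sum_(i < x) chi (1 + i%:Z).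
    by apply: eq_bigr => i _; rewrite -addn1 PoszD addrC.
  apply: le_trans (char_sum_short 1 xY) _; rewrite -mulrA xP.
  have : 0 <= E * (P `^ (1 - a) * x%:R `^ a) by rewrite mulr_ge0 // mulr_ge0 ?powR_ge0.
  rewrite -!mulrA; lra.
have x1 : (1 : R) <= x%:R / q1%:R by rewrite ler_pdivlMr // mul1r ler_nat ltnW.
rewrite (_ : Num.max 1 _ = x%:R / q1%:R); last exact/max_idPr.
set c := (x %/ q1)%N; set x' := (x %% q1)%N.
have ex : x = (c * q1 + x')%N by rewrite -divn_eq.
have c1 : (c%:R : R) <= x%:R / q1%:R by rewrite ler_pdivlMr // -natrM ler_nat leq_divM.
have blk M (y : nat) : (y <= q1)%N ->
    normc (\sum_(i < y) chi (M + i%:Z)) <= 2 * E * P `^ (1 - a) * q1%:R `^ a.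
  move=> yq; apply: le_trans (char_sum_short M yq) _.
  rewrite -mulrA xP mulrA; apply: ler_wpM2l.
    by apply: mulr_ge0; [exact: mulr_ge0|exact: powR_ge0].
  by apply: ge0_ler_powR; rewrite ?nnegrE ?a_ge0 ?ler_nat.
have cblk (d : nat) : normc (\sum_(i < d * q1) chi (1 + i%:Z)) <= d%:R * (2 * E * P `^ (1 - a) * q1%:R `^ a).
  elim: d => [|d IH]; first by rewrite mul0n big_ord0 Normc.normc0 mul0r.
  rewrite mulSnr big_split_ord /= -natr1 mulrDl mul1r.
  apply: le_trans (normcD _ _) _; apply: lerD => //.
  rewrite (eq_bigr (fun i : 'I_q1 => chi ((1 + (d * q1)%N%:Z) + i%:Z))); first exact: blk.
  by move=> i _; rewrite PoszD addrA.
have -> : \sum_(i < x) chi i.+1%:Z = \sum_(i < c * q1 + x') chi (1 + i%:Z).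
  by rewrite -ex; apply: eq_bigr => i _; rewrite -addn1 PoszD addrC.
rewrite big_split_ord /=; apply: le_trans (normcD _ _) _.
apply: (@le_trans _ _ ((c%:R + 1) * (2 * E * P `^ (1 - a) * q1%:R `^ a))).
  rewrite mulrDl mul1r; apply: lerD; first exact: cblk.
  rewrite (eq_bigr (fun i : 'I_x' => chi ((1 + (c * q1)%N%:Z) + i%:Z))); last first.
    by move=> i _; rewrite PoszD addrA.
  by apply: blk; rewrite ltnW // ltn_mod.
apply: (@le_trans _ _ ((2 * (x%:R / q1%:R)) * (2 * E * P `^ (1 - a) * q1%:R `^ a))).
  apply: ler_wpM2r; last by lra.
  by apply: mulr_ge0; rewrite ?powR_ge0 // mulr_ge0 ?powR_ge0 // mulr_ge0.
have x0 : 0 < x%:R / q1%:R :> R by apply: lt_le_trans x1.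
have -> : x%:R `^ a = q1%:R `^ a * (x%:R / q1%:R) `^ a.
  by rewrite -powRM ?(ltW x0) ?(ltW q1R) // mulrCA divff ?mulr1 // gt_eqF.
have e1 : (x%:R / q1%:R) `^ a * (x%:R / q1%:R) `^ (1 - a) = x%:R / q1%:R.
  rewrite -powRD ?(gt_eqF x0) ?implybT // addrC subrK powRr1 // ltW //.
by rewrite -!mulrA e1; lra.
Qed.
End OneCharacter.

End DatumSums.

(** * Gauss sums *)

Section GaussSum.
Variables (R : realType) (p : prime_nat) (n : nat) (chi : int -> R[i]).
Hypothesis hprim : primitive_character (p ^ n)%N chi.
Hypothesis n1 : (1 < n)%N.
Local Notation e := (@e_real R).
Local Notation normc := (@Normc.normc R).
Local Notation pe n := (ppow p n).
Local Notation q := (p ^ n)%N.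

Let hchi : dirichlet_character q chi. Proof. by case: hprim. Qed.
Let n0 : (0 < n)%N. Proof. exact: ltnW. Qed.
Let q0 : (0 < q)%N. Proof. by rewrite expn_gt0 prime_gt0 // prime_valP. Qed.

Lemma primitive_conj : primitive_character q (fun m => conjc (chi m)).
Proof.
case: hprim => -[h1 h2 h3] h; split; first split.
- by move=> a b; rewrite h1 rmorphM.
- by move=> m; rewrite h2.
- by move=> m; rewrite conjc_eq0 h3.
move=> d dq dltq [psi [g1 g2 g3] hpsi]; apply: (h d dq dltq).
exists (fun m => conjc (psi m)); last by move=> m cm; rewrite -hpsi // conjcK.
split.
- by move=> a b; rewrite g1 rmorphM.
- by move=> m; rewrite g2.
by move=> m; rewrite conjc_eq0 g3.
Qed.

Lemma sum_residues_mul (H : int -> R[i]) (c : int) : coprimez c (p : nat) ->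
  (forall x y, modz x (pe n) = modz y (pe n) -> H x = H y) ->
  \sum_(b < q) H (b%:Z * c) = \sum_(b < q) H b%:Z.
Proof.
move=> cc hH.
have lt (b : 'I_q) : (`|modz (b%:Z * c) (pe n)| < q)%N.
  have := @ltz_pmod (b%:Z * c) (pe n) (pe_gt0 p n).
  have := @modz_ge0 (b%:Z * c) (pe n) (pe_neq0 p n).
  by rewrite /ppow; lia.
pose f (b : 'I_q) := Ordinal (lt b).
have fE b : (f b : nat)%:Z = modz (b%:Z * c) (pe n).
  by rewrite /= gez0_abs // modz_ge0 // pe_neq0.
have cpc : coprimez (pe n) c by rewrite coprimez_sym coprimez_ppow.
have ltq (b : 'I_q) : 0 <= (b : nat)%:Z < pe n by rewrite /ppow /= ltz_nat.
have finj : injective f.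
  move=> b b' /(congr1 (fun i : 'I_q => (i : nat)%:Z)); rewrite !fE => /eqP.
  rewrite eqz_mod_dvd -mulrBl (Gauss_dvdzl _ cpc) -eqz_mod_dvd.
  rewrite (modz_small (ltq b)) (modz_small (ltq b')) => /eqP [] h.
  exact/val_inj.
rewrite [RHS](reindex_inj finj); apply: eq_bigr => b _; apply: hH.
by rewrite fE modz_mod.
Qed.

(** The Gauss sum of the conjugate character: with this choice the twisted sums in [gauss_twist]
    reproduce chi itself. *)
Definition gauss_sum : R[i] := \sum_(b < q) conjc (chi b%:Z) * e (b%:R / q%:R).

Lemma e_q_modz (m x y : int) : modz x (pe n) = modz y (pe n) ->
  e ((x * m)%:~R / q%:R) = e ((y * m)%:~R / q%:R).
Proof.
by move=> h; rewrite natrX; apply: e_real_modz; rewrite -modzMml h modzMml.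
Qed.

(** If m is prime to p, substitute b m for b. If p divides m, take c = 1 modulo p^(n-1) with chi(c)
    != 1: replacing b by c b leaves e(m b/q) unchanged but multiplies the sum by conj(chi(c)), so it
    vanishes. *)
Lemma gauss_twist (m : nat) :
  \sum_(b < q) conjc (chi b%:Z) * e ((m * b)%:R / q%:R) = chi m%:Z * gauss_sum.
Proof.
have hm b : (m * b)%:R = (b%:Z * m%:Z)%:~R :> R by rewrite mulnC intrM -!pmulrn natrM.
pose H x : R[i] := conjc (chi x) * e ((x * m%:Z)%:~R / q%:R).
have HH x y : modz x (pe n) = modz y (pe n) -> H x = H y.
  by move=> h; rewrite /H (chi_modz hchi h) (e_q_modz _ h).
have -> : \sum_(b < q) conjc (chi b%:Z) * e ((m * b)%:R / q%:R) = \sum_(b < q) H b%:Z.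
  by apply: eq_bigr => b _; rewrite hm.
have [cm|ncm] := boolP (coprimez m%:Z (p : nat)).
  pose H1 x : R[i] := conjc (chi x) * e ((x * 1)%:~R / q%:R).
  have HH1 x y : modz x (pe n) = modz y (pe n) -> H1 x = H1 y.
    by move=> h; rewrite /H1 (chi_modz hchi h) (e_q_modz _ h).
  have -> : gauss_sum = \sum_(b < q) H1 b%:Z.
    by apply: eq_bigr => b _; rewrite /H1 mulr1.
  rewrite -(sum_residues_mul cm HH1) mulr_sumr; apply: eq_bigr => b _.
  have E1 : chi m%:Z * conjc (chi m%:Z) = 1 by rewrite -normc_sqr (normc_chi hchi n0 cm) expr1n.
  rewrite /H /H1 mulr1 (chiM hchi) conjcM [RHS]mulrA; congr (_ * _).
  by rewrite mulrCA E1 mulr1.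
rewrite (chi_eq0 hchi n0 ncm) mul0r.
have [y hy] := primitive_nontriv hchi n0 hprim n1.
set c := 1 + _ in hy.
have cc : coprimez c (p : nat).
  rewrite -(coprimez_ppow p _ (_ : 0 < n.-1)%N); last by case: (n) n1 => [|[]].
  by rewrite /c /coprimez -gcdz_modl mulrC addrC modzMDl gcdz_modl gcd1z.
have := sum_residues_mul cc HH.
have -> : \sum_(b < q) H (b%:Z * c) = conjc (chi c) * \sum_(b < q) H b%:Z.
  rewrite mulr_sumr; apply: eq_bigr => b _; rewrite /H (chiM hchi) conjcM.
  rewrite [RHS]mulrA (mulrC (conjc (chi c))); congr (_ * _).
  rewrite natrX; apply: e_real_modz; apply/modz_eqP.
  have /dvdzP[d ->] : (p %| m%:Z)%Z.
    move: ncm; rewrite coprimez_sym coprimezE /= prime_coprime ?prime_valP // negbK.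
    by rewrite dvdzE.
  exists (b%:Z * y * d); rewrite /c.
  have -> : pe n = pe n.-1 * p%:Z by rewrite !ppowE -exprSr prednK.
  ring.
move=> h; apply/eqP; have : (conjc (chi c) - 1) * (\sum_(b < q) H b%:Z) == 0.
  by rewrite mulrBl mul1r h subrr.
rewrite mulf_eq0 subr_eq0 => /orP[/eqP e1|//].
by case/eqP: hy; rewrite -[LHS]conjcK e1 conjc1.
Qed.

(** Parseval for conj(chi): by [gauss_twist] both sides contain the sum of |chi(b)|^2, which is
    positive and cancels. *)
Lemma normc_gauss : normc gauss_sum = Num.sqrt q%:R.
Proof.
have := parseval q (fun b => conjc (chi b%:Z)).
rewrite (eq_bigr (fun c : 'I_q => normc (chi c%:Z) ^+ 2 * normc gauss_sum ^+ 2)); last first.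
  by move=> c _; rewrite gauss_twist Normc.normcM exprMn.
rewrite -mulr_suml.
rewrite [in RHS](eq_bigr (fun b : 'I_q => normc (chi b%:Z) ^+ 2)); last first.
  by move=> b _; rewrite normc_conj.
rewrite [RHS]mulrC => /mulfI h.
rewrite -[LHS]ger0_norm ?normc_ge0 // -sqrtr_sqr h //.
have q1 : (1 < q)%N by rewrite -(expn0 p) ltn_exp2l ?prime_gt1 ?prime_valP.
rewrite gt_eqF // (bigD1 (Ordinal q1)) //=.
rewrite (chi1 hchi n0) Normc.normc1 expr1n ltr_pwDl ?ltr01 //.
by apply: sumr_ge0 => b _; rewrite sqr_ge0.
Qed.

End GaussSum.

(** * The series of (1 - w)^(-1/2) *)

Section CentralBinomial.
Variable R : realType.

(* C(2m, m) / 4^m, the coefficient of w^m in (1 - w)^(-1/2). *)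
Definition cb (m : nat) : R := \prod_(j < m) ((2 * j + 1)%:R / (2 * j + 2)%:R).

Let natr21 m : (2 * m + 1)%:R = 2 * m%:R + 1 :> R. Proof. by rewrite natrD natrM. Qed.
Let natr22 m : (2 * m + 2)%:R = 2 * m%:R + 2 :> R. Proof. by rewrite natrD natrM. Qed.

Lemma cb0 : cb 0 = 1.
Proof. by rewrite /cb big_ord0. Qed.

Lemma cbS m : cb m.+1 = cb m * ((2 * m + 1)%:R / (2 * m + 2)%:R).
Proof. by rewrite /cb big_ord_recr. Qed.

Lemma cb_gt0 m : 0 < cb m.
Proof. by apply: prodr_gt0 => j _; rewrite divr_gt0 // ltr0n ?addn1 ?addn2. Qed.

Lemma cbB m : cb m - cb m.+1 = cb m / (2 * m + 2)%:R.
Proof.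
rewrite cbS natr21 natr22; have : (0 : R) <= m%:R by [].
by move=> m0; field; lra.
Qed.

Lemma cb_decr m : cb m.+1 <= cb m.
Proof. by rewrite -subr_ge0 cbB divr_ge0 // ltW // cb_gt0. Qed.

(** The left side does not increase with m, because (2m+1)(2m+3) <= (2m+2)^2. *)
Lemma cb_sqr_le m : cb m ^+ 2 * (2 * m + 1)%:R <= 1.
Proof.
elim: m => [|m IH]; first by rewrite cb0 expr1n mul1r.
rewrite cbS exprMn; apply: le_trans IH; rewrite -mulrA ler_wpM2l ?sqr_ge0 //.
rewrite !natr21 natr22 -natr1; have m0 : (0 : R) <= m%:R by [].
set x := m%:R in m0 *.
rewrite expr_div_n mulrAC ler_pdivrMr ?exprn_gt0 //; last by lra.
nra.
Qed.

Lemma cb_le m : cb m <= (Num.sqrt m.+1%:R)^-1.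
Proof.
have s0 : 0 < Num.sqrt m.+1%:R :> R by rewrite sqrtr_gt0 ltr0n.
rewrite -[leRHS]mul1r ler_pdivlMr // -(ler_pXn2r (ltn0Sn 1)) ?nnegrE //.
- rewrite exprMn sqr_sqrtr // expr1n; apply: le_trans (cb_sqr_le m).
  by rewrite ler_wpM2l ?sqr_ge0 // ler_nat; lia.
- by rewrite mulr_ge0 // ?ltW ?cb_gt0.
Qed.

(** The square of the series is 1/(1 - w). Let d(m) be the convolution. By the symmetry i -> m - i,
    the weights 2i sum to m d(m); together with 2(j+1) cb(j+1) = (2j+1) cb(j) this yields (m+1)
    d(m+1) = (m+1) d(m). *)
Lemma cb_conv m : \sum_(i < m.+1) cb i * cb (m - i)%N = 1.
Proof.
pose d m := \sum_(i < m.+1) cb i * cb (m - i)%N.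
have half j : (2 * j.+1)%:R * cb j.+1 = (2 * j + 1)%:R * cb j.
  rewrite cbS mulnS addnC; have : (2 * j + 2)%:R != 0 :> R by rewrite pnatr_eq0 addn2.
  by move=> h; field.
have sym m' : \sum_(i < m'.+1) (2 * i)%:R * (cb i * cb (m' - i)%N) = m'%:R * d m'.
  have e1 : \sum_(i < m'.+1) (2 * i)%:R * (cb i * cb (m' - i)%N) =
     \sum_(i < m'.+1) (2 * (m' - i))%N%:R * (cb i * cb (m' - i)%N).
    rewrite (reindex_inj rev_ord_inj); apply: eq_bigr => i _ /=.
    by rewrite subSS subKn 1?[cb (m' - _)%N * _]mulrC // -ltnS.
  have : (\sum_(i < m'.+1) (2 * i)%:R * (cb i * cb (m' - i)%N)) *+ 2 = (m'%:R * d m') *+ 2.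
    rewrite {1}mulr2n {2}e1 -big_split /= /d mulr_sumr -sumrMnl; apply: eq_bigr => i _.
    rewrite -mulrDl -natrD -mulnDr subnKC -1?ltnS // natrM -mulrA mulr_natl.
    by [].
  by move=> /eqP; rewrite -subr_eq0 -mulrnBl mulrn_eq0 /= subr_eq0 => /eqP.
elim: m => [|m IH]; first by rewrite big_ord1 cb0 mulr1.
have m1 : m.+1%:R != 0 :> R by rewrite pnatr_eq0.
apply: (mulfI m1); rewrite -/(d m.+1) -sym big_ord_recl muln0 mul0r add0r.
have -> : \sum_(i < m.+1) (2 * (lift ord0 i))%:R * (cb (lift ord0 i) * cb (m.+1 - lift ord0 i)%N) =
   \sum_(i < m.+1) ((2 * i)%:R * (cb i * cb (m - i)%N) + cb i * cb (m - i)%N).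
  apply: eq_bigr => i _; rewrite mulrA half subSS natrD; ring.
by rewrite big_split /= sym /d IH !mulr1 natr1.
Qed.

(** For t2(m) = 1/(m cb(m)^2), t2 decreases while t2(m) - 1/m increases, as t2 <= 4 and 4/(2m+1)^2
    <= 1/m - 1/(m+1). So t2(m) is within 1/m of its limit T. With t = sqrt(t2(m)) >= 1 and K = sqrt
    T, the error is cb(m)(t - K), and t - K <= (t - K)(t + K) <= 1/m. *)
Lemma cb_asymptotic : exists2 K : R, 0 <= K & forall m, (0 < m)%N ->
  `|(Num.sqrt m%:R)^-1 - K * cb m| <= (m%:R * Num.sqrt m%:R)^-1.
Proof.
pose t2 m : R := (m%:R * cb m ^+ 2)^-1.
have t2S m : (0 < m)%N -> t2 m - t2 m.+1 = t2 m / (2 * m + 1)%:R ^+ 2.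
  move=> m0; rewrite /t2 cbS; have c0 := cb_gt0 m; move: (cb m) c0 => c c0.
  have : (0 : R) < m%:R by rewrite ltr0n.
  rewrite natr21 natr22 -natr1; move: (m%:R) => x x0.
  field; rewrite ?gt_eqF //; lra.
have t2_gt0 m : (0 < m)%N -> 0 < t2 m.
  by move=> m0; rewrite invr_gt0 mulr_gt0 ?ltr0n // exprn_gt0 // cb_gt0.
have t2_decr m j : (0 < m)%N -> t2 (m + j)%N <= t2 m.
  move=> m0; elim: j => [|j]; first by rewrite addn0.
  apply: le_trans; rewrite addnS -subr_ge0 t2S ?ltn_addr //.
  by rewrite divr_ge0 ?sqr_ge0 // ltW // t2_gt0 // ltn_addr.
have t2_le4 m : (0 < m)%N -> t2 m <= 4.
  move=> m0; rewrite -(subnKC m0); apply: le_trans (t2_decr 1%N _ isT) _.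
  by rewrite (_ : t2 1%N = 4) // /t2 cbS cb0 natr21 natr22; field.
have t2_incr m j : (0 < m)%N -> t2 m - m%:R^-1 <= t2 (m + j)%N - (m + j)%:R^-1.
  move=> m0; elim: j => [|j IH]; first by rewrite addn0.
  apply: le_trans IH _; rewrite addnS.
  have n0 : (0 < m + j)%N by rewrite ltn_addr.
  have := t2S _ n0; have := t2_le4 _ n0; have := t2_gt0 _ n0.
  have : (0 : R) < (m + j)%:R by rewrite ltr0n.
  move: (t2 (m + j)%N) (t2 (m + j).+1) => a b; rewrite natr21 -(natr1 (m + j)).
  move: (m + j)%:R => x x0 a0 a4 e1.
  have : a / (2 * x + 1) ^+ 2 <= x^-1 - (x + 1)^-1.
    rewrite (_ : x^-1 - _ = 1 / (x * (x + 1))); last by field; lra.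
    rewrite ler_pdivrMr ?exprn_gt0 //; last by lra.
    rewrite mulrAC ler_pdivlMr; last by nra.
    nra.
  by rewrite -e1; lra.
(* By Wallis' formula T is pi; only its position between the two monotone sequences enters. *)
pose T := inf [set t2 m | m in [set m | (0 < m)%N]].
have T_le m : (0 < m)%N -> T <= t2 m.
  move=> m0; apply: ge_inf; last by exists m.
  by exists 0 => _ [j j0 <-]; rewrite ltW // t2_gt0.
have T_ge m : (0 < m)%N -> t2 m - m%:R^-1 <= T.
  move=> m0; apply: lb_le_inf; first by exists (t2 1); exists 1%N.
  move=> _ [j /= j0 <-]; have [mj|jm] := leqP m j.
    rewrite -(subnKC mj); apply: le_trans (t2_incr m (j - m)%N m0) _.
    by rewrite gerBl invr_ge0.
  apply: (@le_trans _ _ (t2 m)); first by rewrite gerBl invr_ge0.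
  by rewrite -(subnKC (ltnW jm)); apply: t2_decr.
exists (Num.sqrt T) => [|m m0]; first exact: sqrtr_ge0.
have mR : (0 : R) < m%:R by rewrite ltr0n.
have sm : 0 < Num.sqrt m%:R :> R by rewrite sqrtr_gt0.
have c0 := cb_gt0 m.
pose t := (Num.sqrt m%:R * cb m)^-1.
have t0 : 0 < t by rewrite invr_gt0 mulr_gt0.
have et : t ^+ 2 = t2 m by rewrite /t /t2 exprVn exprMn sqr_sqrtr // ltW.
have t1 : 1 <= t.
  rewrite -(ler_pXn2r (ltn0Sn 1)) ?nnegrE ?ler01 ?(ltW t0) // expr1n et /t2 invf_ge1 ?mulr_gt0 ?exprn_gt0 //.
  apply: le_trans (cb_sqr_le m); rewrite mulrC ler_wpM2l ?sqr_ge0 // ler_nat; lia.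
have K0 : 0 <= Num.sqrt T by exact: sqrtr_ge0.
have T0 : 0 <= T.
  apply: lb_le_inf; first by exists (t2 1); exists 1%N.
  by move=> _ [j /= j0 <-]; rewrite ltW // t2_gt0.
have eK : Num.sqrt T ^+ 2 = T by rewrite sqr_sqrtr.
have h1 : t ^+ 2 - m%:R^-1 <= Num.sqrt T ^+ 2 by rewrite eK et T_ge.
have h2 : Num.sqrt T ^+ 2 <= t ^+ 2 by rewrite eK et T_le.
move: (Num.sqrt T) K0 h1 h2 => K K0 h1 h2.
have Kt : K <= t by rewrite -(ler_pXn2r (ltn0Sn 1)) ?nnegrE // ltW.
have tK : t - K <= m%:R^-1.
  have : (t - K) * (t + K) <= m%:R^-1 by rewrite -subr_sqr; lra.
  apply: le_trans; rewrite ler_peMr; lra.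
have es : (Num.sqrt m%:R)^-1 = cb m * t by rewrite /t invfM mulrCA divff ?mulr1 // gt_eqF.
rewrite es (mulrC K) -mulrBr normrM gtr0_norm // ger0_norm ?subr_ge0 //.
rewrite invfM mulrC; apply: ler_pM; rewrite ?subr_ge0 ?(ltW c0) //.
apply: le_trans (cb_le m) _; rewrite lef_pV2 ?posrE ?sqrtr_gt0 ?ltr0n //.
by rewrite ler_wsqrtr // ler_nat.
Qed.
End CentralBinomial.

(** * The function (1 - w)^(-1/2) on the unit disc *)

Section InverseSqrt.
Variable R : realType.
Local Notation C := R[i].
Local Notation normc := (@Normc.normc R).

(** The image of the closed right half-plane under the principal square root. *)
Definition sector (z : C) : bool := `|complex.Im z| <= complex.Re z.

Lemma normc_sqrE (z : C) : normc z ^+ 2 = complex.Re z ^+ 2 + complex.Im z ^+ 2.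
Proof. by case: z => a b; rewrite /= sqr_sqrtr // addr_ge0 // sqr_ge0. Qed.

(** Two elements of the sector enclose an angle of at most pi/2, so adding one to the other cannot
    shorten it. *)
Lemma sector_addr (a b : C) : sector a -> sector b -> normc a <= normc (a + b).
Proof.
move=> sa sb; rewrite -(ler_pXn2r (ltn0Sn 1)) ?nnegrE ?normc_ge0 // !normc_sqrE.
case: a b sa sb => [a1 a2] [b1 b2]; rewrite /sector /= !ler_norml.
by move=> /andP[? ?] /andP[? ?]; nra.
Qed.

Lemma sector_Re (a : C) : sector a -> normc a <= 2 * complex.Re a.
Proof.
move=> sa; have r0 : 0 <= complex.Re a by apply: le_trans sa.
rewrite -(ler_pXn2r (ltn0Sn 1)) ?nnegrE ?normc_ge0 ?mulr_ge0 // normc_sqrE.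
case: a sa r0 => a1 a2; rewrite /sector /= ler_norml => /andP[? ?] ?; nra.
Qed.

Definition alpha (w : C) : C := sqrtc (1 - w).
Definition sigma (w : C) : C := (alpha w)^-1.

Lemma alpha_sqr w : alpha w ^+ 2 = 1 - w.
Proof. exact: sqr_sqrtc. Qed.

Lemma Re_1B w : normc w <= 1 -> 0 <= complex.Re (1 - w).
Proof.
move=> w1; have := Re_le_normc w; case: w w1 => a b /= w1.
by lra.
Qed.

(** Re(alpha^2) = Re(alpha)^2 - Im(alpha)^2 is Re(1 - w) >= 0, and the principal root has Re(alpha)
    >= 0. *)
Lemma alpha_sector w : normc w <= 1 -> sector (alpha w).
Proof.
move=> /Re_1B; rewrite -alpha_sqr.
have : 0 <= complex.Re (alpha w).
  by rewrite /alpha; case: (1 - w) => a b; rewrite /= sqrtr_ge0.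
case: (alpha w) => a b; rewrite /sector expr2 /= => a0 h.
rewrite -(ger0_norm a0) -(ler_pXn2r (ltn0Sn 1)) ?nnegrE ?normr_ge0 //.
by rewrite -!normrX !ger0_norm ?sqr_ge0 // !expr2; lra.
Qed.

Lemma alpha_neq0 w : w != 1 -> alpha w != 0.
Proof.
apply: contra => /eqP h; have := alpha_sqr w; rewrite h expr0n /= => /esym/eqP.
by rewrite subr_eq0 eq_sym.
Qed.

Lemma normc_alpha w : normc (alpha w) ^+ 2 = normc (1 - w).
Proof. by rewrite -normcX alpha_sqr. Qed.

Definition cbpoly (N : nat) (w : C) : C := \sum_(m < N) (cb R m)%:C * w ^+ m.

(** By [cb_conv] the coefficients of the square are 1 below w^N. The N remaining ones are incomplete
    convolutions, hence at most 1. *)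
Lemma cbpoly_sqr N w : normc w <= 1 ->
  normc (cbpoly N w ^+ 2 - \sum_(m < N) w ^+ m) <= N%:R * normc w ^+ N.
Proof.
move=> w1; pose P : {poly C} := \poly_(m < N) (cb R m)%:C.
have -> : cbpoly N w = P.[w] by rewrite horner_poly.
rewrite expr2 -hornerM (@horner_coef_wide _ (N + N)); last first.
  apply: leq_trans (size_polyMleq _ _) _; apply: leq_trans (leq_pred _) _.
  by apply: leq_add; exact: size_poly.
rewrite big_split_ord /= addrAC.
have cE m : (m < N)%N -> (P * P)`_m = 1.
  move=> mN; rewrite coefM -[RHS](rmorph1 (real_complex R)) -(cb_conv R m) rmorph_sum.
  apply: eq_bigr => j _; rewrite rmorphM !coef_poly.
  by rewrite (leq_ltn_trans _ mN) ?(leq_ltn_trans (leq_subr _ _) mN) // -ltnS.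
rewrite -sumrB big1 ?add0r => [|m _]; last by rewrite cE ?ltn_ord // mul1r subrr.
apply: le_trans (normc_sum _ _ _) _.
rewrite (_ : N%:R * _ = \sum_(i < N) normc w ^+ N); last first.
  by rewrite sumr_const card_ord mulr_natl.
apply: ler_sum => i _; rewrite Normc.normcM normcX exprD mulrA.
have wi : normc w ^+ i <= 1 by rewrite exprn_ile1 ?normc_ge0.
have wN : 0 <= normc w ^+ N by rewrite exprn_ge0 // normc_ge0.
have wi0 : 0 <= normc w ^+ i by rewrite exprn_ge0 // normc_ge0.
suff c1 : normc (P * P)`_(N + i) <= 1.
  have c0 := normc_ge0 ((P * P)`_(N + i)).
  by rewrite -[leRHS]mul1r -mulrA (mulrC (_ ^+ N)) mulrA ler_wpM2r // mulr_ile1.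
rewrite coefM; apply: le_trans (normc_sum _ _ _) _.
rewrite -[leRHS](cb_conv R (N + i)); apply: ler_sum => j _.
rewrite Normc.normcM; apply: ler_pM; rewrite ?normc_ge0 // coef_poly;
  case: ifP => _; rewrite ?normc_real ?ger0_norm ?Normc.normc0 // ltW ?cb_gt0 //.
Qed.

(** By telescoping, 1 - (1 - w) P is a combination of powers of w whose nonnegative coefficients
    cb(m) - cb(m+1), together with the last cb, sum to 1. So it lies in the unit disc and (1 - w) P
    in the right half-plane. *)
Lemma cbpoly_Re N w : normc w <= 1 -> 0 <= complex.Re ((1 - w) * cbpoly N w).
Proof.
move=> w1; suff : normc (1 - (1 - w) * cbpoly N w) <= 1.
  move=> h; have := le_trans (Re_le_normc _) h.
  by case: ((1 - w) * _) => a b /=; lra.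
case: N => [|N]; first by rewrite /cbpoly big_ord0 mulr0 subr0 Normc.normc1.
have cS m := cb_decr R m; have c0 m := cb_gt0 R m.
have wX m : normc w ^+ m <= 1 by rewrite exprn_ile1 ?normc_ge0.
have cw c m : 0 <= c -> normc (c%:C * w ^+ m) <= c.
  by move=> cc; rewrite Normc.normcM normc_real ger0_norm // normcX ler_piMr.
have : normc (1 - (1 - w) * cbpoly N.+1 w - (cb R N)%:C * w ^+ N.+1) <= 1 - cb R N.
  elim: N => [|N IH].
    rewrite /cbpoly big_ord1 cb0 rmorph1 !mul1r mulr1 expr1 opprB addrCA subrr addr0 subrr.
    by rewrite Normc.normc0 subrr.
  have -> : 1 - (1 - w) * cbpoly N.+2 w - (cb R N.+1)%:C * w ^+ N.+2 =
     (1 - (1 - w) * cbpoly N.+1 w - (cb R N)%:C * w ^+ N.+1) + (cb R N - cb R N.+1)%:C * w ^+ N.+1.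
    rewrite {1}/cbpoly big_ord_recr /= -/(cbpoly N.+1 w) rmorphB /= (exprSr w N.+1).
    move: (cbpoly _ _) (w ^+ N.+1) (real_complex _ _) (real_complex _ _) => P W c1 c2.
    ring.
  apply: le_trans (normcD _ _) _.
  have := cw (cb R N - cb R N.+1) N.+1; rewrite subr_ge0 => /(_ (cS N)); lra.
have := cw _ N.+1 (ltW (c0 N)).
move: (1 - _ * _) => X; move: (_ * _) => Y h1 h2.
have := normcD (X - Y) Y; rewrite subrK; lra.
Qed.

(* With P the partial sum, b = (1 - w) P and a = alpha w both have nonnegative real part,
   so |b^2 - a^2| controls |b - a|. *)
Lemma cbpoly_cvg N w : normc w <= 1 -> w != 1 ->
  normc (cbpoly N w - sigma w) * normc (alpha w) <= 2 * (2 * N%:R + 1) * normc w ^+ N.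
Proof.
move=> w1 wn1; set P := cbpoly N w; set b := (1 - w) * P; set a := alpha w.
have a0 : a != 0 by exact: alpha_neq0.
have na0 : 0 < normc a by exact: normc_gt0.
have ea : a ^+ 2 = 1 - w by exact: alpha_sqr.
have sa := sector_Re (alpha_sector w1).
have bR := cbpoly_Re N w1.
set W := \sum_(m < N) w ^+ m.
have eW : (1 - w) * W = 1 - w ^+ N by rewrite -opprB mulNr -subrX1 opprB.
have hR := cbpoly_sqr N w1; rewrite -/P -/W in hR.
have nba : normc a <= 2 * normc (b + a).
  apply: le_trans sa _; rewrite ler_pM2l // -/a.
  have := Re_le_normc (b + a); move: bR; rewrite -/b.
  by case: (b) (a) => [? ?] [? ?] /=; lra.
(* Both sides are b^2 - a^2, since a^2 (P - sigma w) = b - a; the right side exposes the quantity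
   bounded in [cbpoly_sqr]. *)
have eq1 : (P - sigma w) * a * (a * (b + a)) = a ^+ 2 * (- w ^+ N + (1 - w) * (P ^+ 2 - W)).
  have -> : (P - sigma w) * a = P * a - 1 by rewrite mulrBl mulVf.
  rewrite [in RHS]mulrBr eW /b -ea; ring.
have : normc (P - sigma w) * normc a * (normc a * normc (b + a)) <=
     normc a ^+ 2 * ((2 * N%:R + 1) * normc w ^+ N).
  rewrite -!Normc.normcM eq1 Normc.normcM normcX ler_wpM2l ?sqr_ge0 //.
  apply: le_trans (normcD _ _) _; rewrite normcN normcX Normc.normcM.
  have h2 : normc (1 - w) <= 2.
    by apply: le_trans (normcB _ _) _; rewrite Normc.normc1; lra.
  have := normc_ge0 (1 - w); have := normc_ge0 (P ^+ 2 - W).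
  move: hR h2; move: (normc (P ^+ 2 - W)) (normc (1 - w)) (normc w ^+ N) (N%:R) => x y z t.
  by move=> *; nra.
have := normc_ge0 (P - sigma w).
move: (normc (b + a)) (normc (P - sigma w)) nba na0 => y x; move: (normc a) => c h c0 x0.
have : 0 <= normc w ^+ N by rewrite exprn_ge0 ?normc_ge0.
have : (0 : R) <= N%:R by [].
move: (normc w ^+ N) (N%:R) => W' t t0 W0 h1.
have h3 : x * c * (c * c) <= c ^+ 2 * (2 * (2 * t + 1) * W').
  apply: (@le_trans _ _ (2 * (x * c * (c * y)))).
    rewrite (_ : x * c * (c * c) = (x * c * c) * c); last by ring.
    rewrite (_ : 2 * _ = (x * c * c) * (2 * y)); last by ring.
    by rewrite ler_wpM2l // !mulr_ge0 // ltW.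
  by have := h1; lra.
move: h3; rewrite mulrC -expr2 ler_pM2l //; exact: exprn_gt0.
Qed.

(** The difference is (w - w') sigma sigma'/(alpha + alpha'), and in the sector |alpha + alpha'| >=
    |alpha|, so each of the three factors costs at most s. *)
Lemma sigma_diff w w' (s : R) : normc w <= 1 -> normc w' <= 1 -> w != 1 -> w' != 1 ->
  normc (sigma w) <= s -> normc (sigma w') <= s ->
  normc (sigma w - sigma w') <= normc (w - w') * s ^+ 3.
Proof.
move=> w1 w1' n1 n1' hs hs'.
have a0 := alpha_neq0 n1; have a0' := alpha_neq0 n1'.
have sa := alpha_sector w1; have sa' := alpha_sector w1'.
have ab := sector_addr sa sa'.
have na := normc_gt0 a0.
have ab0 : alpha w + alpha w' != 0.
  by apply/eqP => e; move: ab; rewrite e Normc.normc0; lra.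
have -> : sigma w - sigma w' = (w - w') * (sigma w * sigma w' * (alpha w + alpha w')^-1).
  rewrite /sigma (_ : w - w' = alpha w' ^+ 2 - alpha w ^+ 2); last first.
    by rewrite !alpha_sqr; ring.
  field.
  by rewrite a0 a0' ab0.
rewrite Normc.normcM ler_wpM2l ?normc_ge0 // !Normc.normcM !exprS expr0 mulr1 mulrA.
have t : normc (alpha w + alpha w')^-1 <= s.
  by apply: le_trans hs; rewrite /sigma !Normc.normcV lef_pV2 ?posrE //; apply: lt_le_trans ab.
by apply: ler_pM; rewrite ?mulr_ge0 ?normc_ge0 //; apply: ler_pM; rewrite ?normc_ge0.
Qed.

End InverseSqrt.

Section UnitCircle.
Variable R : realType.
Local Notation e := (@e_real R).
Local Notation normc := (@Normc.normc R).

Lemma normc_1Be (x : R) : normc (1 - e x) = 2 * `|sin (pi * x)|.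
Proof.
apply/eqP; rewrite -(@eqrXn2 _ 2) ?normc_ge0 ?mulr_ge0 // normc_sqrE exprMn real_normK ?num_real //.
rewrite e_realE /= (_ : 2 * pi * x = pi * x *+ 2); last by ring.
have := cos2Dsin2 (pi * x); rewrite cos_mulr2n sin_mulr2n.
move: (cos _) (sin _) => c s h; apply/eqP.
have -> : (1 - (c ^+ 2 *+ 2 - 1)) ^+ 2 + (0 - (c * s) *+ 2) ^+ 2 = 4 * ((1 - c ^+ 2) ^+ 2 + c ^+ 2 * s ^+ 2) by ring.
have -> : s ^+ 2 = 1 - c ^+ 2 by lra.
by ring.
Qed.

Lemma sin_eq_cosM (y : R) : 0 <= y -> exists2 c, 0 <= c <= y & sin y = cos c * y.
Proof.
move=> y0; have [|c cy e] := @MVT_segment R sin cos 0 y y0 (fun x _ => is_derive_sin x).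
  by apply: continuous_subspaceT => x; exact: continuous_sin.
by exists c; [rewrite in_itv in cy|move: e; rewrite sin0 !subr0].
Qed.

Lemma normc_1Be_le (x : R) : 0 <= x -> normc (1 - e x) <= 2 * pi * x.
Proof.
move=> x0; rewrite normc_1Be; have p0 := pi_ge0 R.
have [c _ ->] := sin_eq_cosM (mulr_ge0 p0 x0).
rewrite normrM (ger0_norm (mulr_ge0 p0 x0)) -!mulrA ler_pM2l //.
by rewrite ler_piMl ?mulr_ge0 // cos_max.
Qed.

(** Put y = pi x/2 <= pi/4. Then sin(2y) = 2 sin y cos y = 2 y cos c cos y for some c <= y, both
    cosines are at least 1/sqrt 2, and y >= x because pi >= 2. *)
Lemma normc_1Be_ge (x : R) : 0 <= x -> x <= 2^-1 -> 2 * x <= normc (1 - e x).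
Proof.
move=> x0 x1; rewrite normc_1Be ler_pM2l //; apply: le_trans (ler_norm _).
have p2 := pi_ge2 R; have p0 := pi_ge0 R.
have y0 : 0 <= pi * x / 2 by rewrite divr_ge0 ?mulr_ge0.
have [c /andP[c0 cy] es] := sin_eq_cosM y0.
have hc t : 0 <= t -> t <= pi * x / 2 -> 0 <= cos t /\ 1 <= 2 * cos t ^+ 2.
  move=> t0 ty; have tp : t <= pi / 4 by nra.
  split; first by apply: cos_ge0_pihalf; apply/andP; split; lra.
  have : 0 <= cos (t *+ 2) by apply: cos_ge0_pihalf; apply/andP; split; lra.
  by rewrite cos_mulr2n; lra.
have [h1 h2] := hc _ c0 cy; have [h3 h4] := hc _ y0 (lexx _).
have -> : pi * x = (pi * x / 2) *+ 2 by field.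
rewrite sin_mulr2n es; move: (cos c) (cos (pi * x / 2)) h1 h2 h3 h4 => a b h1 h2 h3 h4.
have ab : 1 <= 2 * (b * a).
  rewrite expr2 in h2; rewrite expr2 in h4.
  case: (leP a b) => [ab|/ltW ab].
    by have := ler_wpM2r h1 ab; lra.
  by have := ler_wpM2l h3 ab; lra.
have : x <= pi * x / 2 by nra.
move: (pi * x / 2) y0 => y y0; nra.
Qed.
End UnitCircle.

Section Kernel.
Variable R : realType.
Local Notation C := R[i].
Local Notation normc := (@Normc.normc R).

Definition kern (r1 r2 : R) (z : C) : C := sigma (r2%:C * z) - sigma (r1%:C * z).

Lemma sigma_diffE w w' : normc w <= 1 -> normc w' <= 1 -> w != 1 -> w' != 1 ->
  sigma w - sigma w' = (w - w') * (sigma w * sigma w' * (alpha w + alpha w')^-1).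
Proof.
move=> w1 w1' n1 n1'.
have a0 := alpha_neq0 n1; have a0' := alpha_neq0 n1'.
have ab := sector_addr (alpha_sector w1) (alpha_sector w1').
have na := normc_gt0 a0.
have ab0 : alpha w + alpha w' != 0.
  by apply/eqP => e; move: ab; rewrite e Normc.normc0; lra.
rewrite /sigma (_ : w - w' = alpha w' ^+ 2 - alpha w ^+ 2); last first.
  by rewrite !alpha_sqr; ring.
by field; rewrite a0 a0' ab0.
Qed.

Lemma normc_inv_alphaD w w' : normc w <= 1 -> normc w' <= 1 -> w != 1 -> w' != 1 ->
  normc (alpha w + alpha w')^-1 <= normc (sigma w).
Proof.
move=> w1 w1' n1 n1'.
have na := normc_gt0 (alpha_neq0 n1).
have ab := sector_addr (alpha_sector w1) (alpha_sector w1').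
by rewrite /sigma !Normc.normcV lef_pV2 ?posrE //; apply: lt_le_trans ab.
Qed.

Lemma normc_mulB (a b a' b' : C) :
  normc (a * b - a' * b') <= normc (a - a') * normc b + normc a' * normc (b - b').
Proof.
have -> : a * b - a' * b' = (a - a') * b + a' * (b - b') by ring.
by apply: le_trans (normcD _ _) _; rewrite !Normc.normcM.
Qed.

Variables (r1 r2 : R) (s : R).
Hypotheses (r10 : 0 <= r1) (r12 : r1 <= r2) (r21 : r2 < 1).

Let in_disc (z : C) (r : R) : 0 <= r -> r <= r2 -> normc z = 1 ->
  normc (r%:C * z) <= 1 /\ r%:C * z != 1.
Proof.
move=> r0 rr z1; have nr : normc (r%:C * z) = r by rewrite Normc.normcM z1 mulr1 normc_real ger0_norm.
split; first by rewrite nr (le_trans rr) // ltW.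
by apply/eqP => e1; move: nr; rewrite e1 Normc.normc1 => e2; move: (le_lt_trans rr r21); rewrite -e2 ltxx.
Qed.

(** The two values of sigma in [kern] are varied separately, so nothing is gained from r1 and r2
    being close; [kern_diff] exploits that. *)
Lemma kern_diff_crude (z z' : C) : normc z = 1 -> normc z' = 1 ->
  normc (sigma (r1%:C * z)) <= s -> normc (sigma (r2%:C * z)) <= s ->
  normc (sigma (r1%:C * z')) <= s -> normc (sigma (r2%:C * z')) <= s ->
  normc (kern r1 r2 z - kern r1 r2 z') <= 2 * normc (z - z') * s ^+ 3.
Proof.
move=> z1 z1' s1 s2 s1' s2'; have r20 := le_trans r10 r12.
have [d1 n1] := in_disc r10 r12 z1; have [d2 n2] := in_disc r20 (lexx _) z1.
have [d1' n1'] := in_disc r10 r12 z1'; have [d2' n2'] := in_disc r20 (lexx _) z1'.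
have s0 : 0 <= s by apply: le_trans s1; exact: normc_ge0.
have h1 := sigma_diff d1 d1' n1 n1' s1 s1'.
have h2 := sigma_diff d2 d2' n2 n2' s2 s2'.
have hr r : 0 <= r -> r <= r2 -> normc (r%:C * z - r%:C * z') <= normc (z - z').
  move=> r0 rr; rewrite -mulrBr Normc.normcM normc_real ger0_norm // ler_piMl ?normc_ge0 //.
  by apply: le_trans rr _; exact: ltW.
have -> : kern r1 r2 z - kern r1 r2 z' =
  (sigma (r2%:C * z) - sigma (r2%:C * z')) - (sigma (r1%:C * z) - sigma (r1%:C * z')).
  by rewrite /kern; ring.
apply: le_trans (normcB _ _) _.
have s3 : 0 <= s ^+ 3 by rewrite exprn_ge0.
have := ler_wpM2r s3 (hr _ r10 r12); have := ler_wpM2r s3 (hr _ r20 (lexx _)).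
lra.
Qed.

(** The kernel is (r2 - r1) z sigma(r2 z) sigma(r1 z) T(z) with T the inverse of the sum of the two
    roots, so r2 - r1 comes out before z varies. The variation of z gives s^3; the two sigma and T
    give 1 + 1 + 2 = 4 times s^5. *)
Lemma kern_diff (z z' : C) : normc z = 1 -> normc z' = 1 ->
  normc (sigma (r1%:C * z)) <= s -> normc (sigma (r2%:C * z)) <= s ->
  normc (sigma (r1%:C * z')) <= s -> normc (sigma (r2%:C * z')) <= s ->
  normc (kern r1 r2 z - kern r1 r2 z') <= (r2 - r1) * normc (z - z') * (s ^+ 3 + 4 * s ^+ 5).
Proof.
move=> z1 z1' s1 s2 s1' s2'; have r20 := le_trans r10 r12.
have [d1 n1] := in_disc r10 r12 z1; have [d2 n2] := in_disc r20 (lexx _) z1.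
have [d1' n1'] := in_disc r10 r12 z1'; have [d2' n2'] := in_disc r20 (lexx _) z1'.
have s0 : 0 <= s by apply: le_trans s1; exact: normc_ge0.
set ep := normc (z - z'); have ep0 : 0 <= ep by exact: normc_ge0.
have hr r : 0 <= r -> r <= r2 -> normc (r%:C * z - r%:C * z') <= ep.
  move=> r0 rr; rewrite -mulrBr Normc.normcM normc_real ger0_norm // ler_piMl ?normc_ge0 //.
  by apply: le_trans rr _; exact: ltW.
have s3 : 0 <= s ^+ 3 by rewrite exprn_ge0.
have h1 : normc (sigma (r1%:C * z) - sigma (r1%:C * z')) <= ep * s ^+ 3.
  by apply: le_trans (sigma_diff d1 d1' n1 n1' s1 s1') _; rewrite ler_wpM2r // hr.
have h2 : normc (sigma (r2%:C * z) - sigma (r2%:C * z')) <= ep * s ^+ 3.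
  by apply: le_trans (sigma_diff d2 d2' n2 n2' s2 s2') _; rewrite ler_wpM2r // hr.
have al w w' : normc w <= 1 -> normc w' <= 1 -> w != 1 -> w' != 1 ->
    normc (sigma w) <= s -> normc (w - w') <= ep -> normc (alpha w' - alpha w) <= ep * s.
  move=> dw dw' nw nw' sw ww.
  have na := normc_gt0 (alpha_neq0 nw).
  have ab := sector_addr (alpha_sector dw) (alpha_sector dw').
  have ab0 : alpha w + alpha w' != 0.
    by apply/eqP => e; move: ab; rewrite e Normc.normc0; lra.
  have -> : alpha w' - alpha w = (w - w') * (alpha w + alpha w')^-1.
    rewrite (_ : w - w' = (alpha w' - alpha w) * (alpha w + alpha w')) ?mulfK //.
    by rewrite (addrC (alpha w)) -subr_sqr !alpha_sqr; ring.
  rewrite Normc.normcM; apply: ler_pM; rewrite ?normc_ge0 //.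
  exact: le_trans (normc_inv_alphaD dw dw' nw nw') sw.
pose T z := (alpha (r2%:C * z) + alpha (r1%:C * z))^-1.
have hT : normc (T z) <= s by exact: le_trans (normc_inv_alphaD d2 d1 n2 n1) s2.
have hT' : normc (T z') <= s by exact: le_trans (normc_inv_alphaD d2' d1' n2' n1') s2'.
have Tn y : normc y = 1 -> alpha (r2%:C * y) + alpha (r1%:C * y) != 0.
  move=> y1; have [e1 f1] := in_disc r10 r12 y1; have [e2 f2] := in_disc r20 (lexx _) y1.
  have na := normc_gt0 (alpha_neq0 f2).
  have ab := sector_addr (alpha_sector e2) (alpha_sector e1).
  by apply/eqP => e; move: ab; rewrite e Normc.normc0; lra.
have dT : normc (T z - T z') <= 2 * (ep * s ^+ 3).
  have -> : T z - T z' = ((alpha (r2%:C * z') - alpha (r2%:C * z)) +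
      (alpha (r1%:C * z') - alpha (r1%:C * z))) * (T z * T z').
    have := Tn _ z1; have := Tn _ z1'; rewrite /T.
    move: (alpha _) (alpha _) (alpha _) (alpha _) => a b c d *; field.
    by apply/andP; split.
  rewrite Normc.normcM (Normc.normcM (T z)).
  rewrite (_ : 2 * (ep * s ^+ 3) = (2 * (ep * s)) * (s * s)); last by ring.
  apply: ler_pM; rewrite ?mulr_ge0 ?normc_ge0 //; last by apply: ler_pM; rewrite ?normc_ge0.
  apply: le_trans (normcD _ _) _.
  have := al _ _ d2 d2' n2 n2' s2 (hr _ r20 (lexx _)).
  have := al _ _ d1 d1' n1 n1' s1 (hr _ r10 r12).
  lra.
have eK y : normc y = 1 -> kern r1 r2 y =
    (r2 - r1)%:C * (y * (sigma (r2%:C * y) * (sigma (r1%:C * y) * T y))).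
  move=> y1; have [e1 f1] := in_disc r10 r12 y1; have [e2 f2] := in_disc r20 (lexx _) y1.
  by rewrite /kern sigma_diffE // -/(T y) rmorphB /=; ring.
rewrite !eK // -mulrBr Normc.normcM normc_real ger0_norm ?subr_ge0 // -mulrA.
rewrite ler_wpM2l ?subr_ge0 //.
move: (T z) (T z') (sigma (r1%:C * z)) (sigma (r2%:C * z)) (sigma (r1%:C * z')) (sigma (r2%:C * z')) s1 s2 s1' s2' h1 h2 hT hT' dT.
move=> t t' a b c d ha hb hc hd hac hbd ht ht' htt.
apply: le_trans (normc_mulB _ _ _ _) _; rewrite z1' mul1r -/ep.
have g1 : normc (b * (a * t)) <= s ^+ 3.
  rewrite !Normc.normcM (_ : s ^+ 3 = s * (s * s)); last by ring.
  by apply: ler_pM; rewrite ?mulr_ge0 ?normc_ge0 //; apply: ler_pM; rewrite ?normc_ge0.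
have g2 : normc (a * t - c * t') <= 3 * ep * s ^+ 4.
  apply: le_trans (normc_mulB _ _ _ _) _.
  have : normc (a - c) * normc t <= (ep * s ^+ 3) * s by apply: ler_pM; rewrite ?normc_ge0.
  have : normc c * normc (t - t') <= s * (2 * (ep * s ^+ 3)) by apply: ler_pM; rewrite ?normc_ge0.
  lra.
have g3 : normc (b * (a * t) - d * (c * t')) <= 4 * ep * s ^+ 5.
  apply: le_trans (normc_mulB _ _ _ _) _.
  have : normc (b - d) * normc (a * t) <= (ep * s ^+ 3) * (s * s).
    apply: ler_pM; rewrite ?normc_ge0 // Normc.normcM; apply: ler_pM; rewrite ?normc_ge0 //.
  have : normc d * normc (a * t - c * t') <= s * (3 * ep * s ^+ 4).
    by apply: ler_pM; rewrite ?normc_ge0.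
  lra.
have := ler_wpM2l ep0 g1; lra.
Qed.

End Kernel.

(** * Weighted sums of powers *)

Section PowerSums.
Variable R : realType.
Implicit Types (x s Z a Y : R).

(** Lets powers be summed by telescoping instead of comparison with an integral. With t = s/x in
    [0, 1] the estimate rests on exp(-t) <= 1/(1+t) <= 1 - t/2, which is where s/2 comes from. *)
Lemma powR_diff_ge x s : 1 <= x -> 0 < s -> s <= 1 ->
  s / 2 * x `^ (s - 1) <= x `^ s - (x - 1) `^ s.
Proof.
move=> x1 s0 s1; have x0 : 0 < x by apply: lt_le_trans x1.
have -> : x `^ (s - 1) = x `^ s / x.
  by rewrite powRD ?(gt_eqF x0) ?implybT // powR_inv1 // ltW.
have xs : 0 < x `^ s by apply: powR_gt0.
suff : (x - 1) `^ s <= x `^ s * (1 - s / 2 / x) by lra.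
have [->|xn1] := eqVneq x 1.
  by rewrite subrr powR0 ?gt_eqF // powR1; lra.
have x1' : 1 < x by rewrite lt_neqAle eq_sym xn1.
have -> : x - 1 = x * (1 - x^-1) by rewrite mulrBr mulr1 divff // gt_eqF.
have xi : x^-1 < 1 by rewrite invf_lt1.
have xi0 : 0 < x^-1 by rewrite invr_gt0.
rewrite powRM ?(ltW x0) ?subr_ge0 ?(ltW xi) // ler_pM2l //.
have y0 : 0 < 1 - x^-1 by rewrite subr_gt0.
rewrite /powR (gt_eqF y0).
have l1 : ln (1 - x^-1) <= - x^-1 by apply: le_ln1Dx; lra.
apply: (@le_trans _ _ (expR (s * - x^-1))).
  by rewrite ler_expR ler_pM2l.
rewrite mulrN expRN.
have e1 := expR_ge1Dx (s / x).
have sx : 0 < s / x by rewrite divr_gt0.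
have sx1 : s / x <= 1 by rewrite ler_pdivrMr // mul1r (le_trans s1).
apply: (@le_trans _ _ (1 + s / x)^-1).
  by rewrite lef_pV2 ?posrE ?expR_gt0 //; lra.
rewrite -[leLHS]mul1r ler_pdivrMr; last by lra.
rewrite (mulrAC s); move: (s / x) sx sx1 => t *; nra.
Qed.

Lemma powRN_diff_ge x s : 0 < x -> 0 < s ->
  s * (x + 1) `^ (- s - 1) <= x `^ (- s) - (x + 1) `^ (- s).
Proof.
move=> x0 s0; set y := x + 1; have y0 : 0 < y by rewrite /y; lra.
have -> : y `^ (- s - 1) = y `^ (- s) / y.
  by rewrite powRD ?(gt_eqF y0) ?implybT // powR_inv1 // ltW.
have ys : 0 < y `^ (- s) by apply: powR_gt0.
suff : y `^ (- s) * (1 + s / y) <= x `^ (- s) by lra.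
have -> : x = y * (1 - y^-1) by rewrite mulrBr mulr1 divff ?gt_eqF // /y addrK.
have yi : y^-1 < 1 by rewrite invf_lt1 // /y; lra.
have z0 : 0 < 1 - y^-1 by rewrite subr_gt0.
rewrite powRM ?(ltW y0) ?(ltW z0) // ler_pM2l // /powR (gt_eqF z0).
have l1 : ln (1 - y^-1) <= - y^-1 by apply: le_ln1Dx; lra.
apply: le_trans (expR_ge1Dx _) _; rewrite ler_expR mulNr -mulrN ler_pM2l //; lra.
Qed.

Lemma sum_powR_le s Z N : 0 < s -> s <= 1 -> 0 <= Z ->
  \sum_(i < N) (if i.+1%:R <= Z then i.+1%:R `^ (s - 1) else 0) <= 2 / s * Z `^ s.
Proof.
move=> s0 s1 Z0.
have mono x y : 0 <= x -> x <= y -> x `^ s <= y `^ s.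
  by move=> x0 xy; apply: ge0_ler_powR; rewrite ?nnegrE ?(ltW s0) ?(le_trans x0).
have c0 : 0 < 2 / s by rewrite divr_gt0.
(* The induction on N needs a bound that grows with the number of terms counted so far. *)
suff h : \sum_(i < N) (if i.+1%:R <= Z then i.+1%:R `^ (s - 1) else 0) <= 2 / s * (Num.min N%:R Z) `^ s.
  by apply: le_trans h _; rewrite ler_pM2l //; apply: mono; rewrite ?le_min ?ler0n // ge_min lexx orbT.
elim: N => [|N IH].
  by rewrite big_ord0 mulr_ge0 ?powR_ge0 // ltW.
rewrite big_ord_recr /=; case: ifP => hN; last first.
  rewrite addr0; apply: le_trans IH _; rewrite ler_pM2l //; apply: mono.
    by rewrite le_min ler0n.
  by rewrite le_min !ge_min lexx orbT ler_nat leqnSn.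
have NZ : N%:R <= Z by apply: le_trans hN; rewrite ler_nat.
rewrite (min_idPl NZ) in IH; rewrite (min_idPl hN).
have := @powR_diff_ge N.+1%:R s _ s0 s1; rewrite ler1n => /(_ isT).
rewrite (_ : N.+1%:R - 1 = N%:R :> R) => [h|]; last by rewrite -natr1 addrK.
have := ler_wpM2l (ltW c0) h; rewrite !mulrA (_ : 2 / s * s / 2 = 1) ?mul1r; last first.
  by field; lra.
lra.
Qed.

Lemma sum_inv_le Z N : 1 <= Z ->
  \sum_(i < N) (if i.+1%:R <= Z then i.+1%:R^-1 else 0) <= 1 + ln Z.
Proof.
move=> Z1; have Z0 : 0 < Z by apply: lt_le_trans Z1.
case: N => [|N]; first by rewrite big_ord0 addr_ge0 // ln_ge0.
suff h : \sum_(i < N.+1) (if i.+1%:R <= Z then i.+1%:R^-1 else 0) <= 1 + ln (Num.min N.+1%:R Z).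
  apply: le_trans h _; rewrite lerD2l ler_ln ?posrE // ?lt_min ?ltr0n ?Z0 //.
  by rewrite ge_min lexx orbT.
elim: N => [|N IH].
  by rewrite big_ord1 /= Z1 invr1 (min_idPl Z1) ln1 addr0.
rewrite big_ord_recr /=; case: ifP => hN; last first.
  rewrite addr0; apply: le_trans IH _; rewrite lerD2l ler_ln ?posrE ?lt_min ?ltr0n ?Z0 //.
  by rewrite le_min !ge_min lexx orbT ler_nat leqnSn.
have NZ : N.+1%:R <= Z by apply: le_trans hN; rewrite ler_nat.
rewrite (min_idPl NZ) in IH; rewrite (min_idPl hN).
suff h : ln N.+1%:R <= ln N.+2%:R - N.+2%:R^-1 :> R.
  by apply: le_trans (lerD IH (lexx _)) _; rewrite -addrA lerD2l -lerBrDr.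
have -> : N.+1%:R = N.+2%:R * (1 - N.+2%:R^-1) :> R.
  by rewrite mulrBr mulr1 divff ?pnatr_eq0 // -[in RHS]natr1 addrK.
have i1 : N.+2%:R^-1 < 1 :> R by rewrite invf_lt1 ?ltr0n // ltr1n.
rewrite lnM ?posrE ?ltr0n ?subr_gt0 // lerD2l.
by apply: le_ln1Dx; rewrite ltrN2.
Qed.

Lemma sum_powRN_le s Z N : 0 < s -> 1 <= Z ->
  \sum_(i < N) (if Z < i.+1%:R then i.+1%:R `^ (- s - 1) else 0) <= 2 `^ s / s * Z `^ (- s).
Proof.
move=> s0 Z1; have Z0 : 0 < Z by apply: lt_le_trans Z1.
have mono x y : 0 < x -> x <= y -> y `^ (- s) <= x `^ (- s).
  move=> x0 xy; have y0 : 0 < y by apply: lt_le_trans xy.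
  rewrite /powR (gt_eqF x0) (gt_eqF y0) ler_expR !mulNr lerN2 ler_pM2l //.
  by rewrite ler_ln.
have Z2 : 0 < Z / 2 by lra.
(* The telescoping starts at Z/2: a counted index i + 1 > Z >= 1 has i >= 1 and i > Z - 1, hence i
   >= Z/2. This costs the factor 2^s. *)
pose B x := s^-1 * ((Z / 2) `^ (- s) - (Num.max x (Z / 2)) `^ (- s)).
suff h : \sum_(i < N) (if Z < i.+1%:R then i.+1%:R `^ (- s - 1) else 0) <= B N%:R.
  apply: le_trans h _; rewrite /B.
  have -> : 2 `^ s / s * Z `^ (- s) = s^-1 * (Z / 2) `^ (- s).
    rewrite powRM ?(ltW Z0) // -(@powR_inv1 _ 2) // -powRrM mulN1r opprK; ring.
  rewrite ler_pM2l ?invr_gt0 // gerBl powR_ge0 //.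
elim: N => [|N IH].
  by rewrite big_ord0 /B (max_idPr (ltW Z2)) subrr mulr0.
rewrite big_ord_recr /=; case: ifP => hN; last first.
  rewrite addr0; apply: le_trans IH _; rewrite /B ler_pM2l ?invr_gt0 // lerD2l lerN2.
  apply: mono; first by rewrite lt_max Z2 orbT.
  by rewrite ge_max !le_max lexx orbT ler_nat leqnSn.
have N1 : 1 <= N%:R :> R by rewrite ler1n lt0n; apply: contraTneq hN => ->; rewrite -leNgt.
have NZ : Z / 2 <= N%:R by rewrite -natr1 in hN; lra.
have NZ' : Z / 2 <= N.+1%:R by apply: le_trans NZ _; rewrite ler_nat.
rewrite /B (max_idPl NZ) in IH; rewrite /B (max_idPl NZ').
have := @powRN_diff_ge N%:R s _ s0; rewrite ltr0n -(ler1n R) N1 natr1 => /(_ isT) h.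
have si : 0 <= s^-1 by rewrite invr_ge0 ltW.
have := ler_wpM2l si h; rewrite mulrA mulVf ?mul1r ?gt_eqF //; lra.
Qed.

Definition wt (Z1 Z2 : R) (b : nat) : R :=
  (b%:R * Num.sqrt b%:R)^-1 * Num.min (Num.min 1 (b%:R / Z1)) (Z2 / b%:R).

(** The shape of [char_majorant] without its constant; for a = 1 it is the trivial bound b. *)
Definition pmaj (a Y : R) (b : nat) : R :=
  b%:R `^ a * Num.max 1 (b%:R / Y) `^ (1 - a).

Lemma powR_N32 b : (0 < b)%N -> (b%:R * Num.sqrt b%:R)^-1 = b%:R `^ (- (3 / 2)) :> R.
Proof.
move=> b0; have bR : (0 : R) < b%:R by rewrite ltr0n.
rewrite powRN; congr (_^-1); rewrite -powR12_sqrt ?ltW // -{1}[b%:R]powRr1 ?ltW //.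
rewrite -powRD ?(gt_eqF bR) ?implybT //; congr (_ `^ _); lra.
Qed.

(** Up to Z2 <= Y the maximum in [pmaj] is 1. Beyond Z2 it is at most b/Z2, so [pmaj] is at most
    Z2^(a-1) b, and the factor Z2/b of the weight leaves Z2^a b^(-3/2). *)
Lemma pmaj_wt_le a Y Z1 Z2 b : 0 <= a -> a <= 1 -> 0 < Z1 -> 1 <= Z2 -> Z2 <= Y -> (0 < b)%N ->
  pmaj a Y b * wt Z1 Z2 b <=
   (if b%:R <= Z2 then b%:R `^ (a - 3 / 2) * Num.min 1 (b%:R / Z1) else 0) +
   Z2 `^ a * (if Z2 < b%:R then b%:R `^ (- 2^-1 - 1) else 0).
Proof.
move=> a0 a1 Z10 Z21 ZY b0; have bR : (0 : R) < b%:R by rewrite ltr0n.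
have Z20 : 0 < Z2 by apply: lt_le_trans Z21.
have Y0 : 0 < Y by apply: lt_le_trans ZY.
rewrite /pmaj /wt powR_N32 //.
have h32 : b%:R `^ a * b%:R `^ (- (3 / 2)) = b%:R `^ (a - 3 / 2).
  by rewrite -powRD // (gt_eqF bR) implybT.
have [bZ|Zb] := leP b%:R Z2.
  rewrite mulr0 addr0 (_ : Num.max 1 _ = 1) ?powR1 ?mulr1; last first.
    by apply/max_idPl; rewrite ler_pdivrMr // mul1r (le_trans bZ).
  by rewrite mulrA h32 ler_wpM2l ?powR_ge0 // ge_min lexx.
rewrite add0r.
apply: (@le_trans _ _ (b%:R `^ a * (b%:R / Z2) `^ (1 - a) * (b%:R `^ (- (3 / 2)) * (Z2 / b%:R)))).
  apply: ler_pM; rewrite ?mulr_ge0 ?powR_ge0 //.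
  - by rewrite le_min le_min ler01 !divr_ge0 ?(ltW Z10) ?(ltW Z20) ?(ltW bR).
  - rewrite ler_wpM2l ?powR_ge0 //; apply: ge0_ler_powR.
    + by rewrite subr_ge0.
    + by rewrite nnegrE le_max ler01.
    + by rewrite nnegrE divr_ge0 // ltW.
    + rewrite ge_max ler_pdivlMr // mul1r (ltW Zb) /= ler_pM2l // lef_pV2 ?posrE //.
  by rewrite ler_wpM2l ?powR_ge0 // ge_min lexx orbT.
rewrite powRM ?(ltW bR) ?invr_ge0 ?(ltW Z20) // -(powR_inv1 (ltW Z20)) -powRrM mulN1r opprB.
rewrite -(powR_inv1 (ltW bR)).
have -> : b%:R `^ a * (b%:R `^ (1 - a) * Z2 `^ (a - 1)) * (b%:R `^ (- (3 / 2)) * (Z2 * b%:R `^ (- 1))) =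
  (Z2 `^ (a - 1) * Z2 `^ 1) * (b%:R `^ a * b%:R `^ (1 - a) * b%:R `^ (- (3 / 2)) * b%:R `^ (- 1)).
  rewrite (powRr1 (ltW Z20)); ring.
rewrite -!powRD ?(gt_eqF bR) ?(gt_eqF Z20) ?implybT // subrK.
rewrite (_ : a + (1 - a) + - (3 / 2) + - 1 = - 2^-1 - 1) //; lra.
Qed.

Lemma pmaj_tail_le a Z N : 1 <= Z ->
  Z `^ a * \sum_(i < N) (if Z < i.+1%:R then i.+1%:R `^ (- 2^-1 - 1) else 0) <= 4 * Z `^ (a - 2^-1).
Proof.
move=> Z1; have Z0 : 0 < Z by apply: lt_le_trans Z1.
apply: (@le_trans _ _ (Z `^ a * (2 `^ 2^-1 / 2^-1 * Z `^ (- 2^-1)))).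
  by rewrite ler_wpM2l ?powR_ge0 // sum_powRN_le.
rewrite powRD; last by rewrite (gt_eqF Z0) implybT.
rewrite invrK.
have s2 : 2 `^ 2^-1 <= 2 :> R.
  by rewrite -[leRHS](@powRr1 _ 2) // ler_powR ?ler1n //; lra.
have AB : 0 <= Z `^ a * Z `^ (- 2^-1) by rewrite mulr_ge0 ?powR_ge0.
move: (2 `^ _) (Z `^ _) (Z `^ _) s2 AB => S A B s2 AB.
have := ler_wpM2r AB s2; lra.
Qed.

(** For a > 1/2 the sum of b^(a - 3/2) is governed by its upper end Z2, so the cutoff at Z1 may be
    dropped. *)
Lemma pmaj_sum_gt a Y Z1 Z2 N : 2^-1 < a -> a <= 1 -> 0 < Z1 -> 1 <= Z2 -> Z2 <= Y ->
  \sum_(i < N) pmaj a Y i.+1 * wt Z1 Z2 i.+1 <= (2 / (a - 2^-1) + 4) * Z2 `^ (a - 2^-1).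
Proof.
move=> a0 a1 Z10 Z21 ZY.
apply: (@le_trans _ _ (\sum_(i < N) (if i.+1%:R <= Z2 then i.+1%:R `^ (a - 2^-1 - 1) else 0) +
    Z2 `^ a * \sum_(i < N) (if Z2 < i.+1%:R then i.+1%:R `^ (- 2^-1 - 1) else 0))).
  rewrite mulr_sumr -big_split /=; apply: ler_sum => i _.
  apply: le_trans (pmaj_wt_le _ a1 Z10 Z21 ZY (ltn0Sn i)) _; first by lra.
  rewrite lerD2r; case: ifP => // _; rewrite (_ : a - 2^-1 - 1 = a - 3 / 2); last by lra.
  by rewrite ler_piMr ?powR_ge0 // ge_min lexx.
by rewrite mulrDl; apply: lerD; [apply: sum_powR_le; lra | exact: pmaj_tail_le].
Qed.

Lemma pmaj_sum_eq Y Z1 Z2 N : 0 < Z1 -> 1 <= Z2 -> Z2 <= Y ->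
  \sum_(i < N) pmaj 2^-1 Y i.+1 * wt Z1 Z2 i.+1 <= 5 + ln Z2.
Proof.
move=> Z10 Z21 ZY.
apply: (@le_trans _ _ (\sum_(i < N) (if i.+1%:R <= Z2 then i.+1%:R^-1 else 0) +
    Z2 `^ 2^-1 * \sum_(i < N) (if Z2 < i.+1%:R then i.+1%:R `^ (- 2^-1 - 1) else 0))).
  rewrite mulr_sumr -big_split /=; apply: ler_sum => i _.
  apply: le_trans (pmaj_wt_le _ _ Z10 Z21 ZY (ltn0Sn i)) _; [lra|lra|].
  rewrite lerD2r; case: ifP => // _; rewrite (_ : 2^-1 - 3 / 2 = - 1); last by lra.
  by rewrite powR_inv1 // ler_piMr // ge_min lexx.
have := sum_inv_le N Z21; have := pmaj_tail_le 2^-1 N Z21.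
rewrite subrr powRr0 => h1 h2; apply: le_trans (lerD h2 h1) _; lra.
Qed.

(** For a < 1/2 the lower end governs: the cutoff b/Z1 turns the exponent a - 3/2 into a - 1/2 below
    Z1, and each of the three ranges then contributes at most a multiple of Z1^(a - 1/2). *)
Lemma pmaj_sum_lt a Y Z1 Z2 N : 0 <= a -> a < 2^-1 -> 1 <= Z1 -> Z1 <= Z2 -> Z2 <= Y ->
  \sum_(i < N) pmaj a Y i.+1 * wt Z1 Z2 i.+1 <=
    (2 / (a + 2^-1) + 2 `^ (2^-1 - a) / (2^-1 - a) + 4) * Z1 `^ (a - 2^-1).
Proof.
move=> a0 a1 Z11 Z12 ZY.
have Z10 : 0 < Z1 by apply: lt_le_trans Z11.
have Z21 : 1 <= Z2 by apply: le_trans Z12.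
have Z20 : 0 < Z2 by apply: lt_le_trans Z21.
pose s := 2^-1 - a; have s0 : 0 < s by rewrite /s; lra.
apply: (@le_trans _ _ (Z1^-1 * \sum_(i < N) (if i.+1%:R <= Z1 then i.+1%:R `^ (a + 2^-1 - 1) else 0) +
   \sum_(i < N) (if Z1 < i.+1%:R then i.+1%:R `^ (- s - 1) else 0) +
    Z2 `^ a * \sum_(i < N) (if Z2 < i.+1%:R then i.+1%:R `^ (- 2^-1 - 1) else 0))).
  rewrite !mulr_sumr -!big_split /=; apply: ler_sum => i _.
  apply: le_trans (pmaj_wt_le _ _ Z10 Z21 ZY (ltn0Sn i)) _; [lra|lra|].
  rewrite lerD2r; set b := i.+1%:R; have b0 : 0 < b by rewrite ltr0n.
  have [bZ|Zb] := leP b Z1.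
    rewrite (le_trans bZ Z12) addr0 mulrC.
    apply: (@le_trans _ _ (b / Z1 * b `^ (a - 3 / 2))).
      by rewrite ler_wpM2r ?powR_ge0 // ge_min lexx orbT.
    rewrite -{1}(powRr1 (ltW b0)) mulrAC -powRD ?(gt_eqF b0) ?implybT // mulrC.
    by rewrite (_ : 1 + (a - 3 / 2) = a + 2^-1 - 1) //; lra.
  rewrite mulr0 add0r; case: ifP => _; last exact: powR_ge0.
  rewrite (_ : - s - 1 = a - 3 / 2); last by rewrite /s; lra.
  by rewrite ler_piMr ?powR_ge0 // ge_min lexx.
rewrite mulrDl mulrDl; apply: lerD; first apply: lerD.
- apply: (@le_trans _ _ (Z1^-1 * (2 / (a + 2^-1) * Z1 `^ (a + 2^-1)))).
    by rewrite ler_pM2l ?invr_gt0 //; apply: sum_powR_le; lra.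
  rewrite mulrCA -(powR_inv1 (ltW Z10)) -powRD ?(gt_eqF Z10) ?implybT //.
  by rewrite (_ : - 1 + (a + 2^-1) = a - 2^-1) //; lra.
- by rewrite -(opprB 2^-1 a); exact: sum_powRN_le.
apply: le_trans (pmaj_tail_le a N Z21) _; rewrite ler_pM2l // -(opprB 2^-1 a) -/s.
rewrite /powR (gt_eqF Z10) (gt_eqF Z20) ler_expR !mulNr lerN2 ler_pM2l //.
by rewrite ler_ln.
Qed.

End PowerSums.

Lemma abel_sum (A : comNzRingType) (x h : nat -> A) N :
  \sum_(i < N) x i * h i =
    \sum_(i < N) (\sum_(j < i.+1) x j) * (h i - h i.+1) + (\sum_(j < N) x j) * h N.
Proof.
elim: N => [|N IH]; first by rewrite !big_ord0 mul0r addr0.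
by rewrite !big_ord_recr /= IH; ring.
Qed.

Section GeometricDecay.
Variable R : realType.
Implicit Types (rho Y : R) (m N : nat).

(** N rho^N is at most 1 + rho + ... + rho^(N-1), which times 1 - rho is 1 - rho^N. *)
Lemma geo_decay1 rho N : 0 <= rho -> rho <= 1 -> N%:R * (1 - rho) * rho ^+ N <= 1.
Proof.
move=> r0 r1; have h : (1 - rho) * \sum_(i < N) rho ^+ i <= 1.
  by rewrite -opprB mulNr -subrX1 opprB gerBl exprn_ge0.
apply: le_trans h; rewrite mulrAC mulrC ler_wpM2l ?subr_ge0 //.
rewrite (_ : N%:R * _ = \sum_(i < N) rho ^+ N); last by rewrite sumr_const card_ord mulr_natl.
by apply: ler_sum => i _; apply: ler_wiXn2l => //; exact: ltnW.
Qed.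

(** Apply [geo_decay1] to s = sqrt rho and square: 1 - rho = (1 + s)(1 - s) with 1 + s <= 2. *)
Lemma geo_decay2 rho N : 0 <= rho -> rho <= 1 -> (N%:R * (1 - rho)) ^+ 2 * rho ^+ N <= 4.
Proof.
move=> r0 r1; pose s := Num.sqrt rho.
have s0 : 0 <= s by exact: sqrtr_ge0.
have es : rho = s ^+ 2 by rewrite sqr_sqrtr.
have s1 : s <= 1 by rewrite -(ler_pXn2r (ltn0Sn 1)) ?nnegrE // -es expr1n.
have h := geo_decay1 N s0 s1.
have h0 : 0 <= N%:R * (1 - s) * s ^+ N by rewrite !mulr_ge0 ?subr_ge0 ?exprn_ge0.
rewrite es -exprM mulnC exprM -exprMn.
have -> : N%:R * (1 - s ^+ 2) * s ^+ N = (1 + s) * (N%:R * (1 - s) * s ^+ N) by ring.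
move: (N%:R * (1 - s) * s ^+ N) h h0 => t t1 t0.
have : 0 <= (1 + s) * t by nra.
have : (1 + s) * t <= 2 by nra.
nra.
Qed.

Lemma geo_decay_eventually rho (eps : R) : 0 <= rho -> rho < 1 -> 0 < eps ->
  (* By [geo_decay2] and 2N + 1 <= 3N the left side is at most 12/(N (1 - rho)^2), which explains
     the 12 in K. *)
  exists N0, forall N, (N0 <= N)%N -> (2 * N%:R + 1) * rho ^+ N <= eps.
Proof.
move=> r0 r1 e0; pose K := 12 / (eps * (1 - rho) ^+ 2).
have d0 : 0 < 1 - rho by rewrite subr_gt0.
have K0 : 0 <= K by rewrite divr_ge0 // mulr_ge0 ?exprn_ge0 ?ltW.
exists (Num.truncn K).+1 => N hN.
have NK : K <= N%:R by apply: le_trans (_ : (Num.truncn K).+1%:R <= _); rewrite ?ler_nat // ltW // truncnS_gt.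
have N1 : 1 <= N%:R :> R by rewrite ler1n (leq_ltn_trans _ hN).
have h := geo_decay2 N r0 (ltW r1).
have X0 : 0 <= rho ^+ N by rewrite exprn_ge0.
rewrite /K ler_pdivrMr ?mulr_gt0 ?exprn_gt0 // in NK.
move: (rho ^+ N) h X0 => X h X0.
have hN2 : N%:R * X * (N%:R * (1 - rho) ^+ 2) <= 4 by move: h; rewrite exprMn; lra.
have N0 : 0 <= N%:R * X by rewrite mulr_ge0.
have h2 : N%:R * X * 12 <= N%:R * X * (N%:R * (eps * (1 - rho) ^+ 2)) by rewrite ler_wpM2l.
have h3 : N%:R * X * 12 <= 4 * eps by nra.
nra.
Qed.

Definition cdiff (r1 r2 : R) m : R := cb R m * (r2 ^+ m - r1 ^+ m).

(** Write A, B for the m-th powers of the two radii. The difference splits into the variation of cb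
    times B - A, and cb times B/Y2 - A/Y1. Each of B - A, m B/Y2, m A/Y1 is bounded by 1, by m/Y1
    and by Y2/m, up to factors 1, 4, 4 coming from geometric decay; their sum is 9. *)
Lemma cdiff_diff_le (Y1 Y2 : R) m : 1 <= Y1 -> Y1 <= Y2 -> (0 < m)%N ->
  `|cdiff (1 - Y1^-1) (1 - Y2^-1) m - cdiff (1 - Y1^-1) (1 - Y2^-1) m.+1| <= 9 * wt Y1 Y2 m.
Proof.
have m2 : (m <= 2 * m + 2)%N by lia.
move=> Y11 Y12 m0; have Y10 : 0 < Y1 by apply: lt_le_trans Y11.
have Y20 : 0 < Y2 by apply: lt_le_trans Y12.
have mR : (0 : R) < m%:R by rewrite ltr0n.
have i21 : Y2^-1 <= Y1^-1 by rewrite lef_pV2 ?posrE.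
have i10 : 0 < Y1^-1 by rewrite invr_gt0.
have i20 : 0 < Y2^-1 by rewrite invr_gt0.
have i11 : Y1^-1 <= 1 by rewrite invf_le1.
set r1 := 1 - Y1^-1; set r2 := 1 - Y2^-1.
have r10 : 0 <= r1 by rewrite subr_ge0.
have r12 : r1 <= r2 by rewrite lerD2l lerN2.
have r21 : r2 <= 1 by rewrite gerBl ltW.
have r20 : 0 <= r2 by apply: le_trans r12.
have r11 : r1 <= 1 by apply: le_trans r21.
pose A := r1 ^+ m; pose B := r2 ^+ m.
have A0 : 0 <= A by rewrite exprn_ge0.
have AB : A <= B by apply: lerXn2r; rewrite ?nnegrE.
have B1 : B <= 1 by rewrite exprn_ile1.
have mY12 : m%:R / Y2 <= m%:R / Y1 by rewrite ler_pM2l.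
have mY20 : 0 < m%:R / Y2 by rewrite divr_gt0.
have bern : 1 - A <= m%:R / Y1.
  have -> : 1 - A = (\sum_(i < m) r1 ^+ i) * Y1^-1.
    by rewrite /A -opprB subrX1 -mulNr mulrC; congr (_ * _); rewrite /r1; ring.
  rewrite ler_pM2r // (_ : m%:R = \sum_(i < m) 1); last by rewrite sumr_const card_ord.
  by apply: ler_sum => i _; rewrite exprn_ile1.
have e2 : 1 - r2 = Y2^-1 by rewrite /r2; ring.
have e1 : 1 - r1 = Y1^-1 by rewrite /r1; ring.
pose F2 := m%:R / Y2 * B; pose F3 := m%:R / Y1 * A.
have F2_1 : F2 <= 1 by have := geo_decay1 m r20 r21; rewrite e2.
have F3_1 : F3 <= 1 by have := geo_decay1 m r10 r11; rewrite e1.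
have F2_4 : m%:R / Y2 * F2 <= 4 by have := geo_decay2 m r20 r21; rewrite e2 expr2 -mulrA.
have F3_4 : m%:R / Y1 * F3 <= 4 by have := geo_decay2 m r10 r11; rewrite e1 expr2 -mulrA.
have mY10 : 0 < m%:R / Y1 by rewrite divr_gt0.
have inv2 : (Y2 / m%:R) * (m%:R / Y2) = 1 by field; rewrite !gt_eqF.
have inv20 : 0 < Y2 / m%:R by rewrite divr_gt0.
pose t := Num.min (Num.min 1 (m%:R / Y1)) (Y2 / m%:R).
have lt_t c z : 0 < c -> z <= c * 1 -> z <= c * (m%:R / Y1) -> z <= c * (Y2 / m%:R) -> z <= c * t.
  by move=> c0 h1 h2 h3; rewrite -ler_pdivrMl // /t !le_min !ler_pdivrMl // h1 h2 h3.
have B0 : 0 <= B by apply: le_trans AB.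
have F20 : 0 <= F2 by rewrite mulr_ge0 // ltW.
have F30 : 0 <= F3 by rewrite mulr_ge0 // ltW.
have F1t : B - A <= 1 * t.
  apply: lt_t => //; first by lra.
    by lra.
  have : (Y2 / m%:R) * F2 <= Y2 / m%:R by rewrite ler_piMr // ltW.
  by rewrite /F2 mulrA inv2; lra.
have up x c : 0 <= c -> m%:R / Y2 * x <= c -> x <= c * (Y2 / m%:R).
  move=> c0 h; have := ler_wpM2l (ltW inv20) h; rewrite mulrA inv2; lra.
have F2t : F2 <= 4 * t.
  apply: lt_t => //; [by lra| |exact: up].
  have : F2 <= m%:R / Y2 by rewrite /F2 ler_piMr // ltW.
  by lra.
have F3t : F3 <= 4 * t.
  apply: lt_t => //; first by lra.
    have : F3 <= m%:R / Y1 by rewrite /F3 ler_piMr ?(ltW mY10) // (le_trans AB).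
    by lra.
  apply: up => //; apply: le_trans F3_4; exact: ler_wpM2r.
have c0 := cb_gt0 R m; have c0' := cb_gt0 R m.+1; have cd := cb_decr R m.
have cle : cb R m <= (Num.sqrt m%:R)^-1.
  apply: le_trans (cb_le R m) _; rewrite lef_pV2 ?posrE ?sqrtr_gt0 ?ltr0n //.
  by rewrite ler_wsqrtr // ler_nat.
have cB : cb R m - cb R m.+1 <= cb R m / m%:R.
  by rewrite cbB ler_pM2l // lef_pV2 ?posrE ?ltr0n ?addn2 // ler_nat -addn2.
have -> : cdiff r1 r2 m - cdiff r1 r2 m.+1 =
   (cb R m - cb R m.+1) * (B - A) + cb R m.+1 * (F2 / m%:R - F3 / m%:R).
  have mn0 : m%:R != 0 :> R by rewrite (gt_eqF mR).
  have -> : F2 / m%:R = B * Y2^-1 by rewrite /F2; field; rewrite mn0 (gt_eqF Y20).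
  have -> : F3 / m%:R = A * Y1^-1 by rewrite /F3; field; rewrite mn0 (gt_eqF Y10).
  rewrite /cdiff !exprS -/A -/B /r1 /r2.
  ring.
have t0 : 0 <= t by rewrite !le_min ler01 !ltW.
have mi : 0 < m%:R^-1 :> R by rewrite invr_gt0.
apply: (@le_trans _ _ (cb R m / m%:R * (B - A + F2 + F3))).
  have h1 : (cb R m - cb R m.+1) * (B - A) <= cb R m / m%:R * (B - A) by rewrite ler_wpM2r // subr_ge0.
  have h1' : 0 <= (cb R m - cb R m.+1) * (B - A) by rewrite mulr_ge0 // subr_ge0.
  have h2 : cb R m.+1 * (F2 / m%:R) <= cb R m / m%:R * F2.
    by rewrite mulrA mulrAC ler_wpM2r // ler_pM2r.
  have h3 : cb R m.+1 * (F3 / m%:R) <= cb R m / m%:R * F3.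
    by rewrite mulrA mulrAC ler_wpM2r // ler_pM2r.
  have h2' : 0 <= cb R m.+1 * (F2 / m%:R) by rewrite !mulr_ge0 // ltW.
  have h3' : 0 <= cb R m.+1 * (F3 / m%:R) by rewrite !mulr_ge0 // ltW.
  by rewrite ler_norml; apply/andP; split; lra.
apply: (@le_trans _ _ (cb R m / m%:R * (9 * t))).
  apply: ler_wpM2l; first by rewrite divr_ge0 ?(ltW c0) ?(ltW mR).
  by lra.
rewrite mulrCA ler_pM2l // /wt -/t ler_wpM2r // invfM mulrC ler_pM2l //.
Qed.
End GeometricDecay.

(** * The smoothed L-series *)

Section SmoothSums.
Variables (R : realType) (p : prime_nat) (n : nat) (chi : int -> R[i]).
Hypothesis hprim : primitive_character (p ^ n)%N chi.
Hypothesis n1 : (1 < n)%N.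
Local Notation e := (@e_real R).
Local Notation C := R[i].
Local Notation normc := (@Normc.normc R).
Local Notation pe n := (ppow p n).
Local Notation q := (p ^ n)%N.

Let hchi : dirichlet_character q chi. Proof. by case: hprim. Qed.
Let n0 : (0 < n)%N. Proof. exact: ltnW. Qed.
Let q0 : (0 < q)%N. Proof. by rewrite expn_gt0 prime_gt0 // prime_valP. Qed.
Let qR : (0 : R) < q%:R. Proof. by rewrite ltr0n. Qed.
Let tau := gauss_sum p n chi.

(* Equal to sum_m chi(m) C(2m, m) 4^(-m) rho^m for rho < 1, see [partial_sum_cvg]; the
   finite form makes it accessible to summation by parts over b. *)
Definition smooth_sum (rho : R) : C :=
  tau^-1 * \sum_(b < q) conjc (chi b%:Z) * sigma (rho%:C * e (b%:R / q%:R)).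

Lemma tau_neq0 : tau != 0.
Proof.
apply/eqP => t0; have := normc_gauss hprim n1; rewrite -/tau t0 Normc.normc0 => /esym/eqP.
by rewrite sqrtr_eq0 leNgt qR.
Qed.

Lemma normc_rho (rho : R) (z : C) : 0 <= rho -> normc z = 1 -> normc (rho%:C * z) = rho.
Proof. by move=> r0 z1; rewrite Normc.normcM z1 mulr1 normc_real ger0_norm. Qed.

Lemma normc_1Brho (rho : R) (z : C) : 0 <= rho -> normc z = 1 -> 1 - rho <= normc (1 - rho%:C * z).
Proof.
move=> r0 z1; have := normcD (1 - rho%:C * z) (rho%:C * z).
by rewrite subrK Normc.normc1 normc_rho //; lra.
Qed.

Lemma rho_neq1 (rho : R) (z : C) : 0 <= rho -> rho < 1 -> normc z = 1 -> rho%:C * z != 1.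
Proof.
move=> r0 r1 z1; apply/eqP => h; have := normc_rho r0 z1; rewrite h Normc.normc1 => h2.
by move: r1; rewrite -h2 ltxx.
Qed.

Lemma partial_sum_cvg (rho eps : R) : 0 <= rho -> rho < 1 -> 0 < eps ->
  exists N0, forall N, (N0 <= N)%N ->
    normc (\sum_(m < N) chi m%:Z * (cb R m * rho ^+ m)%:C - smooth_sum rho) <= eps.
Proof.
move=> r0 r1 e0; have sq0 : 0 < Num.sqrt q%:R :> R by rewrite sqrtr_gt0.
have d0 : 0 < 1 - rho by rewrite subr_gt0.
(* Each of the q points contributes at most 2 eps'/(1 - rho), and dividing by |tau| = sqrt q gives
   eps. *)
pose eps' := eps * Num.sqrt q%:R * (1 - rho) / (2 * q%:R).
have e'0 : 0 < eps' by rewrite divr_gt0 ?mulr_gt0.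
have [N0 hN0] := geo_decay_eventually r0 r1 e'0.
exists N0 => N /hN0 hN.
pose z (b : nat) := e (b%:R / q%:R).
have z1 b : normc (z b) = 1 by exact: normc_e_real.
have -> : \sum_(m < N) chi m%:Z * (cb R m * rho ^+ m)%:C =
    tau^-1 * \sum_(b < q) conjc (chi b%:Z) * cbpoly N (rho%:C * z b).
  apply: (mulfI tau_neq0); rewrite mulVKf ?tau_neq0 // mulr_sumr.
  transitivity (\sum_(m < N) \sum_(b < q) conjc (chi b%:Z) * ((cb R m)%:C * (rho%:C * z b) ^+ m)).
    apply: eq_bigr => m _; rewrite mulrA (mulrC tau) -gauss_twist // mulr_suml.
    apply: eq_bigr => b _; rewrite -mulrA.
    have -> : e ((m * b)%:R / q%:R) = z b ^+ m by rewrite /z -e_realX natrM mulrA.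
    have -> // : z b ^+ m * (cb R m * rho ^+ m)%:C = (cb R m)%:C * (rho%:C * z b) ^+ m.
    by move: (z b) => w; rewrite exprMn rmorphM rmorphXn mulrC -mulrA.
  by rewrite exchange_big; apply: eq_bigr => b _; rewrite /cbpoly mulr_sumr.
rewrite /smooth_sum -mulrBr -sumrB Normc.normcM Normc.normcV normc_gauss //.
rewrite ler_pdivrMl //.
apply: le_trans (normc_sum _ _ _) _.
apply: (@le_trans _ _ (\sum_(b < q) (2 * eps' / (1 - rho)))).
  apply: ler_sum => b _; rewrite -mulrBr Normc.normcM.
  have nc : normc (conjc (chi b%:Z)) <= 1 by rewrite normc_conj; exact: normc_chi_le1 hchi n0 _.
  apply: le_trans (ler_piMl (normc_ge0 _) nc) _.
  set w := rho%:C * z b.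
  have nw : normc w = rho by exact: normc_rho.
  have w1 : normc w <= 1 by rewrite nw ltW.
  have wn : w != 1 by exact: rho_neq1.
  have := cbpoly_cvg N w1 wn; rewrite nw => h.
  (* |alpha w|^2 = |1 - w| is at least 1 - rho, hence at least (1 - rho)^2. *)
  have na : 1 - rho <= normc (alpha w).
    have a2 := normc_alpha w; have h1 := normc_1Brho r0 (z1 b); rewrite -/w -a2 in h1.
    have a0 := normc_ge0 (alpha w).
    rewrite leNgt; apply/negP => hlt; nra.
  rewrite ler_pdivlMr //.
  apply: le_trans (ler_wpM2l (normc_ge0 _) na) _; apply: le_trans h _.
  by rewrite -mulrA ler_pM2l.
rewrite sumr_const card_ord -[leLHS]mulr_natl /eps'.
rewrite le_eqVlt; apply/orP; left; apply/eqP; field.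
by rewrite !gt_eqF.
Qed.

(** Abel summation in m on a truncation at N, with the variation of [cdiff] bounded by 9 [wt]. The
    two truncation errors and the boundary term, at most N r2^N, take eps/3 each. *)
Lemma smooth_sum_direct (g : nat -> R) (Y1 Y2 B : R) :
    (forall x, normc (\sum_(i < x) chi i.+1%:Z) <= g x) -> 1 <= Y1 -> Y1 <= Y2 ->
    (forall N, \sum_(i < N) g i.+1 * wt Y1 Y2 i.+1 <= B) ->
  normc (smooth_sum (1 - Y2^-1) - smooth_sum (1 - Y1^-1)) <= 9 * B.
Proof.
move=> hg Y11 Y12 hB; have Y10 : 0 < Y1 by apply: lt_le_trans Y11.
have Y20 : 0 < Y2 by apply: lt_le_trans Y12.
have i21 : Y2^-1 <= Y1^-1 by rewrite lef_pV2 ?posrE.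
have i10 : 0 < Y1^-1 by rewrite invr_gt0.
have i20 : 0 < Y2^-1 by rewrite invr_gt0.
have i11 : Y1^-1 <= 1 by rewrite invf_le1.
set r1 := 1 - Y1^-1; set r2 := 1 - Y2^-1.
have r10 : 0 <= r1 by rewrite subr_ge0.
have r12 : r1 <= r2 by rewrite lerD2l lerN2.
have r21 : r2 < 1 by rewrite gtrBl.
have r20 : 0 <= r2 by apply: le_trans r12.
have r11 : r1 < 1 by apply: le_lt_trans r21.
apply/ler_addgt0Pr => eps eps0; have e3 : 0 < eps / 3 by rewrite divr_gt0.
have [Na hNa] := partial_sum_cvg r10 r11 e3.
have [Nb hNb] := partial_sum_cvg r20 r21 e3.
have [Nc hNc] := geo_decay_eventually r20 r21 e3.
pose N := (maxn Na (maxn Nb Nc)).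
have := hNa N.+1 (leqW (leq_maxl _ _)); have := hNb N.+1 (leqW (leq_trans (leq_maxl _ _) (leq_maxr _ _))).
have := hNc N (leq_trans (leq_maxr _ _) (leq_maxr _ _)).
set Sb := \sum_(m < N.+1) _; set Sa := \sum_(m < N.+1) _ => hc hb ha.
have eD : Sb - Sa = \sum_(i < N) chi i.+1%:Z * (cdiff r1 r2 i.+1)%:C.
  rewrite /Sa /Sb -sumrB big_ord_recl (chi_eq0 hchi n0) ?mul0r ?subrr ?add0r; last first.
    by rewrite coprimezE /= /coprime gcd0n gtn_eqF // prime_gt1 // prime_valP.
  by apply: eq_bigr => i _; rewrite -mulrBr -rmorphB /cdiff mulrBr.
have hD : normc (Sb - Sa) <= 9 * B + eps / 3.
  rewrite eD (abel_sum (fun i => chi i.+1%:Z) (fun i => (cdiff r1 r2 i.+1)%:C)).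
  apply: le_trans (normcD _ _) _; apply: lerD.
    apply: le_trans (normc_sum _ _ _) _.
    apply: (@le_trans _ _ (9 * \sum_(i < N) g i.+1 * wt Y1 Y2 i.+1)); last by rewrite ler_pM2l.
    rewrite mulr_sumr; apply: ler_sum => i _.
    rewrite Normc.normcM -rmorphB normc_real mulrCA.
    by apply: ler_pM; rewrite ?normc_ge0 //; exact: cdiff_diff_le.
  rewrite Normc.normcM normc_real.
  have s1 : normc (\sum_(j < N) chi j.+1%:Z) <= N%:R.
    apply: le_trans (normc_sum _ _ _) _.
    rewrite (_ : N%:R = \sum_(i < N) 1); last by rewrite sumr_const card_ord.
    by apply: ler_sum => i _; exact: normc_chi_le1 hchi n0 _.
  apply: le_trans hc; apply: ler_pM; rewrite ?normc_ge0 //.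
    by apply: le_trans s1 _; have : (0 : R) <= N%:R by []; lra.
  rewrite /cdiff normrM gtr0_norm ?cb_gt0 // ger0_norm; last first.
    by rewrite subr_ge0; apply: lerXn2r; rewrite ?nnegrE.
  have cb1 : cb R N.+1 <= 1.
    apply: le_trans (cb_le R _) _; rewrite invf_le1 ?sqrtr_gt0 ?ltr0n //.
    by rewrite -[leLHS]sqrtr1 ler_wsqrtr // ler1n.
  have r2N : r2 ^+ N.+1 <= r2 ^+ N by apply: ler_wiXn2l => //; exact: ltW.
  have r1N : 0 <= r1 ^+ N.+1 by rewrite exprn_ge0.
  have c0 := cb_gt0 R N.+1.
  apply: (@le_trans _ _ (1 * (r2 ^+ N.+1 - r1 ^+ N.+1))).
    by apply: ler_wpM2r => //; rewrite subr_ge0; apply: lerXn2r; rewrite ?nnegrE.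
  by lra.
have -> : smooth_sum r2 - smooth_sum r1 = (Sb - Sa) + ((Sa - smooth_sum r1) - (Sb - smooth_sum r2)).
  by ring.
apply: le_trans (normcD _ _) _.
have := normcB (Sa - smooth_sum r1) (Sb - smooth_sum r2); lra.
Qed.

Lemma sigma_le (w : C) (M : R) : 0 < M -> M^-1 <= normc (1 - w) -> normc (sigma w) <= Num.sqrt M.
Proof.
move=> M0 h; have nw : 0 < normc (1 - w) by apply: lt_le_trans h; rewrite invr_gt0.
rewrite -(ler_pXn2r (ltn0Sn 1)) ?nnegrE ?normc_ge0 ?sqrtr_ge0 // sqr_sqrtr ?(ltW M0) //.
rewrite /sigma Normc.normcV exprVn normc_alpha -[leRHS]invrK lef_pV2 ?posrE ?invr_gt0 //.
Qed.

Lemma normc_1Be_q (b d : nat) : (d <= b)%N -> (b + d <= q)%N ->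
  2 * (d%:R / q%:R) <= normc (1 - e (b%:R / q%:R)).
Proof.
move=> db bq; have [bh|bh] := leP (b%:R / q%:R : R) 2^-1.
  apply: le_trans (normc_1Be_ge _ bh); last by rewrite divr_ge0.
  by rewrite ler_pM2l // ler_pM2r ?invr_gt0 // ler_nat.
have bq' : (b <= q)%N by apply: leq_trans bq; exact: leq_addr.
have eb : e (b%:R / q%:R) = conjc (e ((q - b)%:R / q%:R)).
  rewrite -e_realN -[RHS]mul1r -(e_real_nat R 1) -e_realD; congr e.
  by rewrite natrB // mulrBl divff ?gt_eqF // opprB addrC subrK.
have -> : normc (1 - e (b%:R / q%:R)) = normc (1 - e ((q - b)%:R / q%:R)).
  rewrite eb; case: (e _) => a' b' /=; congr Num.sqrt; ring.
apply: le_trans (normc_1Be_ge _ _).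
- by rewrite ler_pM2l // ler_pM2r ?invr_gt0 // ler_nat leq_subRL // addnC.
- by rewrite divr_ge0.
by rewrite natrB // mulrBl divff ?gt_eqF //; lra.
Qed.

(** Let X = q/d. Both points are at distance at least d/q from 1, so sigma <= sqrt X, and also sigma
    <= sqrt Y2. Relative to X^(3/2)/q, the three arguments of the minimum come from
    [kern_diff_crude] with X (factor 1), the same with min(Y2, X) (factor Y2/X), and [kern_diff]
    with r2 - r1 <= 1/Y1 (factor X/Y1). Here 10 pi is 5 times the chord bound 2 pi. *)
Lemma kern_step_le (Y1 Y2 : R) (b d : nat) : 1 <= Y1 -> Y1 <= Y2 ->
    (0 < d)%N -> (d <= b)%N -> (b.+1 + d <= q)%N ->
  normc (kern (1 - Y1^-1) (1 - Y2^-1) (e (b%:R / q%:R)) - kern (1 - Y1^-1) (1 - Y2^-1) (e (b.+1%:R / q%:R)))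
    <= 10 * pi * Num.sqrt q%:R * wt (q%:R / Y2) (q%:R / Y1) d.
Proof.
move=> Y11 Y12 d0 db bq; have Y10 : 0 < Y1 by apply: lt_le_trans Y11.
have Y20 : 0 < Y2 by apply: lt_le_trans Y12.
have i21 : Y2^-1 <= Y1^-1 by rewrite lef_pV2 ?posrE.
have i10 : 0 < Y1^-1 by rewrite invr_gt0.
have i20 : 0 < Y2^-1 by rewrite invr_gt0.
have i11 : Y1^-1 <= 1 by rewrite invf_le1.
have dR : (0 : R) < d%:R by rewrite ltr0n.
have hz := @normc_1Be_q b d db (leq_trans (leqnSn _) bq).
have hz' := @normc_1Be_q b.+1 d (leqW db) bq.
have ez : normc (e (b%:R / q%:R) - e (b.+1%:R / q%:R)) <= 2 * pi / q%:R.
  have -> : e (b%:R / q%:R) - e (b.+1%:R / q%:R) = e (b%:R / q%:R) * (1 - e (q%:R^-1)).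
    by rewrite mulrBr mulr1 -e_realD -natr1 mulrDl mul1r.
  rewrite Normc.normcM normc_e_real mul1r; apply: normc_1Be_le.
  by rewrite invr_ge0.
have z1 := normc_e_real (b%:R / q%:R : R).
have z1' := normc_e_real (b.+1%:R / q%:R : R).
have dq : (d%:R : R) <= q%:R.
  by rewrite ler_nat; apply: leq_trans bq; exact: leq_addl.
move: (e (b%:R / q%:R)) (e (b.+1%:R / q%:R)) hz hz' ez z1 z1' => z z' hz hz' ez z1 z1'.
set r1 := 1 - Y1^-1; set r2 := 1 - Y2^-1.
have r10 : 0 <= r1 by rewrite subr_ge0.
have r12 : r1 <= r2 by rewrite lerD2l lerN2.
have r21 : r2 < 1 by rewrite gtrBl.
have r20 : 0 <= r2 by apply: le_trans r12.
have qR' : 0 < q%:R :> R by [].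
move: (q%:R : R) qR' dq hz hz' ez => Q Q0 dq hz hz' ez.
pose X := Q / d%:R; have X0 : 0 < X by rewrite divr_gt0.
have X1 : 1 <= X by rewrite ler_pdivlMr // mul1r.
have Xi : X^-1 = d%:R / Q by rewrite invf_div.
(* Since |1 - y| <= |1 - r y| + (1 - r) <= 2 |1 - r y|, the factor 2 of [normc_1Be_q] is used up
   here. *)
have low (r : R) (y : C) : 0 <= r -> r <= r2 -> normc y = 1 -> 2 * (d%:R / Q) <= normc (1 - y) ->
    X^-1 <= normc (1 - r%:C * y) /\ Y2^-1 <= normc (1 - r%:C * y).
  move=> r0 rr y1 hy; have h1 := normc_1Brho r0 y1.
  have h2 : Y2^-1 <= 1 - r by move: rr; rewrite /r2; lra.
  split; last by apply: le_trans h1.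
  have h3 : normc (1 - y) <= normc (1 - r%:C * y) + normc (r%:C * y - y).
    by apply: le_trans (normcD _ _); rewrite addrA subrK.
  have h4 : normc (r%:C * y - y) <= 1 - r.
    rewrite -{2}[y]mul1r -(rmorph1 (real_complex R)) -mulrBl -rmorphB Normc.normcM y1 mulr1.
    by rewrite normc_real distrC ger0_norm // subr_ge0 (le_trans rr) // ltW.
  by rewrite Xi; lra.
have sX (r : R) (y : C) : 0 <= r -> r <= r2 -> normc y = 1 -> 2 * (d%:R / Q) <= normc (1 - y) ->
    normc (sigma (r%:C * y)) <= Num.sqrt X.
  by move=> r0 rr y1 hy; apply: sigma_le => //; have [] := low r y r0 rr y1 hy.
pose M := Num.min Y2 X.
have M0 : 0 < M by rewrite lt_min Y20 X0.
have sM (r : R) (y : C) : 0 <= r -> r <= r2 -> normc y = 1 -> 2 * (d%:R / Q) <= normc (1 - y) ->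
    normc (sigma (r%:C * y)) <= Num.sqrt M.
  move=> r0 rr y1 hy; have [l1 l2] := low r y r0 rr y1 hy.
  by apply: sigma_le => //; rewrite /M; case: (leP Y2 X).
have hA := kern_diff_crude r10 r12 r21 z1 z1' (sX r1 z r10 r12 z1 hz) (sX r2 z r20 (lexx _) z1 hz)
  (sX r1 z' r10 r12 z1' hz') (sX r2 z' r20 (lexx _) z1' hz').
have hB := kern_diff_crude r10 r12 r21 z1 z1' (sM r1 z r10 r12 z1 hz) (sM r2 z r20 (lexx _) z1 hz)
  (sM r1 z' r10 r12 z1' hz') (sM r2 z' r20 (lexx _) z1' hz').
have hC := kern_diff r10 r12 r21 z1 z1' (sX r1 z r10 r12 z1 hz) (sX r2 z r20 (lexx _) z1 hz)
  (sX r1 z' r10 r12 z1' hz') (sX r2 z' r20 (lexx _) z1' hz').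
have r2B : r2 - r1 <= Y1^-1 by rewrite /r2 /r1; lra.
have r2B0 : 0 <= r2 - r1 by rewrite subr_ge0.
move: (normc (kern _ _ z - _)) hA hB hC => K hA hB hC.
move: (normc (z - z')) (normc_ge0 (z - z')) ez hA hB hC => ep ep0 ez hA hB hC.
pose S := Num.sqrt X; have S0 : 0 <= S by exact: sqrtr_ge0.
have eS : S ^+ 2 = X by rewrite sqr_sqrtr // ltW.
pose T := Num.sqrt M; have T0 : 0 <= T by exact: sqrtr_ge0.
have eT : T ^+ 2 = M by rewrite sqr_sqrtr // ltW.
have TS : T <= S by rewrite ler_wsqrtr // ge_min lexx orbT.
have MY : M <= Y2 by rewrite ge_min lexx.
have eW : Num.sqrt Q * (d%:R * Num.sqrt d%:R)^-1 = X * S / Q.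
  rewrite /X /S /X sqrtrM ?(ltW Q0) // sqrtrV ?(ltW dR) // invfM.
  have sd : 0 < Num.sqrt d%:R :> R by rewrite sqrtr_gt0.
  by field; rewrite (gt_eqF Q0) (gt_eqF dR) (gt_eqF sd).
rewrite /wt mulrA -(mulrA (10 * pi)) eW.
have -> : d%:R / (Q / Y2) = Y2 / X by rewrite /X; field; rewrite (gt_eqF Q0) (gt_eqF dR) (gt_eqF Y20).
have -> : Q / Y1 / d%:R = X / Y1 by rewrite /X; field; rewrite (gt_eqF dR) (gt_eqF Y10).
rewrite (_ : 10 * pi * (X * S / Q) = 5 * (2 * pi / Q) * (X * S)); last by ring.
have pq : 0 <= 2 * pi / Q by rewrite divr_ge0 ?mulr_ge0 ?pi_ge0 ?(ltW Q0).
move: (2 * pi / Q) pq ez => Pq pq ez.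
have XS0 : 0 <= X * S by rewrite mulr_ge0 // ltW.
have goal t : 0 <= t -> K <= 5 * ep * (X * S) * t -> K <= 5 * Pq * (X * S) * t.
  move=> t0 h; apply: le_trans h _; apply: ler_wpM2r => //; apply: ler_wpM2r => //.
  by rewrite ler_pM2l.
have eps5 : 0 <= ep * (X * S) by rewrite mulr_ge0.
have S3 : S ^+ 3 = X * S by rewrite -eS; ring.
have S5 : S ^+ 5 = X * X * S by rewrite -eS; ring.
have T3 : T ^+ 3 = M * T by rewrite -eT; ring.
rewrite -/S S3 in hA; rewrite -/T T3 in hB; rewrite -/S S3 S5 in hC.
have minE c : (c = 1 \/ c = Y2 / X \/ c = X / Y1) -> K <= 5 * Pq * (X * S) * c.
  case=> [->|[->|->]].
  - by apply: goal => //; lra.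
  - apply: goal; first by rewrite divr_ge0 ?ltW.
    have -> : 5 * ep * (X * S) * (Y2 / X) = 5 * ep * (Y2 * S) by field; rewrite gt_eqF.
    have : M * T <= Y2 * S by apply: ler_pM; rewrite ?(ltW M0).
    have := mulr_ge0 ep0 (mulr_ge0 (ltW Y20) S0).
    by move=> h1 h2; have := ler_wpM2l ep0 h2; lra.
  apply: goal; first by rewrite divr_ge0 ?ltW.
  apply: le_trans hC _.
  have h5 : X * S + 4 * (X * X * S) <= 5 * (X * X * S).
    have := ler_wpM2r XS0 X1; lra.
  apply: (@le_trans _ _ (Y1^-1 * ep * (5 * (X * X * S)))); last by rewrite le_eqVlt; apply/orP; left; apply/eqP; ring.
  apply: ler_pM => //; first by rewrite mulr_ge0.
    by rewrite addr_ge0 // mulr_ge0 // mulr_ge0 // mulr_ge0 // ltW.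
  by apply: ler_wpM2r.
have mc (u v : R) : Num.min u v = u \/ Num.min u v = v by case: (leP u v); [left|right].
case: (mc (Num.min 1 (Y2 / X)) (X / Y1)) => ->; last by apply: minE; right; right.
by case: (mc 1 (Y2 / X)) => ->; apply: minE; [left|right; left].
Qed.

(* Summation by parts over the whole cycle b < q; partial sums at b and q - 1 - b have
   equal norms, so the distance of b / q to the nearest integer governs the kernel. *)
Lemma smooth_sum_dual (g : nat -> R) (Y1 Y2 B : R) :
    (forall x, normc (\sum_(i < x) chi i.+1%:Z) <= g x) -> 1 <= Y1 -> Y1 <= Y2 ->
    (forall N, \sum_(i < N) g i.+1 * wt (q%:R / Y2) (q%:R / Y1) i.+1 <= B) ->
  normc (smooth_sum (1 - Y2^-1) - smooth_sum (1 - Y1^-1)) <= 20 * pi * B.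
Proof.
move=> hg Y11 Y12 hB; have Y10 : 0 < Y1 by apply: lt_le_trans Y11.
have Y20 : 0 < Y2 by apply: lt_le_trans Y12.
pose k (b : nat) := kern (1 - Y1^-1) (1 - Y2^-1) (e (b%:R / q%:R)).
pose x (b : nat) := conjc (chi b%:Z).
have sq0 : 0 < Num.sqrt q%:R :> R by rewrite sqrtr_gt0.
have x0 : x 0%N = 0.
  rewrite /x (chi_eq0 hchi n0) ?conjc0 //.
  by rewrite coprimezE /= /coprime gcd0n gtn_eqF // prime_gt1 // prime_valP.
have xtot : \sum_(b < q) x b = 0.
  have := gauss_twist hprim n1 0; rewrite (chi_eq0 hchi n0) ?mul0r => [h|]; last first.
    by rewrite coprimezE /= /coprime gcd0n gtn_eqF // prime_gt1 // prime_valP.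
  by apply: etrans (etrans h (mul0r _)); apply: eq_bigr => b _; rewrite mul0n mul0r e_real0 mulr1.
have D1 (i : nat) : normc (\sum_(j < i.+1) x j) <= g i.
  rewrite big_ord_recl x0 add0r -conjc_sum normc_conj; apply: le_trans (hg i).
  by rewrite le_eqVlt eqxx.
have [q2 eq2] : exists q2, q = q2.+2.
  have q1 : (1 < q)%N by rewrite -(expn0 p) ltn_exp2l ?prime_gt1 ?prime_valP.
  by exists (q - 2)%N; rewrite -addn2 subnK.
(* The full sum vanishes, so the partial sum is minus the tail of length q - (i + 2) = q2 - i. Read
   backwards, by chi(-b) = chi(-1) chi(b), the tail is again an initial sum. *)
have D2 (i : nat) : (i <= q2)%N -> normc (\sum_(j < i.+2) x j) <= g (q2 - i)%N.
  move=> iq; have qE : q = (i.+2 + (q2 - i))%N by rewrite eq2 !addSn subnKC.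
  have hs : \sum_(j < i.+2) x j = - \sum_(j < q2 - i) x (i.+2 + j)%N.
    apply/eqP; rewrite -subr_eq0 opprK; apply/eqP; rewrite -[RHS]xtot qE big_split_ord /=.
    by [].
  rewrite hs normcN (reindex_inj rev_ord_inj) /=.
  have -> : \sum_(j < q2 - i) x (i.+2 + (q2 - i - j.+1))%N =
      conjc (chi (-1) * \sum_(j < q2 - i) chi j.+1%:Z).
    rewrite mulr_sumr conjc_sum; apply: eq_bigr => j _; rewrite /x; congr conjc.
    rewrite -(chiM hchi); apply: (chi_modz hchi); apply/modz_eqP; exists 1.
    have : (i.+2 + (q2 - i - j.+1) = q - j.+1)%N.
      have := ltn_ord j; rewrite {}qE; lia.
    move=> ->; have : (j.+1 <= q)%N by have := ltn_ord j; rewrite {}qE; lia.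
    by rewrite mul1r mulN1r /ppow => hj; rewrite -subzn // addrC.
  rewrite normc_conj Normc.normcM; apply: le_trans (hg _).
  by rewrite ler_piMl ?normc_ge0 //; exact: normc_chi_le1 hchi n0 _.
have -> : smooth_sum (1 - Y2^-1) - smooth_sum (1 - Y1^-1) = tau^-1 * \sum_(b < q) x b * k b.
  rewrite /smooth_sum -mulrBr -sumrB; congr (_ * _); apply: eq_bigr => b _.
  by rewrite -mulrBr.
rewrite Normc.normcM Normc.normcV normc_gauss // ler_pdivrMl //.
rewrite (abel_sum x k) xtot mul0r addr0.
pose G (d : nat) := g d * wt (q%:R / Y2) (q%:R / Y1) d.
have g0 d : 0 <= g d by apply: le_trans (hg d); exact: normc_ge0.
have wt0 d : 0 <= wt (q%:R / Y2) (q%:R / Y1) d.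
  rewrite /wt mulr_ge0 ?invr_ge0 ?mulr_ge0 ?sqrtr_ge0 // !le_min ler01 /=.
  by rewrite !divr_ge0 ?(ltW Y10) ?(ltW Y20).
(* The nearer end of the cycle supplies d = i + 1 or d = q2 - i. Adding both values of G avoids
   splitting the sum over i and doubles 10 pi to 20 pi. *)
have hterm (i : nat) : (i < q2)%N -> normc ((\sum_(j < i.+2) x j) * (k i.+1 - k i.+2)) <=
    10 * pi * Num.sqrt q%:R * (G i.+1 + G (q2 - i)%N).
  move=> iq; rewrite Normc.normcM.
  have c0 : 0 <= 10 * pi * Num.sqrt q%:R :> R by rewrite !mulr_ge0 ?pi_ge0 ?ltW.
  have G0 d : 0 <= G d by rewrite mulr_ge0.
  have use d : (0 < d)%N -> (d <= i.+1)%N -> (i.+2 + d <= q)%N -> normc (\sum_(j < i.+2) x j) <= g d ->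
     normc (\sum_(j < i.+2) x j) * normc (k i.+1 - k i.+2) <= 10 * pi * Num.sqrt q%:R * G d.
    move=> d0 di dq hd; rewrite /G mulrCA; apply: ler_pM; rewrite ?normc_ge0 //.
    exact: kern_step_le.
  have [h|h] := leqP i.+1 (q2 - i).
    apply: le_trans (use i.+1 isT (leqnn _) _ (D1 _)) _; first by rewrite eq2; lia.
    by apply: ler_wpM2l => //; rewrite lerDl.
  apply: le_trans (use (q2 - i)%N _ _ _ (D2 i (ltnW iq))) _; [lia|lia|by rewrite eq2; lia|].
  by apply: ler_wpM2l => //; rewrite lerDr.
move: eq2 xtot => eq2 xtot.
have -> : \sum_(i < q) (\sum_(j < i.+1) x j) * (k i - k i.+1) =
    \sum_(i < q2) (\sum_(j < i.+2) x j) * (k i.+1 - k i.+2).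
  rewrite [in LHS]eq2 big_ord_recl big_ord1 x0 mul0r add0r big_ord_recr /=.
  have eN : \sum_(j < q2.+2) x j = 0 by rewrite -[RHS]xtot eq2.
  by rewrite -[(bump 0 q2).+1]/q2.+2 eN mul0r addr0.
apply: le_trans (normc_sum _ _ _) _.
apply: (@le_trans _ _ (\sum_(i < q2) 10 * pi * Num.sqrt q%:R * (G i.+1 + G (q2 - i)%N))).
  by apply: ler_sum => i _; apply: hterm.
rewrite -mulr_sumr big_split /=.
have -> : \sum_(i < q2) G (q2 - i)%N = \sum_(i < q2) G i.+1.
  rewrite (reindex_inj rev_ord_inj); apply: eq_bigr => i _ /=.
  by rewrite subKn.
have := hB q2; rewrite -/(G _) => h.
have c0 : 0 <= 10 * pi * Num.sqrt q%:R :> R by rewrite !mulr_ge0 ?pi_ge0 ?ltW.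
have := ler_wpM2l c0 h; lra.
Qed.
End SmoothSums.

(** * Convergence of the L-series *)

Section DirichletTest.
Variable R : realType.
Local Notation normc := (@Normc.normc R).

Variables (w : nat -> R) (B : R).
Hypotheses (w0 : forall i, 0 <= w i) (wS : forall i, w i.+1 <= w i)
  (w_cvg : forall eps, 0 < eps -> exists N0, forall N, (N0 <= N)%N -> w N <= eps).

(** After Abel summation the series converges absolutely by telescoping of w, and the boundary term
    is at most B w(N). *)
Lemma dirichlet_test_real (x : nat -> R) : (forall N, `|\sum_(i < N) x i| <= B) ->
  exists l, forall eps, 0 < eps -> exists N0, forall N, (N0 <= N)%N ->
    `|\sum_(i < N) x i * w i - l| <= eps.
Proof.
move=> hx; have B0 : 0 <= B by apply: le_trans (hx 0%N); exact: normr_ge0.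
pose t i := (\sum_(j < i.+1) x j) * (w i - w i.+1).
have tele N : \sum_(i < N) (w i - w i.+1) = w 0%N - w N.
  by elim: N => [|N IH]; rewrite ?big_ord0 ?subrr // big_ord_recr /= IH addrA subrK.
have nsE n : [normed series t] n = \sum_(i < n) `|t i| by rewrite /= seriesEord.
have cv : cvgn (series t).
  apply: (@normed_cvg R R^o); apply: nondecreasing_is_cvgn.
    by apply/nondecreasing_seqP => n; rewrite !nsE big_ord_recr lerDl.
  exists (B * w 0%N) => _ [n _ <-]; rewrite nsE.
  apply: (@le_trans _ _ (\sum_(i < n) B * (w i - w i.+1))).
    apply: ler_sum => i _; rewrite /t normrM (ger0_norm (_ : 0 <= w i - _)) ?subr_ge0 //.
    by rewrite ler_wpM2r ?subr_ge0.
  by rewrite -mulr_sumr tele ler_wpM2l // gerBl.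
exists (limn (series t)) => eps e0.
have e2 : 0 < eps / 2 by rewrite divr_gt0.
have e3 : 0 < eps / (2 * (B + 1)) by rewrite divr_gt0 // mulr_gt0 // ltr_wpDl.
have [N1 hN1] := w_cvg e3.
have /cvgrPdist_le /(_ _ e2) [N2 _ hN2] := cv.
exists (maxn N1 N2) => N; rewrite geq_max => /andP[h1 h2].
have := hN2 N h2; have := hN1 N h1 => hw.
rewrite /series /= big_mkord distrC => hs.
rewrite (abel_sum x w) addrAC.
apply: le_trans (ler_normD _ _) _; rewrite [leRHS](splitr eps) lerD // normrM (ger0_norm (w0 N)).
apply: (@le_trans _ _ (B * (eps / (2 * (B + 1))))); first exact: ler_pM.
rewrite mulrA ler_pdivrMr; last by rewrite mulr_gt0 // ltr_wpDl.
by nra.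
Qed.

Lemma dirichlet_test (x : nat -> R[i]) : (forall N, normc (\sum_(i < N) x i) <= B) ->
  exists l, forall eps, 0 < eps -> exists N0, forall N, (N0 <= N)%N ->
    normc (\sum_(i < N) x i * (w i)%:C - l) <= eps.
Proof.
move=> hx.
have ReS (F : nat -> R[i]) N : complex.Re (\sum_(i < N) F i) = \sum_(i < N) complex.Re (F i).
  by elim: N => [|N IH]; rewrite ?big_ord0 // !big_ord_recr /= -IH; case: (\sum_(i < N) _) (F N) => [? ?] [? ?].
have ImS (F : nat -> R[i]) N : complex.Im (\sum_(i < N) F i) = \sum_(i < N) complex.Im (F i).
  by elim: N => [|N IH]; rewrite ?big_ord0 // !big_ord_recr /= -IH; case: (\sum_(i < N) _) (F N) => [? ?] [? ?].
have [a ha] : exists a, forall eps, 0 < eps -> exists N0, forall N, (N0 <= N)%N ->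
    `|\sum_(i < N) complex.Re (x i) * w i - a| <= eps.
  apply: (@dirichlet_test_real (fun i => complex.Re (x i))) => N; rewrite -ReS.
  by apply: le_trans (hx N); exact: normc_ge_Re.
have [b hb] : exists b, forall eps, 0 < eps -> exists N0, forall N, (N0 <= N)%N ->
    `|\sum_(i < N) complex.Im (x i) * w i - b| <= eps.
  apply: (@dirichlet_test_real (fun i => complex.Im (x i))) => N; rewrite -ImS.
  by apply: le_trans (hx N); exact: normc_ge_Im.
exists (a +i* b) => eps e0; have e2 : 0 < eps / 2 by rewrite divr_gt0.
have [N1 h1] := ha _ e2; have [N2 h2] := hb _ e2.
exists (maxn N1 N2) => N; rewrite geq_max => /andP[/h1 {}h1 /h2 {}h2].
pose S : R[i] := \sum_(i < N) x i * (w i)%:C; rewrite -/S.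
have eR : complex.Re S = \sum_(i < N) complex.Re (x i) * w i.
  by apply: etrans (ReS (fun i => x i * (w i)%:C) N) _; apply: eq_bigr => i _; case: (x i) => c d /=; rewrite mulr0 subr0.
have eI : complex.Im S = \sum_(i < N) complex.Im (x i) * w i.
  by apply: etrans (ImS (fun i => x i * (w i)%:C) N) _; apply: eq_bigr => i _; case: (x i) => c d /=; rewrite mulr0 add0r.
rewrite -eR in h1; rewrite -eI in h2; case: S h1 h2 {eR eI} => c d h1 h2.
have -> : c +i* d - (a +i* b) = (c - a)%:C + 'i * (d - b)%:C.
  by simpc.
apply: le_trans (normcD _ _) _; rewrite Normc.normcM !normc_real.
rewrite (_ : Normc.normc 'i = 1) ?mul1r; last by rewrite /= expr0n expr1n add0r sqrtr1.
by rewrite [leRHS](splitr eps) lerD.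
Qed.
End DirichletTest.

Section InverseSqrtWeights.
Variable R : realType.

Definition isq (i : nat) : R := (Num.sqrt i.+1%:R)^-1.

Lemma isq_gt0 i : 0 < isq i.
Proof. by rewrite invr_gt0 sqrtr_gt0 ltr0n. Qed.

Lemma isq_decr i j : (i <= j)%N -> isq j <= isq i.
Proof.
by move=> ij; rewrite lef_pV2 ?posrE ?sqrtr_gt0 ?ltr0n // ler_wsqrtr // ler_nat.
Qed.

Lemma isq_cvg eps : 0 < eps -> exists N0, forall N, (N0 <= N)%N -> isq N <= eps.
Proof.
move=> e0; exists (Num.truncn (eps ^- 2)).+1 => N hN.
have h : eps ^- 2 <= N.+1%:R.
  by apply: le_trans (_ : (Num.truncn (eps ^- 2)).+1%:R <= _); rewrite ?ler_nat ?ltW ?truncnS_gt // ltnW.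
rewrite -[leRHS]invrK lef_pV2 ?posrE ?invr_gt0 ?sqrtr_gt0 ?ltr0n //.
rewrite -(ger0_norm (_ : 0 <= eps^-1)) ?invr_ge0 ?(ltW e0) // -sqrtr_sqr ler_wsqrtr // exprVn //.
Qed.

(** Before M each step is at most 2 (M+1)(1 - rho), by Bernoulli. After M it is at most the step of
    U(i) = isq(i)(1 + rho^(i+1)), because isq(i) and isq(i) rho^(i+1) both decrease; this telescopes
    to U(M) <= 2 isq(M). Taking M large first and then rho near 1 makes the bound small uniformly in
    N. *)
Lemma isq_geo_variation (rho : R) (M N : nat) : 0 <= rho -> rho <= 1 ->
  \sum_(i < N) `|isq i * (1 - rho ^+ i.+1) - isq i.+1 * (1 - rho ^+ i.+2)| <=
    2 * M.+1%:R ^+ 2 * (1 - rho) + 2 * isq M.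
Proof.
move=> r0 r1.
have bern i : 1 - rho ^+ i <= i%:R * (1 - rho).
  rewrite -opprB subrX1 -mulNr opprB mulrC ler_wpM2r ?subr_ge0 //.
  rewrite (_ : i%:R = \sum_(j < i) 1); last by rewrite sumr_const card_ord.
  by apply: ler_sum => j _; rewrite exprn_ile1.
have p01 i : 0 <= rho ^+ i <= 1 by rewrite exprn_ge0 // exprn_ile1.
have is1 i : isq i <= 1.
  by rewrite invf_le1 ?sqrtr_gt0 ?ltr0n // -[leLHS]sqrtr1 ler_wsqrtr // ler1n.
have d0 : 0 <= 1 - rho by rewrite subr_ge0.
pose T i := `|isq i * (1 - rho ^+ i.+1) - isq i.+1 * (1 - rho ^+ i.+2)|.
have small i : (i < M)%N -> T i <= 2 * M.+1%:R * (1 - rho).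
  move=> iM; have u j : (j <= M)%N -> 0 <= isq j * (1 - rho ^+ j.+1) <= M.+1%:R * (1 - rho).
    move=> jM; have /andP[a b] := p01 j.+1; apply/andP; split.
      by rewrite mulr_ge0 ?subr_ge0 // ltW // isq_gt0.
    apply: (@le_trans _ _ (1 * (j.+1%:R * (1 - rho)))).
      by apply: ler_pM; rewrite ?subr_ge0 // ltW // isq_gt0.
    by rewrite mul1r ler_wpM2r // ler_nat.
  have /andP[a b] := u i (ltnW iM); have /andP[c d] := u i.+1 iM.
  by rewrite /T ler_norml; apply/andP; split; lra.
pose U i := isq i * (1 + rho ^+ i.+1).
have U0 i : 0 <= U i.
  by have /andP[a b] := p01 i.+1; rewrite mulr_ge0 ?addr_ge0 // ltW // isq_gt0.
have big i : T i <= U i - U i.+1.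
  have w1 : isq i.+1 <= isq i by apply: isq_decr.
  have w0 : 0 <= isq i.+1 by rewrite ltW // isq_gt0.
  have /andP[a b] := p01 i.+1; have /andP[c d] := p01 i.+2.
  have cd : rho ^+ i.+2 <= rho ^+ i.+1 by apply: ler_wiXn2l.
  rewrite /T /U; move: (isq i) (isq i.+1) (rho ^+ i.+1) (rho ^+ i.+2) w1 w0 a b c d cd => v v' x y *.
  by rewrite ler_norml; apply/andP; split; nra.
have tele K : \sum_(i < K) (U (M + i)%N - U (M + i).+1) = U M - U (M + K)%N.
  by elim: K => [|K IH]; rewrite ?big_ord0 ?addn0 ?subrr // big_ord_recr /= IH addrA subrK addnS.
have mono : \sum_(i < N) T i <= \sum_(i < M + N) T i.
  rewrite addnC big_split_ord /= lerDl; apply: sumr_ge0 => i _; exact: normr_ge0.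
apply: le_trans mono _; rewrite big_split_ord /=; apply: lerD.
  apply: (@le_trans _ _ (\sum_(i < M) 2 * M.+1%:R * (1 - rho))).
    by apply: ler_sum => i _; apply: small.
  rewrite sumr_const card_ord -[leLHS]mulr_natl.
  have m1 : (M%:R : R) <= M.+1%:R by rewrite ler_nat.
  have m0 : 0 <= 2 * M.+1%:R * (1 - rho) by rewrite !mulr_ge0.
  apply: le_trans (ler_wpM2r m0 m1) _.
  by rewrite le_eqVlt; apply/orP; left; apply/eqP; ring.
apply: (@le_trans _ _ (\sum_(i < N) (U (M + i)%N - U (M + i).+1))).
  by apply: ler_sum => i _; apply: big.
rewrite tele; apply: (@le_trans _ _ (U M)); first by rewrite gerBl.
have /andP[a b] := p01 M.+1; rewrite /U mulrC ler_wpM2r ?(ltW (isq_gt0 _)) //; lra.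
Qed.

End InverseSqrtWeights.

(** * From the smoothed series to L(1/2, chi) *)

Section LSeries.
Variables (R : realType).
Local Notation normc := (@Normc.normc R).

Lemma dirichlet_term (m : nat) :
  cexp (- 2^-1 * (ln m.+1%:R)%:C) = (isq R m)%:C :> R[i].
Proof.
have m0 : (0 : R) < m.+1%:R by rewrite ltr0n.
have -> : - 2^-1 * (ln m.+1%:R)%:C = (- (2^-1 * ln m.+1%:R))%:C :> R[i].
  by rewrite rmorphN rmorphM /= fmorphV rmorph_nat mulNr.
rewrite /cexp /= cos0 sin0 expRN.
rewrite -[RHS]mulr1; congr (_ * _); congr (_%:C); congr (_^-1).
by rewrite -powR12_sqrt ?ltW // /powR gt_eqF.
Qed.

Variables (p : prime_nat) (n : nat) (chi : int -> R[i]).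
Hypothesis hprim : primitive_character (p ^ n)%N chi.
Hypothesis n1 : (1 < n)%N.
Local Notation q := (p ^ n)%N.

Let hchi : dirichlet_character q chi. Proof. by case: hprim. Qed.
Let n0 : (0 < n)%N. Proof. exact: ltnW. Qed.
Let q0 : (0 < q)%N. Proof. by rewrite expn_gt0 prime_gt0 // prime_valP. Qed.

(** A sum over a full period is zero, by [gauss_twist] for the conjugate character at m = 0; fewer
    than q terms remain. *)
Lemma char_sum_bounded x : normc (\sum_(i < x) chi i.+1%:Z) <= q%:R.
Proof.
have chi_zero : chi 0 = 0.
  rewrite (chi_eq0 hchi n0) //.
  by rewrite coprimezE /= /coprime gcd0n gtn_eqF // prime_gt1 // prime_valP.
have xtot : \sum_(b < q) chi b%:Z = 0.
  have h := etrans (gauss_twist (primitive_conj hprim) n1 0) (etrans (congr1 ( *%R^~ _) (etrans (congr1 conjc chi_zero) (conjc0 R))) (mul0r _)).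
  by apply: etrans h; apply: eq_bigr => b _; rewrite conjcK mul0n mul0r e_real0 mulr1.
have per y : \sum_(i < q) chi (y + i)%N%:Z = 0.
  elim: y => [|y IH]; first by rewrite -[RHS]xtot.
  rewrite -[RHS]IH; case: (q) (hchi) IH => [|q'] hc IH; first by rewrite !big_ord0.
  rewrite big_ord_recr [RHS]big_ord_recl [RHS]addrC; congr (_ + _).
    by apply: eq_bigr => i _; rewrite /= /bump add1n addnS addSn.
  by rewrite /= addn0 addSnnS PoszD; case: hc => _ h _; exact: h.
have small y : (y <= q)%N -> normc (\sum_(i < y) chi (x - y + i.+1)%N%:Z) <= q%:R.
  move=> yq; apply: le_trans (normc_sum _ _ _) _.
  apply: (@le_trans _ _ (\sum_(i < y) 1)).
    by apply: ler_sum => i _; exact: normc_chi_le1 hchi n0 _.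
  by rewrite sumr_const card_ord ler_nat.
have blocks c : \sum_(i < c * q) chi i.+1%:Z = 0.
  elim: c => [|c IH]; first by rewrite big_ord0.
  rewrite mulSnr big_split_ord /= IH add0r -[RHS](per (c * q).+1).
  by apply: eq_bigr => i _; rewrite addSn.
have ex := divn_eq x q.
have ed : (x - x %% q = x %/ q * q)%N by rewrite {1}ex addnK.
have -> : \sum_(i < x) chi i.+1%:Z = \sum_(i < x %% q) chi (x - x %% q + i.+1)%N%:Z.
  have -> : \sum_(i < x) chi i.+1%:Z = \sum_(i < x %/ q * q + x %% q) chi i.+1%:Z by rewrite -ex.
  rewrite big_split_ord /= blocks add0r; apply: eq_bigr => i _.
  by rewrite ed addnS.
by apply: small; rewrite ltnW // ltn_mod.
Qed.

(** [dirichlet_L] is a [lim], which says something only once convergence is known; l is the actual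
    limit, with an explicit modulus of convergence. *)
Lemma dirichlet_L_cvg : exists l : R[i], `|dirichlet_L chi 2^-1| = (normc l)%:C /\
  forall eps, 0 < eps -> exists N0, forall N, (N0 <= N)%N ->
    normc (\sum_(i < N) chi i.+1%:Z * (isq R i)%:C - l) <= eps.
Proof.
have [l hl] := @dirichlet_test R (isq R) q%:R (fun i => ltW (isq_gt0 R i)) (fun i => isq_decr R (leqnSn i))
  (@isq_cvg R) (fun i => chi i.+1%:Z) char_sum_bounded.
exists l; split=> //; rewrite -normrE; congr (`|_|); rewrite /dirichlet_L.
apply: (@cvg_lim R[i]^o (@norm_hausdorff _ _)); apply/cvgrPdist_le => eps eps0.
have [e ee] : exists e : R, eps = e%:C.
  by apply/complex_realP; rewrite realE ltW.
have e0 : 0 < e by rewrite -ltcR -ee.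
have [N0 hN0] := hl e e0.
exists N0.+1 => // -[//|N] /= hN.
rewrite distrC normrE ee lecR; apply: le_trans (hN0 N hN).
rewrite big_add1 big_mkord /= le_eqVlt; apply/orP; left; apply/eqP; congr (normc (_ - _)).
by apply: eq_bigr => i _; rewrite dirichlet_term.
Qed.

(** The order of choices matters: M makes isq(M) small against q, then Y makes 1 - rho small against
    q M^2, and N comes last. The terms are L to partial sum, partial sum to its damped version, and
    the latter to K times the smoothed sum, where replacing m^(-1/2) costs 5, a bound for the sum of
    m^(-3/2). *)
Lemma dirichlet_L_le (K Bnd Y0 : R) : 0 <= K ->
    (forall m, (0 < m)%N -> `|(Num.sqrt m%:R)^-1 - K * cb R m| <= (m%:R * Num.sqrt m%:R)^-1) ->
    (forall Y, Y0 <= Y -> 1 <= Y -> normc (smooth_sum p n chi (1 - Y^-1)) <= Bnd) ->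
  `|dirichlet_L chi 2^-1| <= (K * Bnd + 5)%:C.
Proof.
move=> K0 hK hB; have [l [-> hl]] := dirichlet_L_cvg; rewrite lecR.
apply/ler_addgt0Pr => eps eps0.
have e3 : 0 < eps / 3 by rewrite divr_gt0.
have qR : (0 : R) < q%:R by rewrite ltr0n.
have eq : 0 < eps / 3 / (q%:R * 6) by rewrite divr_gt0 // mulr_gt0.
have [M hM] := isq_cvg eq.
pose s (N : nat) : R[i] := \sum_(i < N) chi i.+1%:Z * (isq R i)%:C.
pose A (rho : R) (N : nat) : R[i] := \sum_(i < N) chi i.+1%:Z * (isq R i * rho ^+ i.+1)%:C.
(* The 1/2 ensures Y >= 2; the other entry makes the part of the variation before M at most
   eps/9. *)
pose dl := Num.min (2^-1) (eps / 3 / (q%:R * (6 * M.+1%:R ^+ 2))).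
have M0 : 0 < q%:R * (6 * M.+1%:R ^+ 2) :> R by rewrite mulr_gt0 // mulr_gt0 // exprn_gt0 // ltr0n.
have X0 : 0 < eps / 3 / (q%:R * (6 * M.+1%:R ^+ 2)) by rewrite divr_gt0.
have dl0 : 0 < dl by rewrite lt_min X0 andbT invr_gt0.
have dlh : dl <= 2^-1 by rewrite ge_min lexx.
have dle : dl <= eps / 3 / (q%:R * (6 * M.+1%:R ^+ 2)) by rewrite ge_min lexx orbT.
pose Y := Num.max Y0 dl^-1.
have YY0 : Y0 <= Y by rewrite le_max lexx.
have Yd : dl^-1 <= Y by rewrite le_max lexx orbT.
have Yp : 0 < Y by apply: lt_le_trans Yd; rewrite invr_gt0.
have Y2 : 2 <= Y by apply: le_trans Yd; rewrite -[leLHS]invrK lef_pV2 ?posrE ?invr_gt0.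
have Yi : Y^-1 <= dl by rewrite -[leRHS]invrK lef_pV2 ?posrE ?invr_gt0.
pose rho := 1 - Y^-1.
have Yi0 : 0 < Y^-1 by rewrite invr_gt0.
have r0 : 0 <= rho by rewrite /rho; lra.
have r1 : rho < 1 by rewrite /rho; lra.
have hBY : normc (smooth_sum p n chi rho) <= Bnd by apply: hB => //; lra.
have eK : 0 < eps / 3 / (K + 1) by rewrite divr_gt0 // ltr_wpDl.
have [N1 hN1] := hl _ e3.
have [N2 hN2] := partial_sum_cvg hprim n1 r0 r1 eK.
pose N := maxn M (maxn N1 N2).
have hN : (N1 <= N)%N by rewrite /N !leq_max leqnn orbT.
have hN' : (N2 <= N.+1)%N by rewrite ltnW // ltnS /N !leq_max leqnn !orbT.
have hNM : (M <= N)%N by rewrite leq_maxl.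
have h1 := hN1 N hN; rewrite -/(s N) in h1.
have h2 := hN2 N.+1 hN'.
have cs := char_sum_bounded.
have h3 : normc (s N - A rho N) <= eps / 3.
  pose u i : R := isq R i * (1 - rho ^+ i.+1).
  have -> : s N - A rho N = \sum_(i < N) chi i.+1%:Z * (u i)%:C.
    rewrite /s /A -sumrB; apply: eq_bigr => i _.
    by rewrite -mulrBr -rmorphB /u mulrBr mulr1.
  rewrite (abel_sum (fun i => chi i.+1%:Z) (fun i => (u i)%:C)).
  apply: le_trans (normcD _ _) _.
  have t1 : normc (\sum_(i < N) (\sum_(j < i.+1) chi j.+1%:Z) * ((u i)%:C - (u i.+1)%:C))
      <= q%:R * (2 * M.+1%:R ^+ 2 * (1 - rho) + 2 * isq R M).
    apply: le_trans (normc_sum _ _ _) _.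
    apply: (@le_trans _ _ (q%:R * \sum_(i < N) `|u i - u i.+1|)).
      rewrite mulr_sumr; apply: ler_sum => i _; rewrite Normc.normcM -rmorphB normc_real.
      by apply: ler_wpM2r.
    by rewrite ler_pM2l //; apply: isq_geo_variation => //; exact: ltW.
  have t2 : normc ((\sum_(j < N) chi j.+1%:Z) * (u N)%:C) <= q%:R * isq R M.
    rewrite Normc.normcM normc_real; apply: ler_pM; rewrite ?normc_ge0 //.
    have p0 : 0 <= rho ^+ N.+1 by rewrite exprn_ge0.
    have p1 : rho ^+ N.+1 <= 1 by rewrite exprn_ile1 // ltW.
    rewrite /u normrM gtr0_norm ?isq_gt0 // ger0_norm ?subr_ge0 //.
    apply: (@le_trans _ _ (isq R N)); last exact: isq_decr.
    by rewrite ler_piMr ?(ltW (isq_gt0 _ _)) // gerBl.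
  apply: le_trans (lerD t1 t2) _.
  have e1 : q%:R * (2 * M.+1%:R ^+ 2 * (1 - rho)) <= eps / 9.
    have -> : 1 - rho = Y^-1 by rewrite /rho; ring.
    have M1 : 0 < M.+1%:R ^+ 2 :> R by rewrite exprn_gt0 // ltr0n.
    apply: (@le_trans _ _ (q%:R * (2 * M.+1%:R ^+ 2 * (eps / 3 / (q%:R * (6 * M.+1%:R ^+ 2)))))).
      by rewrite ler_pM2l // ler_pM2l ?mulr_gt0 // (le_trans Yi).
    move: (M.+1%:R ^+ 2) M1 => m2 M1.
    by rewrite le_eqVlt; apply/orP; left; apply/eqP; field; rewrite !gt_eqF.
  have e2 : q%:R * isq R M <= eps / 18.
    have := hM M (leqnn _); rewrite -(ler_pM2l qR) => /le_trans; apply.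
    by rewrite le_eqVlt; apply/orP; left; apply/eqP; field; rewrite gt_eqF.
  rewrite mulrDr; lra.
have h4 : normc (A rho N) <= K * (Bnd + eps / 3 / (K + 1)) + 5.
  pose V : R[i] := \sum_(m < N.+1) chi m%:Z * (cb R m * rho ^+ m)%:C.
  have hV : normc V <= Bnd + eps / 3 / (K + 1).
    have := normcD (V - smooth_sum p n chi rho) (smooth_sum p n chi rho).
    by rewrite subrK; move: h2; rewrite -/V; lra.
  have chi_zero : chi 0 = 0.
    rewrite (chi_eq0 hchi n0) //.
    by rewrite coprimezE /= /coprime gcd0n gtn_eqF // prime_gt1 // prime_valP.
  pose D : R[i] := \sum_(i < N) chi i.+1%:Z * ((isq R i - K * cb R i.+1) * rho ^+ i.+1)%:C.
  have -> : A rho N = K%:C * V + D.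
    rewrite /V big_ord_recl chi_zero mul0r add0r mulr_sumr /D -big_split; apply: eq_bigr => i _ /=.
    rewrite mulrCA -mulrDr -rmorphM -rmorphD; congr (_ * _%:C); rewrite /bump /= add1n.
    by rewrite mulrA -mulrDl addrC subrK.
  apply: le_trans (normcD _ _) _; apply: lerD.
    by rewrite Normc.normcM normc_real ger0_norm // ler_wpM2l.
  apply: le_trans (normc_sum _ _ _) _.
  (* Splitting off m = 1 reduces the sum of m^(-3/2) to 1 plus a tail, bounded by 4 through
     [pmaj_tail_le] with a = 0 and Z = 1. *)
  apply: (@le_trans _ _ (\sum_(i < N) ((if i.+1%:R <= 1 :> R then i.+1%:R `^ (1 - 1) else 0)
       + (if 1 < i.+1%:R :> R then i.+1%:R `^ (- 2^-1 - 1) else 0)))).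
    apply: ler_sum => i _; rewrite Normc.normcM normc_real normrM.
    have c1 := normc_chi_le1 hchi n0 i.+1%:Z.
    have rr : `|rho ^+ i.+1| <= 1 by rewrite ger0_norm ?exprn_ge0 // exprn_ile1 // ltW.
    apply: (@le_trans _ _ (i.+1%:R `^ (- (3 / 2)))).
      rewrite -powR_N32 //; apply: le_trans (hK i.+1 isT).
      rewrite -[leRHS]mul1r; apply: ler_pM; rewrite ?normc_ge0 ?mulr_ge0 //.
      by rewrite ler_piMr.
    rewrite (_ : - (3 / 2) = - 2^-1 - 1); last by lra.
    have [h|h] := leP (i.+1%:R : R) 1; last by rewrite add0r.
    rewrite addr0; have -> : i.+1%:R = 1 :> R by apply/eqP; rewrite eq_le h ler1n.
    by rewrite !powR1.
  rewrite big_split /=; apply: (@le_trans _ _ (1 + 4)); last by lra.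
  apply: lerD.
    have : \sum_(i < N) (if i.+1%:R <= 1 :> R then i.+1%:R `^ (1 - 1) else 0) <= 2 / 1 * 1 `^ 1 :> R.
      by apply: sum_powR_le.
    case: N {hN hN' hNM h1 h2 h3 V hV D} => [|N'] _; first by rewrite big_ord0.
    rewrite big_ord_recl /= lexx powR1 big1 ?addr0 // => i _.
    by rewrite leNgt ltr1n.
  have := pmaj_tail_le 0 N (lexx (1 : R)); rewrite powRr0 mul1r powR1 mulr1.
  by [].
have -> : l = (l - s N) + ((s N - A rho N) + A rho N) by rewrite !subrK.
have d1 := normcD (l - s N) ((s N - A rho N) + A rho N).
have d2 := normcD (s N - A rho N) (A rho N).
have d3 : normc (l - s N) <= eps / 3 by rewrite -normcN opprB.
have d4 : K * (eps / 3 / (K + 1)) <= eps / 3.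
  rewrite mulrA ler_pdivrMr ?ltr_wpDl // mulrDr mulr1 mulrC lerDl ltW //.
lra.
Qed.
End LSeries.

(** * The central value *)

Section SmoothSumBounds.
Variables (R : realType) (p : prime_nat) (n : nat) (chi : int -> R[i]).
Hypothesis hprim : primitive_character (p ^ n)%N chi.
Hypothesis n1 : (1 < n)%N.
Local Notation normc := (@Normc.normc R).
Local Notation q := (p ^ n)%N.

Let hchi : dirichlet_character q chi. Proof. by case: hprim. Qed.
Let n0 : (0 < n)%N. Proof. exact: ltnW. Qed.

(** At Y = 1 the radius is 0 and only m = 0 is left, where chi vanishes. Bounds for differences
    starting at Y = 1 are thus bounds for values. *)
Lemma smooth_sum0 : smooth_sum p n chi (1 - 1^-1) = 0.
Proof.
rewrite invr1 subrr; apply: Normc.eq0_normc; apply/eqP.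
rewrite eq_le normc_ge0 andbT; apply/ler_addgt0Pr => eps e0; rewrite add0r.
have [N0 /(_ N0.+1 (leqnSn _))] := partial_sum_cvg hprim n1 (lexx 0) ltr01 e0.
rewrite big1 ?sub0r ?normcN // => -[[|m] hm] _ /=; last by rewrite expr0n mulr0 mulr0.
rewrite (chi_eq0 hchi n0) ?mul0r //.
by rewrite coprimezE /= /coprime gcd0n gtn_eqF // prime_gt1 // prime_valP.
Qed.

Lemma pmaj1 (Y : R) b : pmaj 1 Y b = b%:R.
Proof. by rewrite /pmaj subrr powRr0 mulr1 powRr1. Qed.

(** Stated with [pmaj] for a = 1 so that [pmaj_sum_gt] applies to the trivial bound too. *)
Lemma char_sum_trivial x : normc (\sum_(i < x) chi i.+1%:Z) <= pmaj 1 1 x.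
Proof.
rewrite pmaj1; apply: le_trans (normc_sum _ _ _) _.
apply: (@le_trans _ _ (\sum_(i < x) 1)); last by rewrite sumr_const card_ord.
by apply: ler_sum => i _; exact: normc_chi_le1 hchi n0 _.
Qed.

(** X = sqrt q is the self-dual point q/X = X: in both forms the weight has upper end X, and the
    hypothesis allows any lower end. *)
Lemma smooth_sum_le_half (G Y B a : R) :
    0 <= G -> (forall x, normc (\sum_(i < x) chi i.+1%:Z) <= G * pmaj a Y x) ->
    (forall Z1 N, 0 < Z1 -> \sum_(i < N) pmaj a Y i.+1 * wt Z1 (Num.sqrt q%:R) i.+1 <= B) ->
  forall Y', Num.sqrt q%:R <= Y' -> normc (smooth_sum p n chi (1 - Y'^-1)) <= (9 + 20 * pi) * (G * B).
Proof.
move=> G0 hS hB Y' hY.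
have q0 : (0 : R) < q%:R by rewrite ltr0n expn_gt0 prime_gt0 // prime_valP.
set X := Num.sqrt q%:R in hY hB *.
have X1 : 1 <= X by rewrite -[leLHS]sqrtr1 ler_wsqrtr // ler1n expn_gt0 prime_gt0 // prime_valP.
have X0 : 0 < X by apply: lt_le_trans X1.
have Y'0 : 0 < Y' by apply: lt_le_trans hY.
have qX : q%:R / X = X by rewrite -{1}(sqr_sqrtr (ltW q0)) -/X expr2 mulfK // gt_eqF.
have sG (Z1 Z2 : R) N : \sum_(i < N) G * pmaj a Y i.+1 * wt Z1 Z2 i.+1 =
    G * \sum_(i < N) pmaj a Y i.+1 * wt Z1 Z2 i.+1.
  by rewrite mulr_sumr; apply: eq_bigr => i _; rewrite mulrA.
have h1 := @smooth_sum_direct R p n chi hprim n1 (fun x => G * pmaj a Y x) 1 X (G * B) hS (lexx _) X1 _.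
have h2 := @smooth_sum_dual R p n chi hprim n1 (fun x => G * pmaj a Y x) X Y' (G * B) hS X1 hY _.
have {}h1 := h1 (fun N => ltac:(by rewrite sG ler_wpM2l // hB)).
have {}h2 := h2 (fun N => ltac:(by rewrite sG qX ler_wpM2l // hB // divr_gt0)).
rewrite smooth_sum0 subr0 in h1.
have := normcD (smooth_sum p n chi (1 - Y'^-1) - smooth_sum p n chi (1 - X^-1)) (smooth_sum p n chi (1 - X^-1)).
rewrite subrK; lra.
Qed.

(** Duality sends the range [P, X] to [X, Y], so both middle pieces see the weight with ends X and
    Y. It sends [Y, Y'] to a range with upper end P, where the trivial bound gives 8 P^(1/2), as on
    [1, P]; the 8 is 2/(1/2) + 4 from [pmaj_sum_gt] with a = 1. *)
Lemma smooth_sum_le_conv (G P B a : R) : let X := Num.sqrt q%:R in let Y := q%:R / P in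
    0 <= G -> 1 <= P -> P <= X ->
    (forall x, normc (\sum_(i < x) chi i.+1%:Z) <= G * pmaj a Y x) ->
    (forall N, \sum_(i < N) pmaj a Y i.+1 * wt X Y i.+1 <= B) ->
  forall Y', Y <= Y' ->
  normc (smooth_sum p n chi (1 - Y'^-1)) <= (9 + 20 * pi) * (8 * P `^ 2^-1 + G * B).
Proof.
move=> X Y G0 P1 PX hS hB Y' hY.
have q0 : (0 : R) < q%:R by rewrite ltr0n expn_gt0 prime_gt0 // prime_valP.
have P0 : 0 < P by apply: lt_le_trans P1.
have X0 : 0 < X by apply: lt_le_trans PX.
have X1 : 1 <= X by apply: le_trans PX.
have eX : X * X = q%:R by rewrite -expr2 sqr_sqrtr // ltW.
have qX : q%:R / X = X by rewrite -eX mulfK // gt_eqF.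
have XY : X <= Y by rewrite /Y ler_pdivlMr // -eX ler_pM2l.
have Y1 : 1 <= Y by apply: le_trans XY.
have Y0 : 0 < Y by apply: lt_le_trans Y1.
have Y'0 : 0 < Y' by apply: lt_le_trans hY.
have qY : q%:R / Y = P by rewrite /Y; field; rewrite !gt_eqF.
have sG (Z1 Z2 : R) N : \sum_(i < N) G * pmaj a Y i.+1 * wt Z1 Z2 i.+1 =
    G * \sum_(i < N) pmaj a Y i.+1 * wt Z1 Z2 i.+1.
  by rewrite mulr_sumr; apply: eq_bigr => i _; rewrite mulrA.
have triv (Z1 : R) N : 0 < Z1 -> \sum_(i < N) pmaj 1 1 i.+1 * wt Z1 P i.+1 <= 8 * P `^ 2^-1.
  move=> Z10; have := @pmaj_sum_gt R 1 P Z1 P N _ (lexx _) Z10 P1 (lexx _).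
  have -> : (1 : R) - 2^-1 = 2^-1 by lra.
  have -> : 2 / 2^-1 + 4 = 8 :> R by rewrite invrK; lra.
  have h2 : (2^-1 : R) < 1 by lra.
  move=> /(_ h2); apply: le_trans; rewrite le_eqVlt; apply/orP; left; apply/eqP.
  by apply: eq_bigr => i _; rewrite !pmaj1.
have h1 := smooth_sum_direct hprim n1 char_sum_trivial (lexx 1) P1 (fun N => triv 1 N ltr01).
have h2 := @smooth_sum_dual R p n chi hprim n1 (fun x => G * pmaj a Y x) P X (G * B) hS P1 PX.
have {}h2 := h2 (fun N => ltac:(by rewrite sG qX ler_wpM2l // hB)).
have h3 := @smooth_sum_direct R p n chi hprim n1 (fun x => G * pmaj a Y x) X Y (G * B) hS X1 XY.
have {}h3 := h3 (fun N => ltac:(by rewrite sG ler_wpM2l // hB)).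
have h4 := @smooth_sum_dual R p n chi hprim n1 _ Y Y' (8 * P `^ 2^-1) char_sum_trivial Y1 hY.
have {}h4 := h4 (fun N => ltac:(by rewrite qY; apply: triv; rewrite divr_gt0)).
rewrite smooth_sum0 subr0 in h1.
have -> : smooth_sum p n chi (1 - Y'^-1) =
  (smooth_sum p n chi (1 - Y'^-1) - smooth_sum p n chi (1 - Y^-1)) +
  ((smooth_sum p n chi (1 - Y^-1) - smooth_sum p n chi (1 - X^-1)) +
   ((smooth_sum p n chi (1 - X^-1) - smooth_sum p n chi (1 - P^-1)) + smooth_sum p n chi (1 - P^-1))).
  by rewrite !subrK.
apply: le_trans (normcD _ _) _; apply: le_trans (lerD h4 (normcD _ _)) _.
apply: le_trans (lerD (lexx _) (lerD h3 (normcD _ _))) _.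
apply: le_trans (lerD (lexx _) (lerD (lexx _) (lerD h2 h1))) _.
lra.
Qed.

End SmoothSumBounds.

Section CentralValue.
Variables (R : realType) (k l : R) (r : rat -> prime_nat -> nat -> R -> R) (delta : R)
    (n0 u0 : rat -> prime_nat -> nat -> R -> nat)
    (kappa0 : rat -> prime_nat -> nat) (lambda0 : rat -> prime_nat -> R).
Hypothesis hq : padic_exponent_datum k l r delta n0 u0 kappa0 lambda0.
Local Notation normc := (@Normc.normc R).
Local Notation a := (l - k).

Definition central_value_bound (p : prime_nat) (kappa n : nat) (lambda d : R) : R :=
  p%:R `^ (r 1 p kappa lambda + kappa%:R * (1 - k - l))
    * (p%:R ^+ n) `^ ((k + l) / 2 - 4^-1) * ln (p%:R ^+ n) `^ d.

Lemma ln_q_ge (p : prime_nat) n : (0 < n)%N -> 2^-1 <= ln ((p : nat)%:R ^+ n) :> R.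
Proof.
move=> n0'; have p2 : (2 : R) <= (p : nat)%:R by rewrite ler_nat prime_gt1 // prime_valP.
have q2 : (2 : R) <= (p : nat)%:R ^+ n.
  by case: n n0' => // n _; rewrite exprS -[leLHS]mulr1; apply: ler_pM => //; rewrite exprn_ege1 //; lra.
apply: (@le_trans _ _ (ln 2)); last by rewrite ler_ln ?posrE //; lra.
have : ln (1 + - 2^-1) <= - 2^-1 :> R by apply: le_ln1Dx; lra.
rewrite (_ : 1 + - 2^-1 = 2^-1) ?lnV ?posrE //; lra.
Qed.

(* W is the geometric mean form of the bound: W >= p^(kappa/2) comes from multiplying
   [datum_size_ge1] with [datum_size_sqrt]. *)
Lemma exponent_datum_bound : exists2 C : R, 0 < C &
  forall (p : prime_nat) (kappa n : nat) (lambda : R) (chi : int -> R[i]),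
    (1 + iota' p 2 <= kappa)%N -> rhoN p lambda -> (kappa0 1 p <= kappa)%N ->
    lambda0 1 p <= lambda -> (n0 1 p kappa lambda + kappa <= n)%N ->
    primitive_character (p ^ n)%N chi ->
  (2 * kappa < n)%N /\ exists G W : R,
  [/\ 0 <= G, G * Num.sqrt (p ^ n)%:R `^ (a - 2^-1) = 4 * W,
    1 <= ((p : nat)%:R ^+ kappa) `^ 2^-1 :> R, ((p : nat)%:R ^+ kappa) `^ 2^-1 <= W &
    W <= C * central_value_bound p kappa n lambda delta /\
    forall x, normc (\sum_(i < x) chi i.+1%:Z) <= G * pmaj a ((p ^ n)%:R / (p : nat)%:R ^+ kappa) x].
Proof.
have [C C0 hC] := datum_phase_sum hq.
exists C => // p kappa n lambda chi hk hlam hk0 hl0 hnn hprim.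
have [n2k hsum] := hC p kappa n lambda hk hlam hk0 hl0 hnn.
have kn : (kappa <= n)%N by lia.
split=> //.
have p2 : (2 : R) <= (p : nat)%:R by rewrite ler_nat prime_gt1 // prime_valP.
pose Q : R := (p : nat)%:R ^+ (n - 2 * kappa); pose P : R := (p : nat)%:R ^+ kappa.
pose q : R := (p : nat)%:R ^+ n.
have pX m : 1 <= (p : nat)%:R ^+ m :> R by rewrite exprn_ege1 //; lra.
have P1 : 1 <= P by exact: pX.
have Q1 : 1 <= Q by exact: pX.
have P0 : 0 < P by apply: lt_le_trans P1.
have Q0 : 0 < Q by apply: lt_le_trans Q1.
have q0 : 0 < q by apply: lt_le_trans (pX n).
have eq : q = Q * P ^+ 2 by rewrite /q /Q /P -exprM -exprD; congr (_ ^+ _); lia.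
pose E := datum_size k r delta C p kappa n lambda.
have E1 : 1 <= E by exact: datum_size_ge1 hsum.
have EQ : Num.sqrt Q <= E * Q `^ a by exact: datum_size_sqrt hsum.
have E0 : 0 < E by apply: lt_le_trans E1.
pose G := 4 * E * P `^ (1 - a).
(* This is G sqrt(q)^(a - 1/2)/4 in terms of q = Q P^2. With the factor Q^k inside E, the exponent
   of Q becomes (k + l)/2 - 1/4, as in the bound to be proved. *)
pose W := E * Q `^ ((a - 2^-1) / 2) * P `^ 2^-1.
exists G, W; split.
- by rewrite !mulr_ge0 ?powR_ge0 // ltW.
- rewrite natrX -/q eq sqrtrM ?(ltW Q0) // sqrtr_sqr (gtr0_norm P0) powRM ?sqrtr_ge0 ?(ltW P0) //.
  rewrite -(powR12_sqrt (ltW Q0)) -powRrM /G /W.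
  rewrite (_ : 2^-1 * (a - 2^-1) = (a - 2^-1) / 2); last by rewrite mulrC.
  rewrite (_ : P `^ 2^-1 = P `^ (1 - a) * P `^ (a - 2^-1)); first by ring.
  by rewrite -powRD ?(gt_eqF P0) ?implybT //; congr (_ `^ _); lra.
- by rewrite -[leLHS](powRr0 P) ler_powR //; lra.
- rewrite /W ler_peMl ?powR_ge0 //.
  rewrite -(ler_pXn2r (ltn0Sn 1)) ?nnegrE ?ler01 //; last by rewrite mulr_ge0 ?powR_ge0 // ltW.
  rewrite expr1n exprMn -[(Q `^ _) ^+ 2]powR_mulrn ?powR_ge0 // -powRrM divfK //.
  have : 1 <= E * (E * Q `^ (a - 2^-1)).
    rewrite -[leLHS]mulr1; apply: ler_pM => //.
    rewrite powRD; last by rewrite (gt_eqF Q0) implybT.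
    rewrite powRN -powR12_sqrt ?(ltW Q0) // in EQ *.
    by rewrite mulrA ler_pdivlMr ?powR_gt0 // mul1r.
  by rewrite mulrA expr2.
split.
  have lnQ : ln Q `^ delta <= ln q `^ delta.
    have d0 : 0 <= delta by case: hq => -[].
    apply: ge0_ler_powR => //; rewrite ?nnegrE ?ln_ge0 ?pX //.
    by rewrite ler_ln ?posrE // /q /Q; apply: ler_weXn2l; [lra|exact: leq_subr].
  rewrite /W /E /datum_size /central_value_bound -/Q -/q -/P.
  have eqq : q `^ ((k + l) / 2 - 4^-1) = Q `^ ((k + l) / 2 - 4^-1) * P `^ (k + l - 2^-1).
    rewrite eq powRM ?(ltW Q0) ?exprn_ge0 ?(ltW P0) // -(powR_mulrn _ (ltW P0)) -powRrM.
    by congr (_ * _ `^ _); lra.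
  have epp : (p : nat)%:R `^ (r 1 p kappa lambda + kappa%:R * (1 - k - l)) =
     (p : nat)%:R `^ r 1 p kappa lambda * P `^ (1 - k - l) :> R.
    rewrite powRD; last by rewrite pnatr_eq0 gtn_eqF ?implybT // prime_gt0 // prime_valP.
    by rewrite powRrM powR_mulrn.
  rewrite eqq epp.
  have -> : Q `^ ((k + l) / 2 - 4^-1) = Q `^ k * Q `^ ((a - 2^-1) / 2).
    by rewrite -powRD ?(gt_eqF Q0) ?implybT //; congr (_ `^ _); lra.
  have -> : P `^ 2^-1 = P `^ (1 - k - l) * P `^ (k + l - 2^-1).
    by rewrite -powRD ?(gt_eqF P0) ?implybT //; congr (_ `^ _); lra.
  set x1 := _ `^ _; set x2 := Q `^ k; set x3 := Q `^ _; set x4 := P `^ _; set x5 := P `^ _.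
  have -> : C * x1 * x2 * ln Q `^ delta * x3 * (x4 * x5) = (C * x1 * x2 * x3 * x4 * x5) * ln Q `^ delta by ring.
  have -> : C * (x1 * x4 * (x2 * x3 * x5) * ln q `^ delta) = (C * x1 * x2 * x3 * x4 * x5) * ln q `^ delta by ring.
  by rewrite ler_wpM2l // !mulr_ge0 ?powR_ge0 // ltW.
move=> x; have := char_sum_le hq hk n2k hsum hprim x.
rewrite /char_majorant -/E -/P -/G.
rewrite (_ : (p ^ n)%:R / P = (p : nat)%:R ^+ (n - kappa)); first by rewrite /pmaj mulrA.
by rewrite natrX -[in LHS](subnK kn) exprD mulfK // gt_eqF.
Qed.

Lemma L_half_le : exists C : R,
  forall (p : prime_nat) (kappa n : nat) (lambda : R) (chi : int -> R[i]),
    (1 + iota' p 2 <= kappa)%N -> rhoN p lambda -> (kappa0 1 p <= kappa)%N ->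
    lambda0 1 p <= lambda -> (n0 1 p kappa lambda + kappa <= n)%N ->
    primitive_character (p ^ n)%N chi ->
  `|dirichlet_L chi 2^-1| <= (C * central_value_bound p kappa n lambda (delta + (a == 2^-1)%:R))%:C.
Proof.
have [C C0 hC] := exponent_datum_bound.
have [K K0 hK] := cb_asymptotic R.
have a0 : 0 <= a := a_ge0 hq.
have a1 : a <= 1 := a_le1 hq.
have pi0 : 0 < 9 + 20 * pi :> R by rewrite addr_gt0 // mulr_gt0 // pi_gt0.
suff [A A0 hA] : exists2 A : R, 0 <= A &
  forall (p : prime_nat) (kappa n : nat) (G W : R) (chi : int -> R[i]),
    (2 * kappa < n)%N -> (1 < n)%N -> primitive_character (p ^ n)%N chi ->
    0 <= G -> G * Num.sqrt (p ^ n)%:R `^ (a - 2^-1) = 4 * W ->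
    1 <= ((p : nat)%:R ^+ kappa) `^ 2^-1 :> R -> ((p : nat)%:R ^+ kappa) `^ 2^-1 <= W ->
    (forall x, normc (\sum_(i < x) chi i.+1%:Z)
       <= G * pmaj a ((p ^ n)%:R / (p : nat)%:R ^+ kappa) x) ->
  forall Y, (p ^ n)%:R / (p : nat)%:R ^+ kappa <= Y ->
    normc (smooth_sum p n chi (1 - Y^-1))
      <= A * (W * ln ((p : nat)%:R ^+ n) `^ (a == 2^-1)%:R).
  (* The absolute error 5 of [dirichlet_L_le] is at most 10 W T, since W >= 1 and the logarithmic
     factor T is at least 1/2. *)
  exists ((K * A + 10) * C) => p kappa n lambda chi hk hlam hk0 hl0 hnn hprim.
  have [n2k [G [W [G0 eG P1 PW [hW hS]]]]] := hC p kappa n lambda chi hk hlam hk0 hl0 hnn hprim.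
  have n1 : (1 < n)%N.
    by apply: leq_ltn_trans n2k; rewrite muln_gt0 /=; apply: leq_trans hk.
  have {}hA := hA p kappa n G W chi n2k n1 hprim G0 eG P1 PW hS.
  apply: le_trans (dirichlet_L_le hprim n1 K0 hK (fun Y hY _ => hA Y hY)) _.
  rewrite lecR.
  have lq := ln_q_ge p (ltnW n1).
  set T := ln _ `^ _.
  have T2 : 2^-1 <= T.
    by rewrite /T; case: (a == 2^-1); rewrite ?powRr1 ?powRr0 //; lra.
  have eT : central_value_bound p kappa n lambda (delta + (a == 2^-1)%:R) = central_value_bound p kappa n lambda delta * T.
    rewrite /central_value_bound [ln _ `^ _]powRD; first by rewrite mulrA.
    by rewrite (gt_eqF (lt_le_trans _ lq)) ?implybT // invr_gt0.
  rewrite eT.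
  have W1 : 1 <= W by apply: le_trans PW.
  have T0 : 0 <= T by lra.
  have h1 : 2^-1 <= W * T by rewrite -[leLHS]mul1r ler_pM //; lra.
  have h2 : W * T <= C * central_value_bound p kappa n lambda delta * T by rewrite ler_wpM2r.
  apply: (@le_trans _ _ ((K * A + 10) * (W * T))); first by lra.
  rewrite [leRHS](_ : _ = (K * A + 10) * (C * central_value_bound p kappa n lambda delta * T)); last by ring.
  by rewrite ler_wpM2l // addr_ge0 ?ler0n // mulr_ge0.
have basic (p : prime_nat) (kappa n : nat) : (2 * kappa < n)%N ->
  let P : R := (p : nat)%:R ^+ kappa in let X : R := Num.sqrt (p ^ n)%:R in
  [/\ 1 <= P, 1 <= X, P <= X & X <= (p ^ n)%:R / P].
  move=> n2k P X.
  have pm m : 1 <= (p : nat)%:R ^+ m :> R.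
    by rewrite -natrX ler1n expn_gt0 prime_gt0 // prime_valP.
  have P1 : 1 <= P by exact: pm.
  have P0 : 0 < P by apply: lt_le_trans P1.
  have X0 : 0 <= X by exact: sqrtr_ge0.
  have eX : X ^+ 2 = (p ^ n)%:R by rewrite sqr_sqrtr.
  have PX : P <= X.
    rewrite -(ler_pXn2r (ltn0Sn 1)) ?nnegrE ?(ltW P0) // eX natrX /P -exprM.
    by apply: ler_weXn2l; [rewrite -[(p : nat)%:R]expr1 pm|rewrite mulnC ltnW].
  split=> //; first exact: le_trans PX.
  by rewrite ler_pdivlMr // -eX expr2 ler_wpM2l.
have [ag|al|ae] := ltgtP 2^-1 a.
- have c0 : 0 <= 2 / (a - 2^-1) + 4 by rewrite addr_ge0 // divr_ge0 // subr_ge0 ltW.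
  exists ((9 + 20 * pi) * (4 * (2 / (a - 2^-1) + 4))).
    by rewrite mulr_ge0 ?(ltW pi0) // mulr_ge0.
  move=> p kappa n G W chi n2k n1 hprim G0 eG P1' PW hS Y hY.
  have [P1 X1 PX XY] := basic p kappa n n2k.
  rewrite mulr0n powRr0 mulr1.
  have := @smooth_sum_le_half R p n chi hprim n1 G _
    ((2 / (a - 2^-1) + 4) * Num.sqrt (p ^ n)%:R `^ (a - 2^-1)) a G0 hS
    (fun Z1 N Z0 => pmaj_sum_gt N ag a1 Z0 X1 XY) Y (le_trans XY hY).
  rewrite [G * _]mulrCA eG; lra.
- have s0 : 0 < 2^-1 - a by rewrite subr_gt0.
  set c := 2 / (a + 2^-1) + 2 `^ (2^-1 - a) / (2^-1 - a) + 4.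
  have c0 : 0 <= c.
    by rewrite !addr_ge0 // divr_ge0 ?powR_ge0 // ?(ltW s0) // addr_ge0.
  exists ((9 + 20 * pi) * (8 + 4 * c)).
    by rewrite mulr_ge0 ?(ltW pi0) // addr_ge0 // mulr_ge0.
  move=> p kappa n G W chi n2k n1 hprim G0 eG P1' PW hS Y hY.
  have [P1 X1 PX XY] := basic p kappa n n2k.
  rewrite mulr0n powRr0 mulr1.
  have := @smooth_sum_le_conv R p n chi hprim n1 G _ (c * Num.sqrt (p ^ n)%:R `^ (a - 2^-1)) a
    G0 P1 PX hS (fun N => pmaj_sum_lt N a0 al X1 XY (lexx _)) Y hY.
  move=> /le_trans; apply; rewrite [G * _]mulrCA eG -mulrA ler_pM2l //.
  by rewrite (_ : (8 + 4 * c) * W = 8 * W + c * (4 * W)) ?lerD2r ?ler_pM2l //; ring.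
(* 44 = 4 * 11: as ln q >= 1/2, the bound 5 + ln(sqrt q) of [pmaj_sum_eq] is at most 11 ln q, and G
   = 4 W. *)
exists ((9 + 20 * pi) * 44); first by rewrite mulr_ge0 ?(ltW pi0).
move=> p kappa n G W chi n2k n1 hprim G0 eG P1' PW hS Y hY.
have [P1 X1 PX XY] := basic p kappa n n2k.
rewrite mulr1n powRr1; last by apply: le_trans (ln_q_ge p (ltnW n1)).
move: eG hS; rewrite -ae subrr powRr0 mulr1 => eG hS.
have := @smooth_sum_le_half R p n chi hprim n1 G _ (5 + ln (Num.sqrt (p ^ n)%:R)) 2^-1 G0 hS
    (fun Z1 N Z0 => pmaj_sum_eq N Z0 X1 XY) Y (le_trans XY hY).
move=> /le_trans; apply; rewrite eG -[leRHS]mulrA ler_pM2l //.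
rewrite [leRHS](_ : _ = 4 * W * (11 * ln ((p : nat)%:R ^+ n))); last by ring.
have W0 : 0 < W by apply: lt_le_trans PW; apply: lt_le_trans P1'.
rewrite ler_pM2l ?mulr_gt0 //.
have lq := ln_q_ge p (ltnW n1).
have : ln (Num.sqrt (p ^ n)%:R) <= ln ((p : nat)%:R ^+ n) :> R.
  rewrite ler_ln ?posrE ?(lt_le_trans ltr01 X1) //; last first.
    by rewrite exprn_gt0 // ltr0n prime_gt0 // prime_valP.
  by rewrite -natrX -[leRHS]sqr_sqrtr // expr2 ler_peMl // (le_trans ler01).
lra.
Qed.

End CentralValue.

Theorem theorem6 (R : realType) (k l : R)
    (r : rat -> prime_nat -> nat -> R -> R) (delta : R)
    (n0 u0 : rat -> prime_nat -> nat -> R -> nat)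
    (kappa0 : rat -> prime_nat -> nat) (lambda0 : rat -> prime_nat -> R)
    (hq : padic_exponent_datum k l r delta n0 u0 kappa0 lambda0) :
  let delta' : R := if l == k + 2^-1 then 1 else 0 in
  (k + 2^-1 <= l ->
   exists C : R,
   forall (p : prime_nat) (kappa : nat) (lambda : R) (n : nat) (chi : int -> R[i]),
     (maxn (kappa0 1%R p) (1 + iota' p 2) <= kappa)%N ->
     rhoN p lambda -> lambda0 1 p <= lambda ->
     (maxn (n0 1%R p kappa lambda + kappa) (2 * kappa) <= n)%N ->
     primitive_character (p ^ n)%N chi ->
     `| dirichlet_L chi 2^-1 | <=
       (C * (p%:R `^ (r 1 p kappa lambda + kappa%:R * (1 - k - l))
             * (p%:R ^+ n) `^ ((k + l) / 2 - 4^-1)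
             * ln (p%:R ^+ n) `^ (delta + delta')))%:C)
  /\
  (l < k + 2^-1 ->
   exists C : R,
   forall (p : prime_nat) (kappa : nat) (n : nat) (chi : int -> R[i]),
     (maxn (kappa0 1%R p) (1 + iota' p 4%R) <= kappa)%N -> lambda0 1 p <= kappa%:R ->
     (maxn (n0 1%R p kappa kappa%:R%R + kappa) (2 * kappa + 1 + iota' p 12%R) <= n)%N ->
     primitive_character (p ^ n)%N chi ->
     `| dirichlet_L chi 2^-1 | <=
       (C * (p%:R `^ (r 1 p kappa kappa%:R + kappa%:R * (1 - k - l))
             * (p%:R ^+ n) `^ ((k + l) / 2 - 4^-1)
             * ln (p%:R ^+ n) `^ delta))%:C).
Proof.
have [C hC] := L_half_le hq.
move=> delta'; split=> hl; exists C => p kappa.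
  move=> lambda n chi; rewrite !geq_max => /andP[h1 h2] hlam h3 /andP[h4 _] hprim.
  have -> : delta' = (l - k == 2^-1)%:R.
    by rewrite /delta' subr_eq addrC; case: eqP.
  exact: hC.
move=> n chi; rewrite !geq_max => /andP[h1 h2] h3 /andP[h4 _] hprim.
have := hC p kappa n kappa%:R chi _ _ h1 h3 h4 hprim.
rewrite (_ : (l - k == 2^-1) = false) ?addr0; last by apply/negP => /eqP; lra.
apply.
  (* The valuation of 4 is at least that of 2, so the hypothesis on kappa gives the one with
     [iota' p 2]. *)
  by apply: leq_trans h2; rewrite leq_add2l iota'2_logn (_ : iota' p 4 = logn p 4) ?dvdn_leq_log //
    /iota' /ordq /= logn1; lia.
have p1 : (1 < p)%N by rewrite prime_gt1 // prime_valP.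
(* lambda = kappa is the multiple (p - 1) kappa of rho_p = 1/(p - 1). *)
exists ((p - 1) * kappa)%N.
  by rewrite muln_gt0 subn_gt0 p1 (leq_trans _ h2).
rewrite /rho natrM natrB ?(ltnW p1) // mulKf // subr_eq0.
by rewrite pnatr_eq1 gtn_eqF.
Qed.
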